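(* Let $\lambda=(\lambda_1,\ldots,\lambda_r)$, $\lambda_1\ge\cdots\ge\lambda_r\ge1$, be a partition and let $Z$ be a set of double points in $\mathbb{P}^1\times\mathbb{P}^1$ whose support $X$ is ACM with $\alpha_X=\lambda$. Then the following procedure, with input $\lambda$, outputs multisets $\mathcal{SZ}_0,\mathcal{SZ}_1,\mathcal{SZ}_2$ that are the shifts in the bigraded minimal free resolution of $I_Z$; that is, the bigraded minimal free resolution of $I_Z$ has the form $$0\rightarrow\bigoplus_{(a,b)\in\mathcal{SZ}_2}S(-a,-b)\rightarrow\bigoplus_{(a,b)\in\mathcal{SZ}_1}S(-a,-b)\rightarrow\bigoplus_{(a,b)\in\mathcal{SZ}_0}S(-a,-b)\rightarrow I_Z\rightarrow0.$$ Step 1. Set $$\mathcal{SY}_0=\{(2r,0),(r,\lambda_1),(0,2\lambda_1)\}\cup\{(i-1,\lambda_1+\lambda_i),(i+r-1,\lambda_i) : 2\le i\le r,\ \lambda_i-\lambda_{i-1}<0\},$$ $$\mathcal{SY}_1=\{(2r,\lambda_r),(r,\lambda_1+\lambda_r)\}\cup\{(i-1,\lambda_1+\lambda_{i-1}),(i+r-1,\lambda_{i-1}) : 2\le i\le r,\ \lambda_i-\lambda_{i-1}<0\}.$$ Step 2. Set $\mathcal{C}_0=\{(i,\lambda_i+1) : 2\le i\le r,\ \lambda_i-\lambda_{i-1}<0\}$, $\mathcal{C}_1=\{(i,l) : (i,j),(k,l)\in\mathcal{C}_0,\ i>k\}$, and $\mathcal{C}=\mathcal{C}_0\cup\mathcal{C}_1$,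 ordered lexicographically from largest to smallest. Step 3. Let $\mathcal{M}$ be the $r\times\lambda_1$ matrix with $\mathcal{M}_{i,j}=2$ if $j\le\lambda_i$ and $1$ otherwise. Set $\mathcal{SZ}_0:=\mathcal{SY}_0$, $\mathcal{SZ}_1:=\mathcal{SY}_1$, $\mathcal{SZ}_2:=\emptyset$. For each $(i,j)\in\mathcal{C}$, working from largest to smallest, do the following with the current matrix $\mathcal{M}$: put $$u=\mathcal{M}_{1,j}+\cdots+\mathcal{M}_{i-1,j},\quad v=\mathcal{M}_{i,1}+\cdots+\mathcal{M}_{i,j-1},\quad a=\mathcal{M}_{i,j}+\cdots+\mathcal{M}_{r,j},\quad b=\mathcal{M}_{i,j}+\cdots+\mathcal{M}_{i,\lambda_1};$$ adjoin $(u,v)$ to $\mathcal{SZ}_0$, adjoin $(u+a,v)$ and $(u,v+b)$ to $\mathcal{SZ}_1$, and adjoin $(u+a,v+b)$ to $\mathcal{SZ}_2$ (all counted with multiplicity); then replace $\mathcal{M}_{i',j'}$ by $0$ for all $(i',j')$ with $i'\ge i$ and $j'\ge j$. Step 4. Return $\mathcal{SZ}_0,\mathcal{SZ}_1,\mathcal{SZ}_2$.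
   Context: $k$ is an algebraically closed field of characteristic zero, and $S=k[x_0,x_1,y_0,y_1]$ is $\mathbb{N}^2$-graded with $\deg x_i=(1,0)$, $\deg y_i=(0,1)$; it is the coordinate ring of $\mathbb{P}^1\times\mathbb{P}^1$. A point $P=R\times Q\in\mathbb{P}^1\times\mathbb{P}^1$ has defining ideal $I_P=(L_R,L_Q)$, where $L_R$ (degree $(1,0)$) and $L_Q$ (degree $(0,1)$) are linear forms vanishing at $R$, resp. $Q$. A set of double points $Z$ with support a finite set of points $X$ has defining ideal $I_Z=\bigcap_{P\in X}I_P^2$. A set of points $X$ with defining ideal $I_X=\bigcap_{P\in X}I_P$ is arithmetically Cohen-Macaulay (ACM) if $S/I_X$ is Cohen-Macaulay. If $\pi_1(X)=\{R_1,\ldots,R_r\}$ is the set of distinct first coordinates of points of $X$, the partition $\alpha_X$ lists the numbers $|\{P\in X : \pi_1(P)=R_i\}|$, $i=1,\dots,r$, in non-increasing order. *)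

(* Defs.v *)
From HB Require Import structures.
From mathcomp Require Import all_boot all_order all_algebra.
From mathcomp Require Import finmap.
From mathcomp Require Import mpoly.

Set Implicit Arguments.
Unset Strict Implicit.
Unset Printing Implicit Defensive.

Import GRing.Theory.
Local Open Scope ring_scope.

Section ProjectiveLine.
Variable k : fieldType.

Record P1 := MkP1 {
  line_of :> {vspace 'rV[k]_2};
  _ : \dim line_of == 1%N
}.

HB.instance Definition _ := [isSub for line_of].
HB.instance Definition _ := [Choice of P1 by <:].

(* Homogeneous coordinates of a point, well defined up to a nonzero scalar:
   a chosen spanning vector of the line. *)
Definition hcoord (R : P1) (i : 'I_2) : k := vpick R 0 i.
End ProjectiveLine.

(* Ideals are handled as Prop-valued predicates on the ring. *)
Section Ideals.
Variable S : comNzRingType.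
Implicit Types I J m : S -> Prop.

Definition sub_pred I J : Prop := forall f, I f -> J f.

Definition is_ideal I : Prop :=
  [/\ I 0, (forall f g, I f -> I g -> I (f + g))
    & (forall a f, I f -> I (a * f))].

Definition ideal_gen (s : seq S) : S -> Prop :=
  fun f => exists c : 'I_(size s) -> S, f = \sum_i c i * s`_i.

Definition ideal_add I J : S -> Prop :=
  fun f => exists g h, [/\ I g, J h & f = g + h].

Definition ideal_mul I J : S -> Prop :=
  fun f => exists n, exists g h : 'I_n -> S,
    [/\ (forall i, I (g i)), (forall i, J (h i)) & f = \sum_i g i * h i].

Definition is_prime_ideal I : Prop :=
  [/\ is_ideal I, ~ I 1 & (forall f g, I (f * g) -> I f \/ I g)].

(* The quotient S/I is not formed: its primes are the primes of S containing
   I, and regular sequences on S/I are regular sequences modulo I. *)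

(* p 0 < p 1 < ... < p n is a chain of primes of S/I. *)
Definition prime_chain I (n : nat) (p : nat -> S -> Prop) : Prop :=
  (forall i, (i <= n)%N -> is_prime_ideal (p i) /\ sub_pred I (p i)) /\
  (forall i, (i < n)%N ->
     sub_pred (p i) (p i.+1) /\ ~ sub_pred (p i.+1) (p i)).

Definition quot_krull_dim I (d : nat) : Prop :=
  (exists p, prime_chain I d p) /\
  (forall n p, prime_chain I n p -> (n <= d)%N).

Definition regular_seq_mod I (fs : seq S) : Prop :=
  (forall i, (i < size fs)%N -> forall g,
     ideal_add I (ideal_gen (take i fs)) (fs`_i * g) ->
     ideal_add I (ideal_gen (take i fs)) g) /\
  ~ ideal_add I (ideal_gen fs) 1.

Definition quot_depth m I (d : nat) : Prop :=
  (exists fs, [/\ size fs = d, (forall f, f \in fs -> m f)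
                & regular_seq_mod I fs]) /\
  (forall fs, (forall f, f \in fs -> m f) -> regular_seq_mod I fs ->
     (size fs <= d)%N).

(* Cohen-Macaulayness of a graded quotient S/I, where m is the homogeneous
   maximal ideal of S and I is homogeneous: depth = Krull dimension. *)
Definition quot_CM m I : Prop :=
  exists d, quot_krull_dim I d /\ quot_depth m I d.
End Ideals.

Section DoublePoints.
Variable k : fieldType.

Local Notation S := {mpoly k[4]}.

Definition x0 : S := 'X_(inord 0).
Definition x1 : S := 'X_(inord 1).
Definition y0 : S := 'X_(inord 2).
Definition y1 : S := 'X_(inord 3).

Definition irr_ideal : S -> Prop := ideal_gen [:: x0; x1; y0; y1].

Definition bideg (m : 'X_{1..4}) : nat * nat :=
  ((m (inord 0) + m (inord 1))%N, (m (inord 2) + m (inord 3))%N).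

(* The linear forms, unique up to a nonzero scalar, vanishing at R and Q. *)
Definition L1 (R : P1 k) : S := hcoord R 1 *: x0 - hcoord R 0 *: x1.
Definition L2 (Q : P1 k) : S := hcoord Q 1 *: y0 - hcoord Q 0 *: y1.

Definition I_pt (P : P1 k * P1 k) : S -> Prop := ideal_gen [:: L1 P.1; L2 P.2].

Definition I_pts (X : {fset P1 k * P1 k}) : S -> Prop :=
  fun f => forall P, P \in X -> I_pt P f.

Definition I_dbl (X : {fset P1 k * P1 k}) : S -> Prop :=
  fun f => forall P, P \in X -> ideal_mul (I_pt P) (I_pt P) f.

Definition ACM (X : {fset P1 k * P1 k}) : Prop := quot_CM irr_ideal (I_pts X).

Definition proj1_pts (X : {fset P1 k * P1 k}) : {fset P1 k} :=
  [fset P.1 | P in X]%fset.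

Definition alpha (X : {fset P1 k * P1 k}) : seq nat :=
  sort geq [seq #|` [fset P in X | P.1 == R]%fset| | R <- proj1_pts X].

(* A multiset of shifts is a list s : seq (nat * nat); it stands for the free
   module F_s = \bigoplus_((a, b) <- s) S(-a, -b), whose elements are row
   vectors and whose i-th basis vector has degree s`_i.  A matrix A acts by
   v |-> v *m A, so its i-th row is the image of the i-th basis vector. *)
Definition degree0_map (s t : seq (nat * nat)) (A : 'M[S]_(size s, size t)) :
    Prop :=
  forall i j (m : 'X_{1..4}), m \in msupp (A i j) ->
    (bideg m).1 + (nth (0, 0) t j).1 = (nth (0, 0) s i).1 /\
    (bideg m).2 + (nth (0, 0) t j).2 = (nth (0, 0) s i).2.

(* The image of A lies in irr_ideal * F_t. *)
Definition minimal_map (s t : seq (nat * nat)) (A : 'M[S]_(size s, size t)) :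
    Prop :=
  forall i j, irr_ideal (A i j).

(* 0 -> F_s2 -> F_s1 -> F_s0 -> I -> 0 is, for suitable maps, a bigraded
   minimal free resolution of I.  The augmentation F_s0 -> I is given as a
   map to S = F_[:: (0, 0)] with image I. *)
Definition has_min_resolution (I : S -> Prop) (s0 s1 s2 : seq (nat * nat)) :
    Prop :=
  exists (d0 : 'M[S]_(size s0, size [:: (0%N, 0%N)]))
         (d1 : 'M[S]_(size s1, size s0)) (d2 : 'M[S]_(size s2, size s1)),
  [/\ [/\ degree0_map d0, degree0_map d1 & degree0_map d2],
      minimal_map d1 /\ minimal_map d2
    & [/\ (forall f, I f <-> exists v : 'rV_(size s0), (v *m d0) 0 0 = f),
          (forall v : 'rV_(size s0),
             v *m d0 = 0 <-> exists w : 'rV_(size s1), v = w *m d1),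
          (forall v : 'rV_(size s1),
             v *m d1 = 0 <-> exists w : 'rV_(size s2), v = w *m d2)
        & (forall v : 'rV_(size s2), v *m d2 = 0 -> v = 0)]].
End DoublePoints.

Definition is_partition (la : seq nat) : bool := sorted geq la && (0%N \notin la).

(* All indices below start from 1. *)
Section Shifts.
Local Open Scope nat_scope.
Variable la : seq nat.

Definition part (i : nat) : nat := nth 0 la i.-1.
Local Notation r := (size la).

(* the i with 2 <= i <= r and part i < part (i - 1) *)
Definition descents : seq nat := [seq i <- index_iota 2 r.+1 | part i < part i.-1].

Definition SY0 : seq (nat * nat) :=
  [:: (2 * r, 0); (r, part 1); (0, 2 * part 1)]
  ++ [seq (i - 1, part 1 + part i) | i <- descents]
  ++ [seq (i + r - 1, part i) | i <- descents].

Definition SY1 : seq (nat * nat) :=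
  [:: (2 * r, part r); (r, part 1 + part r)]
  ++ [seq (i - 1, part 1 + part i.-1) | i <- descents]
  ++ [seq (i + r - 1, part i.-1) | i <- descents].

Definition C0 : seq (nat * nat) := [seq (i, part i + 1) | i <- descents].

Definition C1 : seq (nat * nat) :=
  [seq (pq.1.1, pq.2.2) | pq <- [seq (p, q) | p <- C0, q <- C0] & pq.2.1 < pq.1.1].

Definition lex_ge (p q : nat * nat) : bool :=
  (q.1 < p.1) || (q.1 == p.1) && (q.2 <= p.2).

Definition C : seq (nat * nat) := sort lex_ge (undup (C0 ++ C1)).

(* The r x part 1 matrix is a function of which only the values at
   1 <= i <= r, 1 <= j <= part 1 are used. *)
Definition M0 (i j : nat) : nat := if j <= part i then 2 else 1.

Record state := State {
  mat : nat -> nat -> nat;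
  st0 : seq (nat * nat);
  st1 : seq (nat * nat);
  st2 : seq (nat * nat)
}.

Definition step (s : state) (c : nat * nat) : state :=
  let: (i, j) := c in
  let M := mat s in
  let u := \sum_(1 <= i' < i) M i' j in
  let v := \sum_(1 <= j' < j) M i j' in
  let a := \sum_(i <= i' < r.+1) M i' j in
  let b := \sum_(j <= j' < (part 1).+1) M i j' in
  State (fun i' j' => if (i <= i') && (j <= j') then 0 else M i' j')
    ((u, v) :: st0 s)
    [:: (u + a, v), (u, v + b) & st1 s]
    ((u + a, v + b) :: st2 s).

Definition final : state := foldl step (State M0 SY0 SY1 [::]) C.

Definition SZ0 : seq (nat * nat) := st0 final.
Definition SZ1 : seq (nat * nat) := st1 final.
Definition SZ2 : seq (nat * nat) := st2 final.
End Shifts.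

(* Main.v *)
From HB Require Import structures.
Require Import Defs.
From mathcomp Require Import all_boot all_order all_algebra.
From mathcomp Require Import finmap.
From mathcomp Require Import mpoly.
From mathcomp Require Import ring zify.

(** Write H_i, V_j for the linear forms of the rows and columns of the support
    X, ordered so that X = {(i, j) : j <= lambda_i}; that X has this shape is
    what the Cohen-Macaulay hypothesis gives.  Let p_0 = 0 < ... < p_n = r be
    the rows at which lambda jumps and q_t = lambda_(p_t + 1).  The ideal I_X
    is generated by the G_t = H_1 ... H_(p_t) V_1 ... V_(q_t), with
    Hilbert-Burch relations l_t = A_t e_t - B_t e_(t+1), where
    A_t = G_(t+1) / gcd and B_t = G_t / gcd.  The key fact is I_Z = I_X^2, and
    the square is resolved by the degree 2 strand of the Koszul complex on the
    l_t over S[e_0, ..., e_n]: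
      0 -> /\^2 F -> F (x) G -> Sym^2 G -> I_X^2 -> 0,
    with entries that are products of linear forms.  The generators e_s e_t and
    the relations account exactly for the shifts produced by the algorithm: an
    element (p_s + 1, q_t + 1) of C contributes e_t e_s, f_s e_t, f_(t-1) e_s
    and f_(t-1) /\ f_s, and the remaining ones are SY_0 and SY_1.

    For I_Z = I_X^2, a linear form in x avoiding the rows is regular modulo
    I_X^2 (the syzygies of the G_s G_t survive restriction to its zero line),
    while some power of it multiplies I_Z into I_X^2, by looking at one row at
    a time. *)

Set Implicit Arguments.
Unset Strict Implicit.
Unset Printing Implicit Defensive.
Import GRing.Theory.

(** * The degree 2 Koszul strand of a staircase *)

(** The nested shape of X comes from depth. When S/I_X has depth at least 2, no nonzero element of
    the cokernel of S/I_X -> prod_P S/I_P is killed by a power of the irrelevant ideal. Two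
    incomparable rows would produce such an element: a family that along each row is a form in y
    whose degree is the number of their common columns.

    Quotients by a linear form are realized by substitutions S -> S that kill it and fix a
    complement. Every reduction thus stays inside a domain, and the exactness results, which assume
    only regularity of the A_i and B_j, apply both to the staircase and to its restrictions to a
    line. For the same reason exactness is proved by recursion on the number of generators, with
    explicit preimages, and not by a rank and depth criterion.

    Cutting rows and columns at the actual drops of lambda, instead of using one relation per row,
    makes every A_t and B_t a nonempty product of linear forms; this is what makes the resolution
    minimal. *)

Section Staircase.
Local Open Scope ring_scope.
Variable S : comNzRingType.
Implicit Types (A B : nat -> S) (v w : nat -> nat -> S).

Definition nzd (b : S) := forall f, b * f = 0 -> f = 0.
Definition nzd_mod (a b : S) := forall f g, a * f = b * g -> exists h, f = b * h.

Definition gen A B n s : S := (\prod_(0 <= i < s) A i) * \prod_(s <= i < n) B i.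

(** The coefficient of e_s in l_a, total in s so that sums need no case split at the ends. *)
Definition lin A B a s : S := A a *+ (s == a) - B a *+ (s == a.+1).

Lemma sum_nat_eq n a (F : nat -> S) : (a < n)%N ->
  \sum_(0 <= s < n) F s *+ (s == a) = F a.
Proof.
move=> an; rewrite (bigD1_seq a) ?mem_index_iota ?iota_uniq //= eqxx mulr1n.
by rewrite big1 ?addr0 // => s /negPf->; rewrite mulr0n.
Qed.

Lemma sum_nat_eqS n a (F : nat -> S) : (a <= n)%N ->
  \sum_(0 <= s < n) F s *+ (s == a) = F a *+ (a < n).
Proof.
rewrite leq_eqVlt => /orP[/eqP-> | an]; last by rewrite sum_nat_eq ?an.
rewrite ltnn big_nat big1 // => s /andP[_ sn].
by rewrite (ltn_eqF sn) mulr0n.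
Qed.

Lemma genS A B n s : (s <= n)%N -> gen A B n.+1 s = B n * gen A B n s.
Proof. by move=> sn; rewrite /gen big_nat_recr //= mulrA mulrC. Qed.

Lemma gen_last A B n : gen A B n n = \prod_(0 <= i < n) A i.
Proof. by rewrite /gen [X in _ * X]big_geq // mulr1. Qed.

Lemma gen_lastS A B n : gen A B n.+1 n.+1 = A n * gen A B n n.
Proof. by rewrite !gen_last big_nat_recr //= mulrC. Qed.

Lemma gen_rel A B n a : (a < n)%N ->
  A a * gen A B n a = B a * gen A B n a.+1.
Proof.
move=> an; rewrite /gen (big_ltn an) big_nat_recr //=; ring.
Qed.

Lemma lin_syz A B n a : (a < n)%N ->
  \sum_(0 <= s < n.+1) lin A B a s * gen A B n s = 0.
Proof.
move=> an.
under eq_bigr => s _ do rewrite /lin mulrBl !mulrnAl.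
by rewrite big_split /= sumrN !sum_nat_eq ?(ltnW an) ?gen_rel ?subrr // ltnS ltnW.
Qed.

Lemma sum_lin_syz A B n (z : nat -> S) m : (m <= n)%N ->
  \sum_(0 <= s < n.+1) (\sum_(0 <= a < m) z a * lin A B a s) * gen A B n s = 0.
Proof.
move=> mn; under eq_bigr => s _ do rewrite mulr_suml.
rewrite exchange_big big_nat big1 // => a /andP[_ am].
under eq_bigr => s _ do rewrite -mulrA.
by rewrite -mulr_sumr lin_syz ?mulr0 // (leq_trans am).
Qed.

Lemma lin_big A B a s : (a.+1 < s)%N -> lin A B a s = 0.
Proof.
by move=> as1; rewrite /lin !gtn_eqF ?(ltnW as1) // !mulr0n subrr.
Qed.

Lemma nzd_mod_prod A (b : S) m n :
  (forall i, (m <= i < n)%N -> nzd_mod (A i) b) -> nzd_mod (\prod_(m <= i < n) A i) b.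
Proof.
case: (leqP n m) => [nm _ | mn].
  by rewrite big_geq // => f g; rewrite mul1r; exists g.
elim: n mn => // n IH mn hA f g.
move: mn; rewrite ltnS leq_eqVlt => /orP[/eqP mn | mn].
  rewrite -{}mn in hA *; rewrite big_nat1; apply: hA; lia.
rewrite big_nat_recr ?(ltnW mn) //= -mulrA => /IH[||h].
- by [].
- by move=> i hi; apply: hA; lia.
- by apply: hA; lia.
Qed.

(** Every generator but the last is divisible by B_n, and the last is a product of A's, so B_n
    divides its coefficient. A multiple of l_n removes that coefficient, and cancelling B_n leaves a
    syzygy of the shorter staircase. *)
Lemma hilbert_burch A B n (w : nat -> S) :
  (forall j, (j < n)%N -> nzd (B j)) ->
  (forall i j, (i < n)%N -> (j < n)%N -> nzd_mod (A i) (B j)) ->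
  \sum_(0 <= s < n.+1) w s * gen A B n s = 0 ->
  exists z, forall s, (s <= n)%N -> w s = \sum_(0 <= a < n) z a * lin A B a s.
Proof.
elim: n w => [|n IH] w hB hA.
  rewrite big_nat1 /gen !big_geq // !mulr1 => w0; exists (fun=> 0) => s.
  by rewrite leqn0 => /eqP->; rewrite big_geq.
rewrite big_nat_recr //= (eq_big_nat _ _ (F2 := fun s => B n * (w s * gen A B n s))).
  2: by move=> s /andP[_]; rewrite ltnS => sn; rewrite genS // mulrCA.
rewrite -mulr_sumr; set X := \sum_(_ <= _ < _) _ => e.
have [h wh] : exists h, w n.+1 = B n * h.
  have := @nzd_mod_prod A (B n) 0 n.+1 _ (w n.+1) (- X); rewrite -(gen_last A B) => H.
  apply: H => [i /andP[_ i_n]|]; first exact: hA.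
  by rewrite mulrN; apply/eqP; rewrite -addr_eq0 addrC mulrC [_ * w _]mulrC mulrC e.
have [|||z zP] := IH (fun s => w s + (h * A n) *+ (s == n)).
- by move=> j jn; apply: hB; lia.
- by move=> i j ni nj; apply: hA; lia.
- under eq_bigr => s _ do rewrite mulrDl mulrnAl.
  rewrite big_split /= sum_nat_eq // -/X.
  by apply: (hB n (ltnSn n)); rewrite -[RHS]e wh gen_lastS; ring.
exists (fun a => if a == n then - h else z a) => s sn.
rewrite big_nat_recr //= eqxx.
rewrite (eq_big_nat _ _ (F2 := fun a => z a * lin A B a s)).
  2: by move=> a /andP[_ an]; rewrite (ltn_eqF an).
move: sn; rewrite leq_eqVlt => /orP[/eqP-> | sn].
  rewrite big_nat big1 => [|a /andP[_ an]]; last by rewrite lin_big ?mulr0.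
  by rewrite /lin gtn_eqF // eqxx mulr0n mulr1n wh; ring.
rewrite -zP // /lin (ltn_eqF sn) mulr0n subr0.
by case: eqP => _; rewrite ?mulr0n ?mulr1n; ring.
Qed.

Definition sym2 (X : nat -> nat -> S) s t := X s t + X t s *+ (s != t).

(** The map f_a (x) e_t |-> l_a (x) e_t; followed by [sym2] it is the middle differential of the
    strand. *)
Definition lin_mul A B n w s t := \sum_(0 <= a < n) lin A B a s * w a t.

Definition quad_eval A B n v :=
  \sum_(0 <= t < n.+1) \sum_(0 <= s < t.+1) v s t * (gen A B n s * gen A B n t).

(* Recursion on [n]: the coefficient at (n+1, n+1) is divisible by B_n, which
   allows to kill it; then the last column becomes B_n y plus a syzygy of the
   generators with index at most n, because B_n is regular modulo these. *)
Lemma quad_syz A B n v :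
  (forall j, (j < n)%N -> nzd (B j)) ->
  (forall i j, (i < n)%N -> (j < n)%N -> nzd_mod (A i) (B j)) ->
  (forall j d (y : nat -> S), (j < n)%N ->
     B j * d = \sum_(0 <= s < j.+1) y s * gen A B j s ->
     exists y' : nat -> S, d = \sum_(0 <= s < j.+1) y' s * gen A B j s) ->
  quad_eval A B n v = 0 ->
  exists w, forall s t, (s <= t <= n)%N -> v s t = sym2 (lin_mul A B n w) s t.
Proof.
elim: n v => [|n IH] v hB hA hI.
  rewrite /quad_eval !big_nat1 /gen !big_geq // !mulr1 => v0.
  exists (fun _ _ => 0) => s t; rewrite leqn0 => /andP[+ /eqP t0].
  by rewrite t0 leqn0 => /eqP->; rewrite /sym2 /lin_mul big_geq // mul0rn addr0.
set G := gen A B n; set P := G n.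
rewrite /quad_eval big_nat_recr //= [X in _ + X]big_nat_recr //=.
set Q := \sum_(0 <= t < n.+1) _; set C := \sum_(0 <= s < n.+1) _ => e.
have eQ : Q = B n ^+ 2 * quad_eval A B n v.
  rewrite /Q /quad_eval mulr_sumr; apply: eq_big_nat => t /andP[_ tn].
  rewrite mulr_sumr; apply: eq_big_nat => s /andP[_ st].
  by rewrite !genS //; [ring | lia].
have eC : C = B n * (A n * P) * \sum_(0 <= s < n.+1) v s n.+1 * G s.
  rewrite /C mulr_sumr; apply: eq_big_nat => t /andP[_ tn].
  by rewrite gen_lastS genS // -/G -/P; ring.
have hP : nzd_mod (A n * P) (B n).
  rewrite -gen_lastS gen_last; apply: nzd_mod_prod => i /andP[_ i_n]; exact: hA.
rewrite gen_lastS -/G -/P in e.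
have [x vx] : exists x, v n.+1 n.+1 = B n * x.
  have [|g] := hP (A n * P * v n.+1 n.+1)
    (- (B n * quad_eval A B n v) - A n * P * \sum_(0 <= s < n.+1) v s n.+1 * G s).
    by apply/eqP; rewrite -subr_eq0; apply/eqP; rewrite -[RHS]e eQ eC; ring.
  exact: hP.
set Y := \sum_(0 <= s < n.+1) v s n.+1 * G s in eC.
have e1 : B n * quad_eval A B n v + A n * P * (Y + x * (A n * P)) = 0.
  by apply: (hB n (ltnSn n)); rewrite -[RHS]e eQ eC vx; ring.
have [d Yd] : exists d, Y + x * (A n * P) = B n * d.
  apply: (hP _ (- quad_eval A B n v)); rewrite mulrN.
  by apply/eqP; rewrite -addr_eq0 addrC e1.
have eY : B n * d = \sum_(0 <= s < n.+1) (v s n.+1 + (x * A n) *+ (s == n)) * G s.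
  under eq_bigr => s _ do rewrite mulrDl mulrnAl.
  by rewrite big_split /= sum_nat_eq // -/Y -Yd /P mulrA.
have [y dy] := hI n _ _ (ltnSn n) eY.
have hB' j : (j < n)%N -> nzd (B j) by move=> jn; apply: hB; lia.
have hA' i j : (i < n)%N -> (j < n)%N -> nzd_mod (A i) (B j).
  by move=> ni nj; apply: hA; lia.
have hI' j d' (y' : nat -> S) : (j < n)%N ->
     B j * d' = \sum_(0 <= s < j.+1) y' s * gen A B j s ->
     exists y' : nat -> S, d' = \sum_(0 <= s < j.+1) y' s * gen A B j s.
  by move=> jn; apply: hI; lia.
have [|z zP] := @hilbert_burch A B n
  (fun s => v s n.+1 + (x * A n) *+ (s == n) - B n * y s) hB' hA'.
  under eq_bigr => s _ do rewrite mulrBl -mulrA.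
  by rewrite big_split /= sumrN -mulr_sumr -dy -eY subrr.
(* Subtracting the multiples -y_s of l_n e_s, which take B_n y_s out of the last column, adds A_n
   y_s to column n. *)
have [||||w wP] := IH (fun s t => v s t + (A n * y s) *+ (t == n)) => //.
  have e2 : quad_eval A B n v + A n * P * d = 0.
    apply: (hB n (ltnSn n)); rewrite mulrDr; move: e1; rewrite Yd => <-; ring.
  rewrite -e2 /quad_eval.
  under eq_big_nat => t _.
    under eq_big_nat => s _ do rewrite mulrDl mulrnAl.
    rewrite big_split /= sumrMnl; over.
  rewrite big_split /= (@sum_nat_eq n.+1 n (fun t => \sum_(0 <= s < t.+1) _)) //.
  congr (_ + _); rewrite dy mulr_sumr; apply: eq_bigr => s _.
  by rewrite -/G /P; ring.
(* f_n e_(n+1) gets -x and so produces the corner B_n x; f_n e_b gets -y_b; f_a e_(n+1) gets the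
   syzygy z_a left in the last column. *)
exists (fun a b => if a == n then (if b == n.+1 then - x else - y b)
                   else if b == n.+1 then z a else w a b) => s t /andP[st tn].
set w' := fun a b => _.
have Xe s' t' : lin_mul A B n.+1 w' s' t' = lin A B n s' * w' n t' +
    \sum_(0 <= a < n) lin A B a s' * (if t' == n.+1 then z a else w a t').
  rewrite /lin_mul big_nat_recr //= addrC; congr (_ + _).
  by apply: eq_big_nat => a /andP[_ an]; rewrite /w' (ltn_eqF an).
have X0 t' : \sum_(0 <= a < n) lin A B a n.+1 * (if t' == n.+1 then z a else w a t') = 0.
  by rewrite big_nat big1 // => a /andP[_ an]; rewrite lin_big ?mul0r.
have linn s' : (s' <= n)%N -> lin A B n s' = A n *+ (s' == n).
  by move=> sn; rewrite /lin [s' == n.+1]ltn_eqF // mulr0n subr0.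
have linn1 : lin A B n n.+1 = - B n by rewrite /lin eqxx gtn_eqF // mulr0n sub0r.
rewrite /sym2 !Xe; move: tn; rewrite leq_eqVlt => /orP[/eqP tn | tn].
  rewrite {}tn in st *; move: st; rewrite leq_eqVlt => /orP[/eqP-> | sn].
    by rewrite X0 eqxx mulr0n linn1 /w' !eqxx vx; ring.
  rewrite X0 linn1 linn // /w' !eqxx [s == n.+1]ltn_eqF //= mulr1n.
  have := zP s; rewrite ltnS in sn => /(_ sn) e3.
  under eq_bigr => a _ do rewrite mulrC.
  by rewrite -e3; case: (s == n); rewrite ?mulr1n ?mulr0n; ring.
have sn : (s < n.+1)%N by lia.
have := wP s t; rewrite st -ltnS tn => /(_ isT).
rewrite /sym2 /lin_mul [t == n.+1]ltn_eqF // [s == n.+1]ltn_eqF // /w' eqxx.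
rewrite [t == n.+1]ltn_eqF // [s == n.+1]ltn_eqF // !linn // => e3.
rewrite -[v s t](addrK ((A n * y s) *+ (t == n))) e3.
have [tn'|tn'] := eqVneq t n; have [sn'|sn'] := eqVneq s n.
- by rewrite sn' tn' eqxx /=; ring.
- have -> : (s != t) by lia.
  by rewrite tn' /=; ring.
- by lia.
- by case: (s != t) => /=; ring.
Qed.

Lemma sum_sym2 n X (F : nat -> nat -> S) : (forall s t, F s t = F t s) ->
  \sum_(0 <= t < n) \sum_(0 <= s < t.+1) sym2 X s t * F s t =
  \sum_(0 <= t < n) \sum_(0 <= s < n) X s t * F s t.
Proof.
move=> Fsym; elim: n => [|n IH]; first by rewrite !big_geq.
rewrite big_nat_recr //= IH [RHS]big_nat_recr //=.
rewrite [X in _ = _ + X]big_nat_recr //= [X in _ + X = _]big_nat_recr //=.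
rewrite [X in _ = X + _](eq_big_nat _ _
  (F2 := fun t => \sum_(0 <= s < n) X s t * F s t + X n t * F n t)).
  2: by move=> t _; rewrite big_nat_recr.
rewrite big_split /= -!addrA; congr (_ + _).
rewrite (eq_big_nat _ _ (F2 := fun s => X s n * F s n + X n s * F n s)).
  2: by move=> s /andP[_ sn]; rewrite /sym2 (ltn_eqF sn) mulrDl [F n s]Fsym.
by rewrite big_split /= /sym2 eqxx mulr0n addr0 -addrA addrCA.
Qed.

Lemma quad_eval_lin_mul A B n w : quad_eval A B n (sym2 (lin_mul A B n w)) = 0.
Proof.
rewrite /quad_eval (sum_sym2 _ _ (F := fun s t => gen A B n s * gen A B n t)).
  2: by move=> s t; rewrite mulrC.
rewrite big1 // => t _.
transitivity ((\sum_(0 <= s < n.+1) (\sum_(0 <= a < n) w a t * lin A B a s) * gen A B n s)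
   * gen A B n t); last by rewrite sum_lin_syz ?mul0r.
rewrite mulr_suml; apply: eq_bigr => s _; rewrite mulrA; congr (_ * _ * _).
by apply: eq_bigr => a _; rewrite mulrC.
Qed.

(** * The map from /\^2 F and exactness at F (x) G *)

Definition alt v a j := v a j *+ (a < j)%N - v j a *+ (j < a)%N.

Lemma altC v a j : alt v j a = - alt v a j.
Proof. by rewrite /alt opprB. Qed.

Lemma alt_diag v a : alt v a a = 0.
Proof. by rewrite /alt ltnn subrr. Qed.

(** The image of sum v_aj f_a /\ f_j over a < j, where f_a /\ f_j goes to f_a (x) l_j - f_j (x) l_a;
    [alt] is the antisymmetric extension of these coordinates. *)
Definition koszul A B n v a b := \sum_(0 <= j < n) alt v a j * lin A B j b.

Lemma lin_mul_koszul A B n v s t : sym2 (lin_mul A B n (koszul A B n v)) s t = 0.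
Proof.
pose Y s t := lin_mul A B n (koszul A B n v) s t.
have YE s' t' : Y s' t' = \sum_(0 <= a < n) \sum_(0 <= j < n)
    alt v a j * (lin A B a s' * lin A B j t').
  rewrite /Y /lin_mul; apply: eq_bigr => a _; rewrite /koszul mulr_sumr.
  by apply: eq_bigr => j _; rewrite mulrCA.
have Yanti s' t' : Y s' t' + Y t' s' = 0.
  rewrite !YE [X in _ + X]exchange_big /= -big_split big1 //= => a _.
  rewrite -big_split big1 //= => j _.
  rewrite (altC v a j) [lin A B j t' * _]mulrC mulNr subrr //.
rewrite /sym2 -/(Y s t) -/(Y t s); have [->|st] := eqVneq s t; last exact: Yanti.
rewrite mulr0n addr0 YE.
have H : forall m, \sum_(0 <= a < m) \sum_(0 <= j < m)
    alt v a j * (lin A B a t * lin A B j t) = 0.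
  elim=> [|m IH]; first by rewrite big_geq.
  rewrite big_nat_recr //= [X in _ + X]big_nat_recr //= alt_diag mul0r addr0.
  rewrite (eq_bigr _ (fun a _ => big_nat_recr m _ _ _)) //=.
  rewrite big_split /= IH add0r -big_split big1 //= => a _.
  by rewrite (altC v a m) mulNr [lin A B m t * _]mulrC subrr.
exact: H.
Qed.

(** The relations are in echelon form, l_a having the last entry -B_a at e_(a+1), so the
    coefficients vanish from the top one down. *)
Lemma lin_free A B n (z : nat -> S) : (forall j, (j < n)%N -> nzd (B j)) ->
  (forall b, (b <= n)%N -> \sum_(0 <= a < n) z a * lin A B a b = 0) ->
  forall a, (a < n)%N -> z a = 0.
Proof.
elim: n => // n IH hB h.
have zn : z n = 0.
  have := h n.+1 (leqnn _); rewrite big_nat_recr //= big_nat big1.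
    2: by move=> a /andP[_ an]; rewrite lin_big ?mulr0.
  rewrite add0r /lin gtn_eqF // eqxx mulr0n sub0r => e.
  by apply: (hB n) => //; apply/eqP; rewrite -oppr_eq0 mulrC -mulrN e.
move=> a; rewrite ltnS leq_eqVlt => /orP[/eqP-> //|].
apply: IH => [j jn|b bn]; first by apply: hB; lia.
by have := h b (leqW bn); rewrite big_nat_recr //= zn mul0r addr0.
Qed.

Lemma koszul_inj A B n v : (forall j, (j < n)%N -> nzd (B j)) ->
  (forall a b, (a < n)%N -> (b <= n)%N -> koszul A B n v a b = 0) ->
  forall a j, (a < j < n)%N -> v a j = 0.
Proof.
move=> hB h a j /andP[aj jn].
have := @lin_free A B n (alt v a) hB; rewrite /alt => /(_ _ j jn).
rewrite aj ltnNge (ltnW aj) subr0; apply=> b bn; apply: h => //; lia.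
Qed.

(** Induction on the number m of the f_a involved, the e_b still running up to n. The coefficients
    at e_(m+1) e_b show that the row of f_m vanishes beyond column m and that B_m times it is a
    combination of the l_a with a < m. Hence this row is a syzygy of the first m + 1 generators, say
    sum z_a l_a, and it is removed together with f_m by the boundaries of the f_a /\ f_m. *)
Lemma koszul_exact A B n m w : (m <= n)%N ->
  (forall j, (j < n)%N -> nzd (B j)) ->
  (forall i j, (i < n)%N -> (j < n)%N -> nzd_mod (A i) (B j)) ->
  (forall s t, (s <= t <= n)%N -> sym2 (lin_mul A B m w) s t = 0) ->
  exists v, forall a b, (a < m)%N -> (b <= n)%N -> w a b = koszul A B m v a b.
Proof.
move=> + hB hA; elim: m w => [|m IH] w mn h; first by exists (fun _ _ => 0).
have linm1 : lin A B m m.+1 = - B m by rewrite /lin eqxx gtn_eqF // mulr0n sub0r.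
have Lm1 t : lin_mul A B m.+1 w m.+1 t = - (B m * w m t).
  rewrite /lin_mul big_nat_recr //= big_nat big1 ?add0r ?linm1 ?mulNr //.
  by move=> a /andP[_ am]; rewrite lin_big ?mul0r.
have w0 b : (m < b <= n)%N -> w m b = 0.
  move=> /andP[mb bn]; apply: (hB m); first by lia.
  have := h m.+1 b; rewrite mb bn => /(_ isT); rewrite /sym2 Lm1.
  have [<-|nb] := eqVneq m.+1 b; first by rewrite mulr0n addr0 => /eqP; rewrite oppr_eq0 => /eqP.
  rewrite [lin_mul _ _ _ _ b _]/lin_mul big_nat big1 ?mul0rn ?addr0.
    by move/eqP; rewrite oppr_eq0 => /eqP.
  by move=> a /andP[_ am]; rewrite lin_big ?mul0r //; lia.
have wB b : (b <= m)%N -> B m * w m b = \sum_(0 <= a < m) w a m.+1 * lin A B a b.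
  move=> bm; have := h b m.+1; rewrite mn (leqW bm) => /(_ isT).
  rewrite /sym2 Lm1 ltn_eqF //= mulr1n {1}/lin_mul big_nat_recr //= w0 ?mulr0 ?addr0; last by lia.
  move/eqP; rewrite subr_eq0 => /eqP <-.
  by apply: eq_bigr => a _; rewrite mulrC.
have [j jm|i j im jm||z zP] := @hilbert_burch A B m (w m).
- by apply: hB; lia.
- by apply: hA; lia.
- apply: (hB m) => //; rewrite mulr_sumr.
  rewrite -[RHS](@sum_lin_syz A B m (w ^~ m.+1) m (leqnn m)).
  by apply: eq_big_nat => s /andP[_ sm]; rewrite mulrA wB.
have wm b : (b <= n)%N -> w m b = \sum_(0 <= a < m) z a * lin A B a b.
  move=> bn; have [bm|mb] := leqP b m; first exact: zP.
  rewrite w0 ?mb // big_nat big1 // => a /andP[_ am]; rewrite lin_big ?mulr0 //; lia.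
pose w' a b := w a b + z a * lin A B m b.
have [||v vP] := IH w'; [lia | move=> s t /andP[st tn] |].
  have := h s t; rewrite st tn => /(_ isT) <-.
  have E s' t' : (t' <= n)%N -> lin_mul A B m.+1 w s' t' = lin_mul A B m w' s' t' -
     (\sum_(0 <= a < m) lin A B a s' * z a) * lin A B m t' +
     lin A B m s' * (\sum_(0 <= a < m) z a * lin A B a t').
    move=> t'n; rewrite /lin_mul big_nat_recr //= wm //; congr (_ + _).
    rewrite mulr_suml -sumrB; apply: eq_bigr => a _; rewrite /w'; ring.
  rewrite /sym2 !E //; last by lia.
  set X := \sum_(_ <= _ < _) _ * lin A B _ _; set Y := \sum_(_ <= _ < _) _ * lin A B _ _.
  have -> : \sum_(0 <= a < m) lin A B a s * z a = Y.
    by apply: eq_bigr => a _; rewrite mulrC.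
  have -> : \sum_(0 <= a < m) lin A B a t * z a = X.
    by apply: eq_bigr => a _; rewrite mulrC.
  have [e|_] := eqVneq s t; last by rewrite /= mulr1n; ring.
  by rewrite /Y /X e /= !mulr0n; ring.
exists (fun a j => if j == m then - z a else v a j) => a b am bn.
rewrite /koszul big_nat_recr //=.
move: am; rewrite ltnS leq_eqVlt => /orP[/eqP-> | am].
  rewrite alt_diag mul0r addr0 wm //; apply: eq_big_nat => j /andP[_ jm].
  by rewrite /alt jm eqxx ltnNge (ltnW jm) mulr0n mulr1n sub0r opprK.
have := vP a b am bn; rewrite /w' => /(canRL (addrK _)) ->.
rewrite /alt am ltnNge (ltnW am) eqxx mulr0n mulr1n subr0 mulNr; congr (_ - _).
apply: eq_big_nat => j /andP[_ jm]; rewrite /alt (ltn_eqF jm).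
by rewrite (ltn_eqF am).
Qed.
End Staircase.

(** * Linear forms and linear projections *)

Section Forms.
Local Open Scope ring_scope.
Variable k : fieldType.
Local Notation S := {mpoly k[4]}.
Implicit Types (f g : S) (R Q : P1 k) (A B : nat -> S).

Lemma mpoly_alg_ind (P : S -> Prop) :
  (forall c : k, P c%:MP) -> (forall i, P 'X_i) ->
  (forall f g, P f -> P g -> P (f + g)) ->
  (forall f g, P f -> P g -> P (f * g)) -> forall f, P f.
Proof.
move=> PC PX PD PM f; rewrite (mpolyE f).
have P0 : P 0 by rewrite -(mpolyC0 4); exact: PC.
have P1 : P 1 by rewrite -(mpolyC1 4); exact: PC.
apply: big_ind => [//|x y|m _]; first exact: PD.
rewrite -mul_mpolyC; apply: (PM) => //.
rewrite mpolyXE_id; apply: big_ind => [//|x y|i _]; first exact: PM.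
by elim: (m i) => [|n IH]; rewrite ?expr0 // exprS; apply: (PM).
Qed.

Lemma nzd_neq0 f : f != 0 -> nzd f.
Proof. by move=> /negPf f0 g /eqP; rewrite mulf_eq0 f0 => /eqP. Qed.

Lemma nzd_modM_l (a a' b : S) : nzd_mod a b -> nzd_mod a' b -> nzd_mod (a * a') b.
Proof. by move=> ha ha' f g; rewrite -mulrA => /ha[h] /ha'. Qed.

Lemma nzd_modM_r (a b b' : S) : b != 0 ->
  nzd_mod a b -> nzd_mod a b' -> nzd_mod a (b * b').
Proof.
move=> b0 hb hb' f g e; have [|h fh] := hb f (b' * g); first by rewrite e mulrA.
have [|h' hh'] := hb' h g; last by exists h'; rewrite fh hh' mulrA.
by apply: (mulfI b0); rewrite mulrCA -fh e mulrA.
Qed.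

Section Plane.
Variables i j : 'I_4.
Hypothesis ij : i != j.

Definition form f := exists a b : k, (a != 0) || (b != 0) /\ f = a *: 'X_i + b *: 'X_j.

Definition prodform f := exists2 s : seq S, forall l, l \in s -> form l & f = \prod_(l <- s) l.

Lemma form_neq0 f : form f -> f != 0.
Proof.
move=> [a [b [ab ->]]]; apply/eqP => e; move: ab.
have ji : (U_(j) == U_(i) :> 'X_{1..4})%MM = false.
  apply/eqP => /(congr1 (fun m : 'X_{1..4} => m j)).
  by rewrite !mnm1E eqxx (negPf ij).
have := congr1 (fun p : S => p@_U_(i)) e; rewrite mcoeffD !mcoeffZ !mcoeffX eqxx ji.
rewrite mulr1 mulr0 addr0 mcoeff0 => ->; rewrite eqxx /=.
have := congr1 (fun p : S => p@_U_(j)) e.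
rewrite mcoeffD !mcoeffZ !mcoeffX eqxx [U_(i)%MM == _]eq_sym ji.
by rewrite mulr1 mulr0 add0r mcoeff0 => ->; rewrite eqxx.
Qed.

Lemma form_prodform f : form f -> prodform f.
Proof.
by exists [:: f]; rewrite ?big_seq1 // => l; rewrite inE => /eqP->.
Qed.

Lemma prodform_prod (I : eqType) (s : seq I) (F : I -> S) :
  (forall x, x \in s -> form (F x)) -> prodform (\prod_(x <- s) F x).
Proof.
move=> h; exists (map F s); last by rewrite big_map.
by move=> l /mapP[x xs ->]; apply: h.
Qed.

Lemma prodform_neq0 f : prodform f -> f != 0.
Proof.
by case=> s hs ->; rewrite prodf_seq_neq0; apply/allP => l /hs /form_neq0->.
Qed.

(* The projection of the (i, j)-plane onto the line spanned by (c0, c1): it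
   kills the linear form vanishing at (c0 : c1). *)
Variables c0 c1 : k.
Hypothesis c_neq0 : (c0 != 0) || (c1 != 0).

Definition plane_vanish : S := c1 *: 'X_i - c0 *: 'X_j.

(** A linear form with value 1 at (c0, c1); this normalization makes [plane_proj] idempotent. *)
Definition plane_gen : S := if c0 != 0 then c0^-1 *: 'X_i else c1^-1 *: 'X_j.

Definition plane_proj : S -> S := comp_mpoly
  [tuple if l == i then c0 *: plane_gen else if l == j then c1 *: plane_gen
         else 'X_l | l < 4].

HB.instance Definition _ := GRing.RMorphism.on plane_proj.

Lemma plane_projC c : plane_proj c%:MP = c%:MP.
Proof. exact: comp_mpolyC. Qed.

Lemma plane_projZ c f : plane_proj (c *: f) = c *: plane_proj f.
Proof. exact: comp_mpolyZ. Qed.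

Lemma plane_projX l : plane_proj 'X_l =
  if l == i then c0 *: plane_gen else if l == j then c1 *: plane_gen else 'X_l.
Proof. by rewrite /plane_proj comp_mpolyXU -tnth_nth tnth_mktuple. Qed.

Lemma plane_proj_id l : l != i -> l != j -> plane_proj 'X_l = 'X_l.
Proof. by move=> /negPf li /negPf lj; rewrite plane_projX li lj. Qed.

Lemma plane_proj_form a b :
  plane_proj (a *: 'X_i + b *: 'X_j) = (a * c0 + b * c1) *: plane_gen.
Proof.
rewrite rmorphD /= !plane_projZ !plane_projX eqxx [j == i]eq_sym (negPf ij) eqxx.
by rewrite !scalerA scalerDl.
Qed.

Lemma plane_proj_vanish : plane_proj plane_vanish = 0.
Proof.
by rewrite /plane_vanish -scaleNr plane_proj_form mulNr mulrC subrr scale0r.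
Qed.

Lemma form_plane_gen : form plane_gen.
Proof.
rewrite /plane_gen; case: ifP => c; [exists c0^-1, 0 | exists 0, c1^-1].
  by rewrite invr_eq0 c scale0r addr0.
by move: c_neq0; rewrite c /= => c1n0; rewrite invr_eq0 c1n0 orbT scale0r add0r.
Qed.

Lemma form_scale a : a != 0 -> form (a *: plane_gen).
Proof.
move=> a0; have [b [c [bc ->]]] := form_plane_gen; exists (a * b), (a * c).
by rewrite !mulf_eq0 (negPf a0) scalerDr !scalerA.
Qed.

Lemma plane_proj_gen : plane_proj plane_gen = plane_gen.
Proof.
rewrite {1}/plane_gen; case: ifP => c; rewrite plane_projZ plane_projX eqxx.
  by rewrite scalerA mulVf // scale1r /plane_gen c.
rewrite [j == i]eq_sym (negPf ij); move: c_neq0; rewrite c /= => c1n0.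
by rewrite scalerA mulVf // scale1r /plane_gen c.
Qed.

Lemma plane_proj_mod f : exists g, f = plane_proj f + plane_vanish * g.
Proof.
elim/mpoly_alg_ind: f => [c|l|f f' [g fg] [g' fg']|f f' [g fg] [g' fg']].
- by exists 0; rewrite plane_projC mulr0 addr0.
- rewrite plane_projX; case: eqP => [->|_]; last case: eqP => [->|_].
  + rewrite /plane_gen; have [c|c] := eqVneq c0 0; rewrite /= ?c ?eqxx /=.
      move: c_neq0; rewrite c eqxx /= => c1n0; exists (c1^-1)%:MP.
      rewrite /plane_vanish c !scale0r subr0 add0r mulrC mul_mpolyC scalerA mulVf //.
      by rewrite scale1r.
    by exists 0; rewrite scalerA mulfV // scale1r mulr0 addr0.
  + rewrite /plane_gen; have [c|c] := eqVneq c0 0; rewrite /= ?c ?eqxx /=.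
      move: c_neq0; rewrite c eqxx /= => c1n0; exists 0.
      by rewrite scalerA mulfV // scale1r mulr0 addr0.
    exists (- (c0^-1)%:MP); rewrite /plane_vanish mulrN mulrC mul_mpolyC scalerBr !scalerA.
    by rewrite mulVf // scale1r [c1 * _]mulrC; ring.
  + by exists 0; rewrite mulr0 addr0.
- by exists (g + g'); rewrite rmorphD /= {1}fg {1}fg'; ring.
- exists (g * plane_proj f' + plane_proj f * g' + plane_vanish * g * g').
  by rewrite rmorphM /= {1}fg {1}fg'; ring.
Qed.

Lemma plane_proj_eq0 f : plane_proj f = 0 -> exists g, f = plane_vanish * g.
Proof. by move=> e; have [g fg] := plane_proj_mod f; exists g; rewrite fg e add0r. Qed.

End Plane.

Lemma form_proj_id (i j l m : 'I_4) c0 c1 f : l \notin [:: i; j] -> m \notin [:: i; j] ->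
  form l m f -> plane_proj i j c0 c1 f = f.
Proof.
rewrite !inE !negb_or => /andP[li lj] /andP[mi mj] [a [b [_ ->]]].
by rewrite rmorphD /= !plane_projZ !plane_proj_id.
Qed.

Lemma prodform_proj_id (i j l m : 'I_4) c0 c1 f : l \notin [:: i; j] -> m \notin [:: i; j] ->
  prodform l m f -> plane_proj i j c0 c1 f = f.
Proof.
move=> hl hm [s hs ->]; rewrite rmorph_prod /= big_seq [RHS]big_seq.
by apply: eq_bigr => x /hs; apply: form_proj_id.
Qed.

(** One linear factor of g at a time: the projection along that factor kills it, fixes every form in
    the other two variables, and has values in a domain. *)
Lemma nzd_mod_forms (i j l m : 'I_4) f g : uniq [:: i; j; l; m] ->
  prodform i j f -> prodform l m g -> nzd_mod f g.
Proof.
rewrite /= !inE !negb_or => /and4P[/and3P[ij il im] /andP[jl jm] lm _] [s hs ->] [t ht ->].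
rewrite big_seq; apply: (big_ind (fun x => nzd_mod x (\prod_(y <- t) y))) => [h h'|x y|x xs]; first by rewrite mul1r => ->; exists h'.
  exact: nzd_modM_l.
elim: t ht => [|y t IH] ht.
  by rewrite big_nil => h h' _; exists h; rewrite mul1r.
have fy : form l m y by apply: ht; rewrite mem_head.
rewrite big_cons; apply: nzd_modM_r.
- exact: form_neq0 fy.
- case: fy => a [b [ab ->]] h h' e.
  have ab' : (- b != 0) || (a != 0) by rewrite oppr_eq0 orbC.
  have ey : a *: 'X_l + b *: 'X_m = plane_vanish l m (- b) a.
    by rewrite /plane_vanish scaleNr opprK.
  rewrite ey; apply: plane_proj_eq0 => //.
  have := congr1 (plane_proj l m (- b) a) e; rewrite ey !rmorphM /=.
  rewrite plane_proj_vanish // mul0r => /eqP; rewrite mulf_eq0 => /orP[|/eqP//].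
  rewrite (form_proj_id _ _ _ _ (hs x xs)) ?(negPf (form_neq0 ij (hs x xs))) //.
  + by rewrite !inE negb_or il.
  + by rewrite !inE negb_or jl.
- by apply: IH => z zt; apply: ht; rewrite inE zt orbT.
Qed.

Lemma inord4_neq a b : (a < 4)%N -> (b < 4)%N -> a != b -> (inord a : 'I_4) != inord b.
Proof. by move=> a4 b4; rewrite -val_eqE /= !inordK. Qed.

Lemma uniq_vars : uniq [:: inord 0; inord 1; inord 2; inord 3 : 'I_4].
Proof. by rewrite /= !inE !negb_or !inord4_neq. Qed.

Lemma xvar : (inord 0 : 'I_4) != inord 1. Proof. exact: inord4_neq. Qed.
Lemma yvar : (inord 2 : 'I_4) != inord 3. Proof. exact: inord4_neq. Qed.

Lemma xnoty l : (l < 2)%N -> (inord l : 'I_4) \notin [:: inord 2; inord 3].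
Proof. by move=> l2; rewrite !inE negb_or !inord4_neq; lia. Qed.

Lemma ynotx l : (2 <= l < 4)%N -> (inord l : 'I_4) \notin [:: inord 0; inord 1].
Proof. by move=> l2; rewrite !inE negb_or !inord4_neq; lia. Qed.

Definition xform := form (inord 0) (inord 1).
Definition yform := form (inord 2) (inord 3).
Definition xprod := prodform (inord 0) (inord 1).
Definition yprod := prodform (inord 2) (inord 3).

Lemma nzd_mod_xy f g : xprod f -> yprod g -> nzd_mod f g.
Proof. exact/nzd_mod_forms/uniq_vars. Qed.

Lemma yprod_neq0 f : yprod f -> f != 0. Proof. exact/prodform_neq0/yvar. Qed.

(** * Points of P^1 and the projections along their linear forms *)

Lemma hcoord_neq0 R : (hcoord R 0 != 0) || (hcoord R 1 != 0).
Proof.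
have : vpick R != 0.
  rewrite vpick0; apply/eqP => R0; case: R R0 => U /= dU U0.
  by move: dU; rewrite U0 dimv0.
apply: contraNT; rewrite negb_or !negbK => /andP[/eqP h0 /eqP h1].
apply/eqP/rowP => i; rewrite mxE.
by case: i => [[|[|//]]] hi; [rewrite -h0 | rewrite -h1]; congr (vpick R _ _); apply/val_inj.
Qed.

Lemma vpick_line R : line_of R = <[vpick R]>%VS.
Proof.
apply/esym/eqP; rewrite eqEdim -memvE memv_pick dim_vline.
have -> : vpick R != 0.
  by apply: contraTneq (hcoord_neq0 R) => e; rewrite /hcoord e !mxE eqxx.
by case: R => U /= /eqP ->.
Qed.

Lemma hcoord_det R R' : R != R' -> hcoord R 1 * hcoord R' 0 - hcoord R 0 * hcoord R' 1 != 0.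
Proof.
apply: contra_neq => /eqP; rewrite subr_eq0 => /eqP e.
have sub (R1 R2 : P1 k) : hcoord R1 1 * hcoord R2 0 = hcoord R1 0 * hcoord R2 1 ->
    (line_of R1 <= line_of R2)%VS.
  move=> e'; rewrite (vpick_line R1) -memvE (vpick_line R2).
  have [c0|c0] := eqVneq (hcoord R2 0) 0.
    have := hcoord_neq0 R2; rewrite c0 eqxx /= => c1.
    apply/vlineP; exists (hcoord R1 1 / hcoord R2 1); apply/rowP => i; rewrite !mxE.
    have z : hcoord R1 0 = 0.
      by apply: (mulIf c1); rewrite -e' c0 mulr0 mul0r.
    case: i => [[|[|//]]] hi.
      transitivity (hcoord R1 0); first by congr (vpick R1 _ _); apply/val_inj.
      transitivity (hcoord R1 1 / hcoord R2 1 * hcoord R2 0); first by rewrite z c0 mulr0.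
      by congr (_ * vpick R2 _ _); apply/val_inj.
    transitivity (hcoord R1 1); first by congr (vpick R1 _ _); apply/val_inj.
    transitivity (hcoord R1 1 / hcoord R2 1 * hcoord R2 1); first by rewrite mulfVK.
    by congr (_ * vpick R2 _ _); apply/val_inj.
  apply/vlineP; exists (hcoord R1 0 / hcoord R2 0); apply/rowP => i; rewrite !mxE.
  case: i => [[|[|//]]] hi.
    transitivity (hcoord R1 0); first by congr (vpick R1 _ _); apply/val_inj.
    transitivity (hcoord R1 0 / hcoord R2 0 * hcoord R2 0); first by rewrite mulfVK.
    by congr (_ * vpick R2 _ _); apply/val_inj.
  transitivity (hcoord R1 1); first by congr (vpick R1 _ _); apply/val_inj.
  transitivity (hcoord R1 0 / hcoord R2 0 * hcoord R2 1).
    by apply: (mulIf c0); rewrite mulrAC mulfVK.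
  by congr (_ * vpick R2 _ _); apply/val_inj.
apply/val_inj/eqP; rewrite eqEsubv !sub //.
by rewrite mulrC [RHS]mulrC.
Qed.

(** Collects finitely many existential witnesses into one family without a choice axiom; [x0] is the
    value out of range. *)
Lemma fin_choice (T : Type) n (P : nat -> T -> Prop) (x0 : T) :
  (forall s, (s < n)%N -> exists x, P s x) -> exists F, forall s, (s < n)%N -> P s (F s).
Proof.
elim: n => [|n IH] h; first by exists (fun=> x0).
have [|F hF] := IH; first by move=> s sn; apply: h; lia.
have [x hx] := h n (ltnSn n); exists (fun s => if s == n then x else F s) => s sn.
case: eqP => [->//|sn']; apply: hF; lia.
Qed.

Definition projx R := plane_proj (inord 0) (inord 1) (hcoord R 0) (hcoord R 1).
Definition projy Q := plane_proj (inord 2) (inord 3) (hcoord Q 0) (hcoord Q 1).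
HB.instance Definition _ R := GRing.RMorphism.on (projx R).
HB.instance Definition _ Q := GRing.RMorphism.on (projy Q).
Definition genx R := plane_gen (inord 0) (inord 1) (hcoord R 0) (hcoord R 1).
Definition geny Q := plane_gen (inord 2) (inord 3) (hcoord Q 0) (hcoord Q 1).

Lemma projx_L1 R : projx R (L1 R) = 0.
Proof. exact/plane_proj_vanish/xvar. Qed.

Lemma projy_L2 Q : projy Q (L2 Q) = 0.
Proof. exact/plane_proj_vanish/yvar. Qed.

Lemma projx_mod R f : exists g, f = projx R f + L1 R * g.
Proof. exact/plane_proj_mod/hcoord_neq0. Qed.

Lemma projy_mod Q f : exists g, f = projy Q f + L2 Q * g.
Proof. exact/plane_proj_mod/hcoord_neq0. Qed.

Lemma projx_eq0 R f : projx R f = 0 -> exists g, f = L1 R * g.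
Proof. exact/plane_proj_eq0/hcoord_neq0. Qed.

Lemma projy_eq0 Q f : projy Q f = 0 -> exists g, f = L2 Q * g.
Proof. exact/plane_proj_eq0/hcoord_neq0. Qed.

Lemma xform_L1 R : xform (L1 R).
Proof.
exists (hcoord R 1), (- hcoord R 0); rewrite oppr_eq0 orbC hcoord_neq0.
by rewrite scaleNr.
Qed.

Lemma yform_L2 Q : yform (L2 Q).
Proof.
exists (hcoord Q 1), (- hcoord Q 0); rewrite oppr_eq0 orbC hcoord_neq0.
by rewrite scaleNr.
Qed.

Lemma projx_L1_neq R R' : R != R' -> exists2 a, a != 0 & projx R' (L1 R) = a *: genx R'.
Proof.
move=> /hcoord_det d; exists (hcoord R 1 * hcoord R' 0 - hcoord R 0 * hcoord R' 1) => //.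
by rewrite /projx /L1 -scaleNr plane_proj_form ?xvar // mulNr.
Qed.

Lemma projy_L2_neq Q Q' : Q != Q' -> exists2 a, a != 0 & projy Q' (L2 Q) = a *: geny Q'.
Proof.
move=> /hcoord_det d; exists (hcoord Q 1 * hcoord Q' 0 - hcoord Q 0 * hcoord Q' 1) => //.
by rewrite /projy /L2 -scaleNr plane_proj_form ?yvar // mulNr.
Qed.

Lemma yform_projy_L2 Q Q' : Q != Q' -> yform (projy Q' (L2 Q)).
Proof. by move=> /projy_L2_neq[a a0 ->]; apply/form_scale => //; apply/hcoord_neq0. Qed.

Lemma projy_x Q f : xprod f -> projy Q f = f.
Proof. by apply: prodform_proj_id; apply: xnoty. Qed.

Lemma projx_y R f : yprod f -> projx R f = f.
Proof. by apply: prodform_proj_id; apply: ynotx. Qed.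

Lemma rmorph_gen (phi : {rmorphism S -> S}) A B n s :
  phi (gen A B n s) = gen (phi \o A) (phi \o B) n s.
Proof. by rewrite /gen rmorphM !rmorph_prod. Qed.

Lemma gen_ext A A' B B' n s : (forall i, (i < n)%N -> A i = A' i) ->
  (forall i, (i < n)%N -> B i = B' i) -> (s <= n)%N -> gen A B n s = gen A' B' n s.
Proof.
move=> hA hB sn; rewrite /gen; congr (_ * _); apply: eq_big_nat => i hi.
  by apply: hA; lia.
by apply: hB; lia.
Qed.

(** On the zero line of L_Q the restricted generators still form a staircase with nonzero column
    factors, so the y_s restrict to a combination of its Hilbert-Burch relations. The same
    combination of the original relations agrees with the y_s modulo L_Q and contributes nothing to
    the sum; the remaining multiples of L_Q can be cancelled. *)
Lemma L2_regular A (bs : nat -> seq (P1 k)) n Q d (y : nat -> S) :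
  let B a := \prod_(Q' <- bs a) L2 Q' in
  (forall a, (a < n)%N -> xprod (A a)) ->
  (forall a, (a < n)%N -> Q \notin bs a) ->
  L2 Q * d = \sum_(0 <= s < n.+1) y s * gen A B n s ->
  exists y' : nat -> S, d = \sum_(0 <= s < n.+1) y' s * gen A B n s.
Proof.
move=> B hA hQ e; pose phi : {rmorphism S -> S} := projy Q.
have hB a : (a < n)%N -> yprod (phi (B a)).
  move=> an; rewrite /B rmorph_prod; apply: prodform_prod => Q' hQ'.
  by apply: yform_projy_L2; apply: contraNneq (hQ a an) => <-.
have hA' a : (a < n)%N -> phi (A a) = A a by move=> /hA; apply: projy_x.
have [j jn|i j im jn||z zP] := @hilbert_burch _ A (phi \o B) n (phi \o y).
- exact/nzd_neq0/yprod_neq0/hB.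
- by apply: nzd_mod_xy; [apply: hA | apply: hB].
- have := congr1 phi e; rewrite rmorphM /= [phi (L2 Q)]projy_L2 mul0r rmorph_sum /= => e'.
  rewrite [RHS]e'; apply: eq_big_nat => s /andP[_ sn]; rewrite rmorphM rmorph_gen.
  by congr (_ * _); apply: gen_ext => // i i_n /=; rewrite hA'.
have lmod a s : (a < n)%N -> exists g, lin A (phi \o B) a s = lin A B a s + L2 Q * g.
  move=> an; have [g fB] := projy_mod Q (B a); exists (g *+ (s == a.+1)).
  have E : (phi \o B) a = B a - L2 Q * g by rewrite [in RHS]fB addrK.
  by rewrite /lin E; case: (s == a.+1) => /=; ring.
have [u uP] : exists u : nat -> S, forall s, (s < n.+1)%N ->
    y s = \sum_(0 <= a < n) z a * lin A B a s + L2 Q * u s.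
  apply: (fin_choice (P := fun s x => y s = \sum_(0 <= a < n) z a * lin A B a s + L2 Q * x) 0).
  move=> s sn; have [g yg] := projy_mod Q (y s).
  have [F hF] := fin_choice (0 : S) (fun a an => lmod a s an).
  exists (\sum_(0 <= a < n) z a * F a + g); rewrite [LHS]yg [projy Q _]zP //.
  rewrite mulrDr addrA mulr_sumr -big_split /=; congr (_ + _).
  by apply: eq_big_nat => a /andP[_ an]; rewrite hF //; ring.
exists u; have L0 : L2 Q != 0 := form_neq0 yvar (yform_L2 Q).
apply: (mulfI L0); rewrite e mulr_sumr.
transitivity (\sum_(0 <= s < n.+1) (\sum_(0 <= a < n) z a * lin A B a s) * gen A B n s
  + \sum_(0 <= s < n.+1) L2 Q * (u s * gen A B n s)); last by rewrite sum_lin_syz ?add0r.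
rewrite -big_split /=.
by apply: eq_big_nat => s /andP[_ sn]; rewrite uP //; ring.
Qed.

Lemma L2prod_regular A (bs : nat -> seq (P1 k)) n (t : seq (P1 k)) d (y : nat -> S) :
  let B a := \prod_(Q' <- bs a) L2 Q' in
  (forall a, (a < n)%N -> xprod (A a)) ->
  (forall a Q, (a < n)%N -> Q \in t -> Q \notin bs a) ->
  (\prod_(Q <- t) L2 Q) * d = \sum_(0 <= s < n.+1) y s * gen A B n s ->
  exists y' : nat -> S, d = \sum_(0 <= s < n.+1) y' s * gen A B n s.
Proof.
move=> B hA; elim: t d y => [|Q t IH] d y hQ.
  by rewrite big_nil mul1r => ->; exists y.
rewrite big_cons -mulrA => /L2_regular[//||y'].
  by move=> a an; apply: hQ; rewrite ?mem_head.
by apply: IH => a Q' an Q't; apply: hQ; rewrite // inE Q't orbT.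
Qed.

Section XYStaircase.
Variables (A : nat -> S) (bs : nat -> seq (P1 k)) (n : nat).
Let B a : S := \prod_(Q <- bs a) L2 Q.
Hypothesis hA : forall a, (a < n)%N -> xprod (A a).
Hypothesis hbs : forall a b Q, (a < b < n)%N -> Q \in bs b -> Q \notin bs a.

Lemma yprod_L2 (t : seq (P1 k)) : yprod (\prod_(Q <- t) L2 Q).
Proof. by apply: prodform_prod => Q _; apply: yform_L2. Qed.

Lemma xy_nzd j : (j < n)%N -> nzd (B j).
Proof. by move=> _; apply/nzd_neq0/yprod_neq0/yprod_L2. Qed.

Lemma xy_nzd_mod i j : (i < n)%N -> (j < n)%N -> nzd_mod (A i) (B j).
Proof. by move=> i_n _; apply: nzd_mod_xy; [apply: hA | apply: yprod_L2]. Qed.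

Lemma xy_quad_syz v : quad_eval A B n v = 0 ->
  exists w, forall s t, (s <= t <= n)%N -> v s t = sym2 (lin_mul A B n w) s t.
Proof.
apply: quad_syz => [j|i j|j d y jn]; [exact: xy_nzd | exact: xy_nzd_mod|].
apply: L2prod_regular => [a aj|a Q aj]; first by apply: hA; lia.
by apply: hbs; rewrite aj.
Qed.
End XYStaircase.

End Forms.

(** * Ideals of points in a row *)

Section IdealLemmas.
Local Open Scope ring_scope.
Variable S : comNzRingType.
Implicit Types (J : S -> Prop) (f g : S).

Lemma ideal_gen2 (a b f : S) :
  ideal_gen [:: a; b] f <-> exists g h, f = g * a + h * b.
Proof.
split=> [[c ->]|[g [h ->]]].
  by rewrite big_ord_recl big_ord1 /=; exists (c ord0), (c (lift ord0 ord0)).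
exists (fun i => if i == ord0 then g else h).
by rewrite big_ord_recl big_ord1.
Qed.

Lemma is_ideal_gen (s : seq S) : is_ideal (ideal_gen s).
Proof.
split=> [|f g [c ->] [d ->]|a f [c ->]].
- by exists (fun=> 0); rewrite big1 // => i _; rewrite mul0r.
- exists (fun i => c i + d i); rewrite -big_split; apply: eq_bigr => i _.
  by rewrite mulrDl.
- exists (fun i => a * c i); rewrite mulr_sumr; apply: eq_bigr => i _.
  by rewrite mulrA.
Qed.

Lemma ideal_sum J (I : Type) (r : seq I) (P : pred I) (F : I -> S) : is_ideal J ->
  (forall i, P i -> J (F i)) -> J (\sum_(i <- r | P i) F i).
Proof. by case=> J0 JD _ h; apply: big_ind. Qed.

Lemma idealMr J f g : is_ideal J -> J f -> J (f * g).
Proof. by case=> _ _ JM h; rewrite mulrC; apply: JM. Qed.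

Lemma ideal_mul2 (a b f : S) :
  ideal_mul (ideal_gen [:: a; b]) (ideal_gen [:: a; b]) f <->
  exists x y z, f = x * a ^+ 2 + y * (a * b) + z * b ^+ 2.
Proof.
split=> [[n [g [h [hg hh ->]]]]|[x [y [z ->]]]].
  pose J p := exists x y z, p = x * a ^+ 2 + y * (a * b) + z * b ^+ 2.
  have JI : is_ideal J.
    split=> [|p q [x [y [z ->]]] [x' [y' [z' ->]]]|p q [x [y [z ->]]]].
    - by exists 0, 0, 0; ring.
    - by exists (x + x'), (y + y'), (z + z'); ring.
    - by exists (p * x), (p * y), (p * z); ring.
  apply: (@ideal_sum J) => // i _.
  have /ideal_gen2[u [v ->]] := hg i; have /ideal_gen2[u' [v' ->]] := hh i.
  by exists (u * u'), (u * v' + v * u'), (v * v'); ring.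
exists 3%N, (fun i : 'I_3 => if i == 0 then x * a else if i == 1 then y * a else z * b),
  (fun i : 'I_3 => if i == 0 then a else b); split.
- move=> i; apply/ideal_gen2; case: ifP => _; last case: ifP => _.
  + by exists x, 0; ring.
  + by exists y, 0; ring.
  + by exists 0, z; ring.
- move=> i; apply/ideal_gen2; case: ifP => _.
    by exists 1, 0; ring.
  by exists 0, 1; ring.
- by rewrite !big_ord_recl big_ord0 /=; ring.
Qed.

(** Let E(u) be the product of the L_y with y outside u. Since L_y E(x, y, u) = E(x, u) and L_x E(x,
    y, u) = E(y, u), a power of w in (L_x, L_y) carries membership in J, up to powers of w, from
    smaller sets u to larger ones. The singletons are the hypothesis, and E(t) = 1. *)
Lemma conductor_power (I : eqType) (t : seq I) (L : I -> S) J (w : S) :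
  is_ideal J -> uniq t -> t != [::] ->
  (forall x, x \in t -> J (\prod_(y <- t | y != x) L y)) ->
  (forall x y, x \in t -> y \in t -> x != y ->
     exists N g h, w ^+ N = g * L x + h * L y) ->
  exists N, J (w ^+ N).
Proof.
move=> JI; have [_ JD JM] := JI => ut t0 hJ hw.
pose E (u : seq I) := \prod_(y <- t | y \notin u) L y.
have main m : forall u, size u = m.+1 -> uniq u -> {subset u <= t} ->
    exists N, J (w ^+ N * E u).
  elim: m => [|m IH] [|x u] //= [su] /andP[xu uu] sub.
    move/size0nil in su; subst u; exists 0; rewrite mul1r.
    have := hJ x (sub x (mem_head _ _)); rewrite /E.
    by congr J; apply: eq_bigl => y; rewrite inE.
  case: u su xu uu sub => // y u [su] xyu /= /andP[yu uu] sub.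
  have xt : x \in t by apply: sub; rewrite mem_head.
  have yt : y \in t by apply: sub; rewrite !inE eqxx orbT.
  have xy : x != y by apply: contraNneq xyu => ->; rewrite mem_head.
  have xu : x \notin u by apply: contraNN xyu => h; rewrite inE h orbT.
  have [|||N1 h1] := IH (x :: u).
  - by rewrite /= su.
  - by rewrite /= xu.
  - by move=> z; rewrite inE => /orP[/eqP->//|zu]; apply: sub; rewrite !inE zu !orbT.
  have [|||N2 h2] := IH (y :: u).
  - by rewrite /= su.
  - by rewrite /= yu.
  - by move=> z; rewrite inE => /orP[/eqP->//|zu]; apply: sub; rewrite !inE zu !orbT.
  have [N [g [h e]]] := hw x y xt yt xy.
  have E1 : E (x :: u) = L y * E (x :: y :: u).
    rewrite /E -big_filter (bigD1_seq y) ?filter_uniq //=; last first.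
      by rewrite mem_filter yt inE negb_or yu eq_sym xy.
    rewrite big_filter_cond; congr (_ * _).
    by apply: eq_bigl => z; rewrite !inE !negb_or; case: (z == x); case: (z == y); case: (z \in u).
  have E2 : E (y :: u) = L x * E (x :: y :: u).
    rewrite /E -big_filter (bigD1_seq x) ?filter_uniq //=; last first.
      by rewrite mem_filter xt inE negb_or xu xy.
    rewrite big_filter_cond; congr (_ * _).
    by apply: eq_bigl => z; rewrite !inE !negb_or; case: (z == x); case: (z == y); case: (z \in u).
  exists (N + (N1 + N2))%N; rewrite !exprD e.
  have -> : (g * L x + h * L y) * (w ^+ N1 * w ^+ N2) * E (x :: y :: u) =
    (g * w ^+ N1) * (w ^+ N2 * E (y :: u)) + (h * w ^+ N2) * (w ^+ N1 * E (x :: u)).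
    by rewrite E1 E2; ring.
  by apply: JD; apply: JM.
case: t t0 @E ut main {hJ hw} => // x t _ E ut /(_ (size t) (x :: t)).
case=> // N; rewrite /E big1_seq ?mulr1; first by exists N.
by move=> y /andP[/negPf ->].
Qed.

(** Each term of the cube of a g + b h contains a^2 or b^2. *)
Lemma expr3_in_squares (w a b g h : S) : w = a * g + b * h ->
  w ^+ 3 = (a * g ^+ 3 + 3 * g ^+ 2 * h * b) * a ^+ 2 +
           (3 * g * h ^+ 2 * a + b * h ^+ 3) * b ^+ 2.
Proof. by move=> ->; ring. Qed.
End IdealLemmas.

Section PointIdeals.
Local Open Scope ring_scope.
Variable k : fieldType.
Local Notation S := {mpoly k[4]}.
Implicit Types (f g : S) (R Q : P1 k).

Lemma form_in_span (i j : 'I_4) (c0 c1 : k) f l : i != j -> (c0 != 0) || (c1 != 0) ->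
  form i j f -> form i j l -> plane_proj i j c0 c1 l != 0 ->
  exists g h, f = plane_vanish i j c0 c1 * g + l * h.
Proof.
move=> ij c [a [b [_ ->]]] [a' [b' [_ ->]]]; rewrite plane_proj_form // => d0.
have {d0} d0 : a' * c0 + b' * c1 != 0 by apply: contraNneq d0 => ->; rewrite scale0r.
have [g eg] := plane_proj_mod i j c (a *: 'X_i + b *: 'X_j).
have [g' eg'] := plane_proj_mod i j c (a' *: 'X_i + b' *: 'X_j).
rewrite !plane_proj_form // in eg eg'.
set d := a' * c0 + b' * c1 in d0 eg'; set e := a * c0 + b * c1 in eg.
exists (g - ((e / d)%:MP * g')), ((e / d)%:MP).
have ed : (e / d)%:MP * d%:MP = e%:MP :> S by rewrite -mpolyCM mulfVK.
by rewrite [in RHS]eg' {1}eg -!mul_mpolyC -ed; ring.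
Qed.

Lemma L1_span R R' f : R != R' -> xform f -> exists g h, f = L1 R * g + L1 R' * h.
Proof.
move=> RR' hf; apply: form_in_span => //; first exact: xvar.
- exact: hcoord_neq0.
- exact: xform_L1.
- have [|a a0] := @projx_L1_neq _ R' R; first by rewrite eq_sym.
  rewrite /projx => ->.
  by apply: (form_neq0 xvar); apply: form_scale; [apply: hcoord_neq0|].
Qed.

Lemma L2_span Q Q' f : Q != Q' -> yform f -> exists g h, f = L2 Q * g + L2 Q' * h.
Proof.
move=> QQ' hf; apply: form_in_span => //; first exact: yvar.
- exact: hcoord_neq0.
- exact: yform_L2.
- have [|a a0] := @projy_L2_neq _ Q' Q; first by rewrite eq_sym.
  rewrite /projy => ->.
  by apply: (form_neq0 yvar); apply: form_scale; [apply: hcoord_neq0|].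
Qed.

Lemma L1_neq0 R : L1 R != 0. Proof. exact/(form_neq0 xvar)/xform_L1. Qed.
Lemma L2_neq0 Q : L2 Q != 0. Proof. exact/(form_neq0 yvar)/yform_L2. Qed.

Definition Vprod (t : seq (P1 k)) : S := \prod_(Q <- t) L2 Q.

Lemma projyV_neq0 Q (t : seq (P1 k)) : Q \notin t -> projy Q (Vprod t) != 0.
Proof.
move=> Qt; rewrite /Vprod rmorph_prod /=; apply: (yprod_neq0 (k := k)).
by apply: prodform_prod => Q' hQ'; apply: yform_projy_L2; apply: contraNneq Qt => <-.
Qed.

Lemma L2_dvd_mulV Q (t : seq (P1 k)) f g : Q \notin t -> f * Vprod t = L2 Q * g ->
  exists h, f = L2 Q * h.
Proof.
move=> Qt /(congr1 (projy Q)); rewrite !rmorphM /= projy_L2 mul0r => /eqP.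
by rewrite mulf_eq0 (negPf (projyV_neq0 Qt)) orbF => /eqP/projy_eq0.
Qed.

(** V is a nonzerodivisor modulo I_P when the column of P is not among its factors; this lets the
    row ideals be computed by adding one point at a time. *)
Lemma I_pt_mulV R Q (t : seq (P1 k)) f g h : Q \notin t ->
  f * Vprod t = L1 R * g + L2 Q * h -> exists g' h', f = L1 R * g' + L2 Q * h'.
Proof.
move=> Qt e; have := congr1 (projx R) e.
rewrite !rmorphD !rmorphM /= projx_L1 mul0r add0r.
rewrite (projx_y _ (yprod_L2 t)) (projx_y _ (form_prodform (yform_L2 Q))).
move/(L2_dvd_mulV Qt) => [h' fh']; have [g' fg'] := projx_mod R f.
by exists g', h'; rewrite fg' fh' addrC.
Qed.

Lemma I_row_simple R (t : seq (P1 k)) f : uniq t ->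
  (forall Q, Q \in t -> I_pt (R, Q) f) -> exists g h, f = L1 R * g + Vprod t * h.
Proof.
elim: t => [|Q t IH] /=; first by exists 0, f; rewrite /Vprod big_nil; ring.
move=> /andP[Qt ut] h; have [|g [h' e]] := IH ut.
  by move=> Q' Q't; apply: h; rewrite inE Q't orbT.
have /ideal_gen2 /= [x [y e']] := h Q (mem_head _ _).
have [|p [q hpq]] := @I_pt_mulV R Q t h' (x - g) y Qt.
  by apply/eqP; rewrite -subr_eq0; apply/eqP; transitivity (f - f); [rewrite {1}e e' | ]; ring.
exists (g + Vprod t * p), q; rewrite e hpq /Vprod big_cons; ring.
Qed.

(* Adding the point Q to the row: modulo L_R the coefficient of V^2 is in
   (L_Q^2), then that of L_R V is in (L_R, L_Q). *)
Lemma I_row_double R (t : seq (P1 k)) f : uniq t ->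
  (forall Q, Q \in t -> ideal_mul (I_pt (R, Q)) (I_pt (R, Q)) f) ->
  exists x y z, f = L1 R ^+ 2 * x + L1 R * Vprod t * y + Vprod t ^+ 2 * z.
Proof.
elim: t => [|Q t IH] /=; first by exists 0, 0, f; rewrite /Vprod big_nil; ring.
move=> /andP[Qt ut] h; have [|x [y [z e]]] := IH ut.
  by move=> Q' Q't; apply: h; rewrite inE Q't orbT.
have /ideal_mul2 /= [a [b [c e']]] := h Q (mem_head _ _).
have pV : projx R (Vprod t) = Vprod t by exact: (projx_y _ (yprod_L2 t)).
have pQ : projx R (L2 Q) = L2 Q by exact: (projx_y _ (form_prodform (yform_L2 Q))).
have [z1 [z2 hz]] : exists z1 z2, z = L1 R * z1 + L2 Q ^+ 2 * z2.
  have e1 : projx R z * Vprod t * Vprod t = L2 Q * (L2 Q * projx R c).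
    have := congr1 (projx R) (etrans (esym e) e').
    rewrite !expr2 !rmorphD !rmorphM /= projx_L1 pV pQ => e1.
    transitivity (0 * 0 * projx R x + 0 * Vprod t * projx R y
                  + Vprod t * Vprod t * projx R z); first by ring.
    by rewrite e1; ring.
  have [u hu] := L2_dvd_mulV Qt e1; have [v hv] := L2_dvd_mulV Qt hu.
  have {}e1 : v * Vprod t * Vprod t = L2 Q * projx R c.
    by apply: (mulfI (L2_neq0 Q)); rewrite -e1 hv; ring.
  have [u1 hu1] := L2_dvd_mulV Qt e1; have [u2 hu2] := L2_dvd_mulV Qt hu1.
  have [z1 hz1] := projx_mod R z; exists z1, u2.
  by rewrite hz1 hv hu2; ring.
(* The part L_R z1 of z is moved into the middle term: L_R V y + L_R z1 V^2 = L_R V (y + z1 V). *)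
have [y1 [y2 hy]] : exists y1 y2, y + z1 * Vprod t = L1 R * y1 + L2 Q * y2.
  have e2 : L1 R * (L1 R * (x - a) + (y + z1 * Vprod t) * Vprod t - b * L2 Q) =
            L2 Q ^+ 2 * (c - Vprod t ^+ 2 * z2).
    apply/eqP; rewrite -subr_eq0; apply/eqP; transitivity (f - f); last by rewrite subrr.
    by rewrite {1}e e' hz; ring.
  have [c' hc'] : exists c', c - Vprod t ^+ 2 * z2 = L1 R * c'.
    apply: projx_eq0; have := congr1 (projx R) e2; rewrite rmorphM /= projx_L1 mul0r.
    rewrite rmorphM rmorphXn /= pQ => /esym/eqP.
    by rewrite mulf_eq0 expf_eq0 (negPf (L2_neq0 Q)) andbF => /eqP.
  apply: (@I_pt_mulV R Q t _ (a - x) (b + L2 Q * c') Qt).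
  apply/eqP; rewrite -subr_eq0; apply/eqP; apply: (mulfI (L1_neq0 R)); rewrite mulr0.
  transitivity (L1 R * (L1 R * (x - a) + (y + z1 * Vprod t) * Vprod t - b * L2 Q)
     - L2 Q ^+ 2 * (L1 R * c')); first by ring.
  by rewrite e2 hc' subrr.
exists (x + Vprod t * y1), y2, z2; rewrite /Vprod big_cons -/(Vprod t) e.
have -> : y = L1 R * y1 + L2 Q * y2 - z1 * Vprod t by rewrite -hy addrK.
by rewrite hz; ring.
Qed.
End PointIdeals.

(** * The ideal of the double points is a square *)

Section SquareIdeal.
Local Open Scope ring_scope.
Variable k : fieldType.
Local Notation S := {mpoly k[4]}.
Implicit Types (f g : S) (A B : nat -> S) (v : nat -> nat -> S).

Definition square_ideal A B n f := exists v, f = quad_eval A B n v.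

Lemma quad_eval_linear A B n v v' (c : S) :
  quad_eval A B n (fun s t => c * v s t + v' s t) =
  c * quad_eval A B n v + quad_eval A B n v'.
Proof.
rewrite /quad_eval mulr_sumr -big_split; apply: eq_bigr => t _ /=.
rewrite mulr_sumr -big_split; apply: eq_bigr => s _ /=; ring.
Qed.

Lemma quad_eval_ext A B n v v' :
  (forall s t, (s <= t <= n)%N -> v s t = v' s t) -> quad_eval A B n v = quad_eval A B n v'.
Proof.
move=> h; apply: eq_big_nat => t ht; apply: eq_big_nat => s hs; rewrite h //; lia.
Qed.

Lemma quad_eval0 A B n : quad_eval A B n (fun _ _ => 0) = 0.
Proof.
by rewrite /quad_eval big1 // => t _; rewrite big1 // => s _; rewrite mul0r.
Qed.

Lemma square_ideal_is_ideal A B n : is_ideal (square_ideal A B n).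
Proof.
split=> [|f g [v ->] [v' ->]|c f [v ->]].
- by exists (fun _ _ => 0); rewrite quad_eval0.
- by exists (fun s t => 1 * v s t + v' s t); rewrite quad_eval_linear mul1r.
- by exists (fun s t => c * v s t + 0); rewrite quad_eval_linear quad_eval0 addr0.
Qed.

Lemma square_ideal_gen A B n s t : (s <= n)%N -> (t <= n)%N ->
  square_ideal A B n (gen A B n s * gen A B n t).
Proof.
wlog st : s t / (s <= t)%N.
  move=> H sn tn; have [st|ts] := leqP s t; first exact: H.
  by rewrite mulrC; apply: H => //; apply: ltnW.
move=> sn tn; exists (fun s' t' => 1 *+ (s' == s) *+ (t' == t)).
rewrite /quad_eval (eq_bigr (fun t' => (\sum_(0 <= s' < t'.+1)
   (gen A B n s' * gen A B n t') *+ (s' == s)) *+ (t' == t))).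
  by rewrite !sum_nat_eq.
by move=> t' _; rewrite -sumrMnl; apply: eq_bigr => s' _; rewrite !mulrnAl mul1r.
Qed.

Lemma rmorph_quad_eval (phi : {rmorphism S -> S}) A B n v :
  phi (quad_eval A B n v) = quad_eval (phi \o A) (phi \o B) n (fun s t => phi (v s t)).
Proof.
rewrite /quad_eval rmorph_sum; apply: eq_bigr => t _; rewrite rmorph_sum.
by apply: eq_bigr => s _; rewrite rmorphM [phi (gen _ _ _ _ * _)]rmorphM !rmorph_gen.
Qed.

Lemma eq_quad_eval A A' B B' n v : (forall i, (i < n)%N -> A i = A' i) ->
  (forall i, (i < n)%N -> B i = B' i) -> quad_eval A B n v = quad_eval A' B' n v.
Proof.
move=> hA hB; apply: eq_big_nat => t ht; apply: eq_big_nat => s hs.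
by rewrite !(gen_ext hA hB) //; lia.
Qed.

(* The linear form vanishing at (c0 : c1) is regular modulo the square ideal,
   because the syzygies of the products of generators remain the expected
   ones after restriction to its zero locus. *)
Lemma square_ideal_regular A (bs : nat -> seq (P1 k)) n c0 c1 f :
  let B a := \prod_(Q <- bs a) L2 Q in
  let W := plane_vanish (inord 0) (inord 1) c0 c1 in
  let phi := plane_proj (inord 0) (inord 1) c0 c1 in
  (c0 != 0) || (c1 != 0) ->
  (forall a, (a < n)%N -> xprod (phi (A a))) ->
  (forall a b Q, (a < b < n)%N -> Q \in bs b -> Q \notin bs a) ->
  square_ideal A B n (W * f) -> square_ideal A B n f.
Proof.
move=> B W phi' c hA hbs [v e]; pose phi : {rmorphism S -> S} := phi'.
have phiW : phi W = 0 by apply: plane_proj_vanish xvar _ _.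
have hmod f' : exists g, f' = phi f' + W * g by apply: plane_proj_mod.
have W0 : W != 0.
  by apply: (form_neq0 xvar); exists c1, (- c0); rewrite oppr_eq0 orbC c scaleNr.
have hB a : phi (B a) = B a.
  by apply: (prodform_proj_id _ _ _ _ (yprod_L2 (bs a))); apply: ynotx.
have [|w hw] := @xy_quad_syz k (phi \o A) bs n hA hbs (fun s t => phi (v s t)).
  have := congr1 phi e; rewrite rmorphM phiW mul0r rmorph_quad_eval => ->.
  by apply: eq_quad_eval => // i _ /=; rewrite hB.
have lmod a s : exists g, lin (phi \o A) B a s = lin A B a s + W * g.
  have [g fA] := hmod (A a); exists (- g *+ (s == a)).
  have E : (phi \o A) a = A a - W * g by rewrite [in RHS]fA addrK.
  by rewrite /lin E; case: (s == a) => /=; ring.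
have mmod s t : exists g, lin_mul (phi \o A) B n w s t = lin_mul A B n w s t + W * g.
  have [F hF] := @fin_choice S n (fun a g => lin (phi \o A) B a s = lin A B a s + W * g)
    0 (fun a _ => lmod a s).
  exists (\sum_(0 <= a < n) F a * w a t); rewrite /lin_mul mulr_sumr -big_split.
  by apply: eq_big_nat => a /andP[_ an] /=; rewrite hF //; ring.
have vmod t : (t < n.+1)%N -> exists u : nat -> S, forall s, (s < t.+1)%N ->
    v s t = sym2 (lin_mul A B n w) s t + W * u s.
  move=> tn; apply: (@fin_choice S t.+1
    (fun s g => v s t = sym2 (lin_mul A B n w) s t + W * g) 0) => s st.
  have [g fg] := hmod (v s t); have [g1 e1] := mmod s t; have [g2 e2] := mmod t s.
  exists (g1 + g2 *+ (s != t) + g); rewrite fg hw; last by lia.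
  by rewrite /sym2 e1 e2; case: (s != t) => /=; ring.
have [u hu] := @fin_choice (nat -> S) n.+1 (fun t u => forall s, (s < t.+1)%N ->
    v s t = sym2 (lin_mul A B n w) s t + W * u s) (fun=> 0) vmod.
exists (fun s t => u t s); apply: (mulfI W0); rewrite e.
rewrite (@quad_eval_ext A B n v (fun s t => W * u t s + sym2 (lin_mul A B n w) s t)).
  by rewrite quad_eval_linear quad_eval_lin_mul addr0.
by move=> s t /andP[st tn]; rewrite (hu t) // addrC.
Qed.
End SquareIdeal.

Definition staircase_pts (k : fieldType) (Rf Qf : nat -> P1 k) (p q : nat -> nat) n
    (X : {fset P1 k * P1 k}) :=
  forall R Q, (R, Q) \in X <->
  exists a i j, [/\ a < n, p a <= i < p a.+1, j < q a, R = Rf i & Q = Qf j].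

Lemma block_index (p : nat -> nat) n i : p 0 = 0 -> i < p n ->
  exists2 a, a < n & p a <= i < p a.+1.
Proof.
move=> p0; elim: n => [|n IH]; first by rewrite p0.
have [/IH[a an ha] _|ni] := ltnP i (p n); last by exists n; rewrite ?ni.
by exists a; rewrite // ltnS ltnW.
Qed.

(** * The equality I_Z = I_X^2 for a staircase *)

Section DoublePointIdeal.
Local Open Scope ring_scope.
Variable k : closedFieldType.
Local Notation S := {mpoly k[4]}.
Implicit Types f g : S.

Variables (Rf Qf : nat -> P1 k) (p q : nat -> nat) (n : nat).
Hypothesis p0 : p 0%N = 0%N.
Hypothesis p_mono : forall a, (a < n)%N -> (p a <= p a.+1)%N.
Hypothesis pn_gt0 : (0 < p n)%N.
Hypothesis qn : q n = 0%N.
Hypothesis q_mono : forall a, (a < n)%N -> (q a.+1 <= q a)%N.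
Hypothesis R_inj : forall i j, (i < p n)%N -> (j < p n)%N -> Rf i = Rf j -> i = j.
Hypothesis Q_inj : forall i j, (i < q 0)%N -> (j < q 0)%N -> Qf i = Qf j -> i = j.

Definition row_factor a : S := \prod_(R <- [seq Rf i | i <- index_iota (p a) (p a.+1)]) L1 R.
Definition col_factor a : S := \prod_(Q <- [seq Qf j | j <- index_iota (q a.+1) (q a)]) L2 Q.
Local Notation A := row_factor.
Local Notation B := col_factor.

Lemma p_le a b : (a <= b <= n)%N -> (p a <= p b)%N.
Proof.
elim: b => [|b IH]; first by rewrite leqn0 => /andP[/eqP->].
move=> /andP[]; rewrite leq_eqVlt => /orP[/eqP->//|ab bn].
by apply: leq_trans (p_mono bn); apply: IH; lia.
Qed.

Lemma q_le a b : (a <= b <= n)%N -> (q b <= q a)%N.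
Proof.
elim: b => [|b IH]; first by rewrite leqn0 => /andP[/eqP->].
move=> /andP[]; rewrite leq_eqVlt => /orP[/eqP->//|ab bn].
by apply: leq_trans (q_mono bn) _; apply: IH; lia.
Qed.

Lemma gen_factors s : (s <= n)%N ->
  gen A B n s = \prod_(0 <= i < p s) L1 (Rf i) * \prod_(0 <= j < q s) L2 (Qf j).
Proof.
move=> sn; rewrite /gen; congr (_ * _).
  elim: s sn => [|s IH] sn; first by rewrite p0 !big_geq.
  rewrite big_nat_recr //= IH; last by lia.
  by rewrite /A big_map [RHS](big_cat_nat (n := p s)) //= p_mono.
move: sn => /subnK; move: (n - s)%N => d dn.
elim: d s dn => [|d IH] s dn; first by rewrite add0n in dn; rewrite dn qn !big_geq.
rewrite big_ltn; last by lia.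
rewrite (IH s.+1); last by lia.
by rewrite /B big_map [RHS](big_cat_nat (n := q s.+1)) //= ?q_mono 1?mulrC //; lia.
Qed.

Lemma xprod_row_factor a : xprod (A a).
Proof. by apply: prodform_prod => R _; apply: xform_L1. Qed.

Lemma cols_disjoint a b Q : (a < b < n)%N ->
  Q \in [seq Qf j | j <- index_iota (q b.+1) (q b)] ->
  Q \notin [seq Qf j | j <- index_iota (q a.+1) (q a)].
Proof.
move=> abn /mapP[j]; rewrite mem_index_iota => hj ->; apply/mapP => -[j'].
rewrite mem_index_iota => hj' /Q_inj e.
have := @q_le 0 a; have := @q_le 0 b; have := @q_le a.+1 b; lia.
Qed.

(** The point (1 : x) avoids all rows: the values of the L_R at (1 : t) are nonzero polynomials in
    t, and so is their product, which has a nonroot. *)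
Lemma nonvanishing_point : exists x : k, forall i, (i < p n)%N ->
  hcoord (Rf i) 1 - hcoord (Rf i) 0 * x != 0.
Proof.
pose F i : {poly k} := (hcoord (Rf i) 1)%:P - (hcoord (Rf i) 0)%:P * 'X.
have F0 i : F i != 0.
  apply/eqP => e; have := hcoord_neq0 (Rf i).
  have := congr1 (fun P : {poly k} => P`_0) e; have := congr1 (fun P : {poly k} => P`_1) e.
  rewrite /= !coef0 /F !coefB !coefC !coefCM !coefX /= mulr1 mulr0 sub0r subr0.
  by move=> /eqP; rewrite oppr_eq0 => -> ->; rewrite eqxx.
have : \prod_(0 <= i < p n) F i != 0 by rewrite prodf_seq_neq0; apply/allP => i _; apply: F0.
move=> /closed_nonrootP[x hx]; exists x => i hi; move: hx; rewrite /root horner_prod.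
rewrite prodf_seq_neq0 => /allP /(_ i); rewrite mem_index_iota hi => /(_ isT) /=.
by rewrite /F !hornerE.
Qed.

Variable X : {fset P1 k * P1 k}.
Hypothesis X_pts : staircase_pts Rf Qf p q n X.

(** Either row i is among the first p_s and its form divides the generator, or s <= a, and then j <
    q_a <= q_s makes the form of column j divide it. *)
Lemma gen_I_pt P s : P \in X -> (s <= n)%N ->
  exists g h, gen A B n s = g * L1 P.1 + h * L2 P.2.
Proof.
case: P => R Q /X_pts[a [i [j [an hi hj -> ->]]]] sn /=; rewrite gen_factors //.
have [ips|psi] := ltnP i (p s).
  rewrite (bigD1_seq i) ?mem_index_iota ?iota_uniq //=.
  set x := \prod_(_ <- _ | _) _; set y := \prod_(_ <= _ < _) _.
  by exists (x * y), 0; ring.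
have sa : (s <= a)%N by rewrite leqNgt; apply/negP => sa; have := @p_le a.+1 s; lia.
have jq : (j < q s)%N by have := @q_le s a; lia.
rewrite mulrC (bigD1_seq j) ?mem_index_iota ?iota_uniq //=.
set x := \prod_(_ <- _ | _) _; set y := \prod_(_ <= _ < _) _.
by exists 0, (x * y); ring.
Qed.

Lemma square_ideal_sub_I_dbl f : square_ideal A B n f -> I_dbl X f.
Proof.
move=> [v ->] P PX; apply/ideal_mul2.
pose J f := exists x y z : S,
    f = x * L1 P.1 ^+ 2 + y * (L1 P.1 * L2 P.2) + z * L2 P.2 ^+ 2.
have JI : is_ideal J.
  split=> [|g h [x [y [z ->]]] [x' [y' [z' ->]]]|g h [x [y [z ->]]]].
  - by exists 0, 0, 0; ring.
  - by exists (x + x'), (y + y'), (z + z'); ring.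
  - by exists (g * x), (g * y), (g * z); ring.
rewrite /quad_eval big_nat; apply: (@ideal_sum _ J) => // t /andP[_ tn].
rewrite big_nat; apply: (@ideal_sum _ J) => // s /andP[_ sn].
have [g [h ->]] := gen_I_pt PX (ltac:(lia) : (s <= n)%N).
have [g' [h' ->]] := gen_I_pt PX (ltac:(lia) : (t <= n)%N).
by exists (v s t * (g * g')), (v s t * (g * h' + h * g')), (v s t * (h * h')); ring.
Qed.

(** Along row i, f is a combination of L^2, L V and V^2, where V is the product of the first q_a
    columns. If Pi is the product of the other rows, then L Pi is the last generator and Pi V is a
    multiple of the a-th one, so Pi^2 f is a combination of products of two generators. *)
Lemma row_conductor f i : I_dbl X f -> (i < p n)%N ->
  square_ideal A B n (\prod_(i' <- iota 0 (p n) | i' != i) L1 (Rf i') ^+ 2 * f).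
Proof.
move=> hf i_n; have [a an hi] := block_index p0 i_n.
have [_ JD JM] := square_ideal_is_ideal A B n.
pose t := [seq Qf j | j <- index_iota 0 (q a)].
have qa0 : (q a <= q 0)%N by apply: q_le; lia.
have [||x [y [z ->]]] := @I_row_double k (Rf i) t f.
- rewrite map_inj_in_uniq ?iota_uniq // => j j'; rewrite !mem_index_iota => hj hj'.
  by apply: Q_inj; lia.
- move=> Q /mapP[j]; rewrite mem_index_iota => hj ->; apply: (hf (Rf i, Qf j)).
  by apply/X_pts; exists a, i, j.
pose Pi := \prod_(i' <- iota 0 (p n) | i' != i) L1 (Rf i').
have -> : \prod_(i' <- iota 0 (p n) | i' != i) L1 (Rf i') ^+ 2 = Pi ^+ 2.
  by rewrite -prodrXl.
have Gn : gen A B n n = L1 (Rf i) * Pi.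
  rewrite gen_factors // qn [X in _ * X]big_geq // mulr1 (bigD1_seq i) ?iota_uniq //=.
    by rewrite /index_iota subn0.
  by rewrite mem_index_iota.
have [c Ka] : exists c, Pi * Vprod t = c * gen A B n a.
  exists (\prod_(p a <= i' < p n | i' != i) L1 (Rf i')).
  rewrite gen_factors ?(ltnW an) // mulrA /Vprod big_map; congr (_ * _).
  rewrite /Pi (_ : iota 0 (p n) = index_iota 0 (p n)); last by rewrite /index_iota subn0.
  rewrite (big_cat_nat (n := p a)) //=; last by apply: p_le; lia.
  rewrite mulrC; congr (_ * _); rewrite big_nat_cond [RHS]big_nat; apply: eq_bigl => i'.
  by case: (ltnP i' (p a)) => // h; rewrite andbT; lia.
rewrite (_ : Pi ^+ 2 * _ = x * (gen A B n n * gen A B n n) +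
  (y * c) * (gen A B n n * gen A B n a) + (z * c ^+ 2) * (gen A B n a * gen A B n a)).
  by apply: (JD); [apply: (JD)|]; apply: (JM); apply: square_ideal_gen => //; apply: ltnW.
transitivity (x * (L1 (Rf i) * Pi) ^+ 2 + y * (L1 (Rf i) * Pi) * (Pi * Vprod t)
   + z * (Pi * Vprod t) ^+ 2); first by ring.
by rewrite Ka -Gn; ring.
Qed.

Lemma I_dbl_square f : I_dbl X f <-> square_ideal A B n f.
Proof.
split=> [hf|]; last exact: square_ideal_sub_I_dbl.
have [x hx] := nonvanishing_point.
have c : (1 != 0 :> k) || (x != 0) by rewrite oner_neq0.
pose W : S := plane_vanish (inord 0) (inord 1) 1 x.
have [J0 JD JM] := square_ideal_is_ideal A B n.
(* The multipliers of f into the square form an ideal. By [row_conductor] it contains the product of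
   all squared rows but one, and any two squared rows generate W^3. *)
have [|||||N] := @conductor_power _ nat (iota 0 (p n)) (fun i => L1 (Rf i) ^+ 2)
    (fun g => square_ideal A B n (g * f)) W.
- split=> [|g h hg hh|g h hh].
  + by rewrite mul0r.
  + by rewrite mulrDl; apply: JD.
  + by rewrite -mulrA; apply: JM.
- exact: iota_uniq.
- by rewrite -size_eq0 size_iota -lt0n.
- by move=> i; rewrite mem_iota => hi; apply: row_conductor.
- move=> i j; rewrite !mem_iota => hi hj ij; exists 3%N.
  have [||g [h e]] := @L1_span _ (Rf i) (Rf j) W.
  + by apply: contra_neq ij; apply: R_inj; lia.
  + by exists x, (- 1); rewrite orbC oppr_eq0 c scaleNr.
  by have := expr3_in_squares e => ->; do 2 eexists.
elim: N => [|N IH]; first by rewrite mul1r.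
rewrite exprS -mulrA => /square_ideal_regular h; apply: IH; apply: h => //.
- move=> a an; rewrite /A rmorph_prod big_map; apply: prodform_prod => i.
  rewrite mem_index_iota => hi.
  rewrite /= /L1 -scaleNr plane_proj_form ?xvar //; apply: form_scale => //.
  by rewrite mulr1 mulNr; apply: hx; have := @p_le a.+1 n; lia.
- exact: cols_disjoint.
Qed.
End DoublePointIdeal.

(** * Cohen-Macaulay supports have nested rows *)

Section ACM.
Local Open Scope ring_scope.
Variable k : fieldType.
Local Notation S := {mpoly k[4]}.
Implicit Types (f g : S) (R Q : P1 k) (P : P1 k * P1 k).

(** Presents I_P as the kernel of an endomorphism of a domain: it is prime, and membership becomes
    an equation. *)
Lemma I_ptP P f : I_pt P f <-> projx P.1 (projy P.2 f) = 0.
Proof.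
split=> [/ideal_gen2[g [h ->]]|/projx_eq0[g e]].
  have -> : projy P.2 (g * L1 P.1 + h * L2 P.2) = projy P.2 g * L1 P.1.
    rewrite rmorphD !rmorphM /= projy_L2 mulr0 addr0.
    by rewrite (projy_x _ (form_prodform (xform_L1 _))).
  by rewrite rmorphM /= projx_L1 mulr0.
apply/ideal_gen2; have [h ->] := projy_mod P.2 f; exists g, h.
by rewrite e mulrC [h * _]mulrC.
Qed.

Lemma ker_prime (D : idomainType) (phi : {rmorphism S -> D}) :
  is_prime_ideal (fun f => phi f = 0).
Proof.
split=> [||f g].
- split=> [|f g hf hg|a f hf]; first exact: rmorph0.
    by rewrite rmorphD hf hg addr0.
  by rewrite rmorphM hf mulr0.
- by rewrite rmorph1; apply/eqP/oner_neq0.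
- by rewrite rmorphM => /eqP; rewrite mulf_eq0 => /orP[] /eqP; [left | right].
Qed.

Lemma I_pt_prime P : is_prime_ideal (I_pt P).
Proof.
have [[h0 hD hM] h1 hp] := ker_prime (projx P.1 \o projy P.2 : {rmorphism S -> S}).
split=> [||f g /I_ptP /hp[] h]; [split=> [|f g|a f]| | left | right].
- exact/I_ptP.
- by move=> /I_ptP hf /I_ptP hg; apply/I_ptP; apply: hD.
- by move=> /I_ptP hf; apply/I_ptP; apply: hM.
- by move=> /I_ptP.
- exact/I_ptP.
- exact/I_ptP.
Qed.

Definition kill (K : pred 'I_4) : S -> S :=
  comp_mpoly [tuple if K l then 0 else 'X_l | l < 4].
HB.instance Definition _ K := GRing.RMorphism.on (kill K).

Lemma killX K l : kill K 'X_l = if K l then 0 else 'X_l.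
Proof. by rewrite /kill comp_mpolyXU -tnth_nth tnth_mktuple. Qed.

Lemma killZ K c f : kill K (c *: f) = c *: kill K f.
Proof. exact: comp_mpolyZ. Qed.

Lemma kill_form (K : pred 'I_4) i j f : K i -> K j -> form i j f -> kill K f = 0.
Proof.
by move=> Ki Kj [a [b [_ ->]]]; rewrite rmorphD /= !killZ !killX Ki Kj !scaler0 addr0.
Qed.

Lemma kill_prodform (K : pred 'I_4) i j f : ~~ K i -> ~~ K j -> prodform i j f -> kill K f = f.
Proof.
move=> /negPf Ki /negPf Kj [s hs ->]; rewrite rmorph_prod big_seq [RHS]big_seq.
apply: eq_bigr => x /hs [a [b [_ ->]]].
by rewrite rmorphD /= !killZ !killX Ki Kj.
Qed.

Definition isx (l : 'I_4) := (l < 2)%N.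
Definition isy (l : 'I_4) := (2 <= l)%N.

(** The kernels of [phi0], [phi1], [phi2] are I_P, (L_R, y0, y1) and the irrelevant ideal. Together
    with Cohen-Macaulayness this chain bounds the depth below by 2. *)
Lemma prime_chain_I_pt (I : S -> Prop) P : sub_pred I (I_pt P) ->
  exists p, prime_chain I 2 p.
Proof.
case: P => R Q sub.
pose phi0 : {rmorphism S -> S} := projx R \o projy Q.
pose phi1 : {rmorphism S -> S} := projx R \o kill isy.
pose phi2 : {rmorphism S -> k} := meval (fun _ : 'I_4 => 0 : k).
have x_isy f : xprod f -> kill isy f = f by apply: kill_prodform; rewrite /isy inordK.
have y_isy f : yform f -> kill isy f = 0 by apply: kill_form; rewrite /isy inordK.
have sub01 f : phi0 f = 0 -> phi1 f = 0.
  move=> /(I_ptP (R, Q)) /ideal_gen2[g [h ->]] /=.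
  have -> : kill isy (g * L1 R + h * L2 Q) = kill isy g * L1 R.
    rewrite rmorphD !rmorphM /= (y_isy _ (yform_L2 _)) mulr0 addr0.
    by rewrite (x_isy _ (form_prodform (xform_L1 _))).
  by rewrite rmorphM /= projx_L1 mulr0.
have phi21 f : phi2 (phi1 f) = phi2 f.
  elim/mpoly_alg_ind: f => [c|i|f g ef eg|f g ef eg].
  - by rewrite /phi1 /= /kill comp_mpolyC [projx _ _]plane_projC.
  - rewrite /phi1 /= killX; case: ifP => _; first by rewrite !rmorph0 /phi2 /= mevalXU.
    rewrite [projx _ _]plane_projX /plane_gen /phi2 /=.
    by do !case: ifP => _; rewrite ?mevalZ ?mevalXU ?mulr0.
  - by rewrite !rmorphD ef eg.
  - by rewrite !rmorphM ef eg.
have gx : xform (genx R) by apply/form_plane_gen/hcoord_neq0.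
have gy : yform (geny Q) by apply/form_plane_gen/hcoord_neq0.
exists (fun i => match i with 0 => fun f => phi0 f = 0 | 1 => fun f => phi1 f = 0
                 | _ => fun f => phi2 f = 0 end); split.
  have subI f : I f -> phi0 f = 0 by move=> /sub /I_ptP.
  case=> [|[|[|//]]] _; split.
  - exact: (ker_prime phi0).
  - exact: subI.
  - exact: (ker_prime phi1).
  - by move=> f /subI; apply: sub01.
  - exact: (ker_prime phi2).
  - by move=> f /subI /sub01 h; rewrite -phi21 h rmorph0.
case=> [|[|//]] _; split=> [f|].
- exact: sub01.
- move=> /(_ (geny Q)); rewrite /phi1 /= (y_isy _ gy) rmorph0 => /(_ erefl).
  rewrite /phi0 /= [projy _ _](plane_proj_gen yvar (hcoord_neq0 Q)).
  by rewrite (projx_y _ (form_prodform gy)) => /eqP; rewrite (negPf (form_neq0 yvar gy)).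
- by move=> h; rewrite -phi21 h rmorph0.
- move=> /(_ (genx R)); rewrite /phi1 /= (x_isy _ (form_prodform gx)).
  rewrite [projx _ _](plane_proj_gen xvar (hcoord_neq0 R)) => h.
  have g0 : genx R = 0.
    apply: h; rewrite /genx /plane_gen /phi2 /=.
    by case: ifP => _; rewrite mevalZ mevalXU mulr0.
  by move: (form_neq0 xvar gx); rewrite -/(genx R) g0 eqxx.
Qed.

Lemma prod_mem_dvd (T : eqType) (t : seq T) (F : T -> S) x : x \in t ->
  exists g, \prod_(y <- t) F y = F x * g.
Proof. by move=> xt; rewrite (big_rem x xt) /=; eexists. Qed.

(** * Lifting families from the points to S/I_X in depth 2 *)

Section Depth.
Variable X : {fset P1 k * P1 k}.

(* The family (s_P), seen in the product of the rings S/I_P, comes from S/I_X. *)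
Definition global (s : P1 k * P1 k -> S) := exists F, forall P, P \in X -> I_pt P (F - s P).

Lemma global_ideal s : is_ideal (fun g => global (fun P => g * s P)).
Proof.
split=> [|f g [F hF] [G hG]|a f [F hF]].
- exists 0 => P _; rewrite mul0r subrr; apply/I_ptP; by rewrite !rmorph0.
- exists (F + G) => P PX; have [[_ JD _] _ _] := I_pt_prime P.
  by rewrite mulrDl opprD addrACA; apply: JD; [apply: hF | apply: hG].
- exists (a * F) => P PX; have [[_ _ JM] _ _] := I_pt_prime P.
  by rewrite -mulrA -mulrBr; apply: JM; apply: hF.
Qed.

(** If f were in I_P, then f times a product of forms, one through each other point and none through
    P, would lie in I_X although the cofactor is outside I_P. Points in the row of P are cut out by
    their column, all others by their row. *)
Lemma regular_notin f P : (forall g, I_pts X (f * g) -> I_pts X g) -> P \in X -> ~ I_pt P f.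
Proof.
move=> hf PX fP.
pose l P' := if P'.1 == P.1 then L2 P'.2 else L1 P'.1.
pose t := [seq P' <- X | P' != P]; pose g := \prod_(P' <- t) l P'.
have [[_ _ JM] J1 Jp] := I_pt_prime P.
have /hf /(_ P PX) : I_pts X (f * g).
  move=> P' P'X; have [[_ _ JM'] _ _] := I_pt_prime P'.
  have [->|PP'] := eqVneq P' P; first by rewrite mulrC; apply: JM.
  have [|g' eg] := @prod_mem_dvd _ t l P'; first by rewrite mem_filter PP'.
  rewrite /g eg mulrCA mulrC; apply: (JM'); apply/ideal_gen2; rewrite /l.
  by case: ifP => _; [exists 0, 1 | exists 1, 0]; rewrite mul0r mul1r ?add0r ?addr0.
have : forall P', P' \in t -> P' != P by move=> P'; rewrite mem_filter => /andP[].
rewrite /g; elim: t {g} => [_|P' t IH ht]; first by rewrite big_nil.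
have PP' := ht P' (mem_head _ _); rewrite big_cons => /Jp[]; last first.
  by apply: IH => P'' h; apply: ht; rewrite inE h orbT.
move=> /I_ptP; rewrite /l; case: eqP => [e|/eqP n12].
  have : P'.2 != P.2 by apply: contra_neq PP' => e'; by rewrite [P']surjective_pairing e e' -surjective_pairing.
  move=> n; have /form_prodform hy := yform_projy_L2 n.
  by rewrite (projx_y _ hy) => /eqP; rewrite (negPf (yprod_neq0 hy)).
rewrite (projy_x _ (form_prodform (xform_L1 _))).
have [a a0 ->] := projx_L1_neq n12.
have gx : xform (a *: genx P.1) by apply: form_scale => //; apply: hcoord_neq0.
by move/eqP; rewrite (negPf (form_neq0 xvar gx)).
Qed.

Hypothesis depth2 : exists f1 f2, [/\ irr_ideal f1, irr_ideal f2,
  forall g, I_pts X (f1 * g) -> I_pts X g &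
  forall g h, I_pts X (f2 * g - f1 * h) -> exists h', I_pts X (g - f1 * h')].

(** The cokernel of S/I_X -> prod_P S/I_P has no socle: f1 s and f2 s lift to some a and b with f2 a
    = f1 b modulo I_X, hence a = f1 h' there, and h' lifts s because f1 lies in no prime I_P. *)
Lemma global_regular s :
  (forall v, v \in [:: x0 k; x1 k; y0 k; y1 k] -> global (fun P => v * s P)) -> global s.
Proof.
case: depth2 => f1 [f2 [m1 m2 r1 r2]] h.
have hm f : irr_ideal f -> global (fun P => f * s P).
  case=> c ->; apply: (ideal_sum (J := fun g => global (fun P => g * s P))).
    exact: global_ideal.
  move=> i _; have [_ _ JM] := global_ideal s; apply: JM; apply: h; exact: mem_nth.
have [a ha] := hm _ m1; have [b hb] := hm _ m2.
have [P PX|h' hh'] := r2 a b.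
  have [[_ JD JM] _ _] := I_pt_prime P.
  rewrite (_ : _ - _ = f2 * (a - f1 * s P) + (- f1) * (b - f2 * s P)); last by ring.
  by apply: JD; apply: JM; [apply: ha | apply: hb].
exists h' => P PX; have [[_ JD JM] _ Jp] := I_pt_prime P.
have /Jp[] // : I_pt P (f1 * (h' - s P)).
  rewrite (_ : _ * _ = (a - f1 * s P) + (-1) * (a - f1 * h')); last by ring.
  by apply: JD; [apply: ha | apply: JM; apply: hh'].
by move=> f1P; case: (regular_notin r1 PX f1P).
Qed.

(** Without socle there is no torsion for powers of the variables. Induction on the sum of the
    exponents: passing from s to v s lowers the exponent of the variable v. *)
Lemma global_conductor s :
  (forall v, v \in [:: x0 k; x1 k; y0 k; y1 k] -> exists N, global (fun P => v ^+ N * s P)) ->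
  global s.
Proof.
pose vs := [:: x0 k; x1 k; y0 k; y1 k].
have main M : forall s (N : nat -> nat), (N 0 + N 1 + N 2 + N 3 <= M)%N ->
    (forall i, (i < 4)%N -> global (fun P => vs`_i ^+ N i * s P)) -> global s.
  elim: M => [|M IH] {}s N hN hs.
    have := hs 0%N isT; have -> : N 0%N = 0%N by lia.
    by case=> F hF; exists F => P /hF; rewrite mul1r.
  have [/hasP[i]|/hasPn pos] := boolP (has (fun i => N i == 0%N) (iota 0 4)).
    rewrite mem_iota => i4 /eqP Ni; have := hs i i4; rewrite Ni.
    by case=> F hF; exists F => P /hF; rewrite mul1r.
  have {}pos i : (i < 4)%N -> (0 < N i)%N by move=> i4; rewrite lt0n pos // mem_iota.
  apply: global_regular => v /(nthP 0)[i i4 <-].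
  apply: (IH _ (fun j => if j == i then (N j).-1 else N j)).
    move: (pos 0%N isT) (pos 1%N isT) (pos 2%N isT) (pos 3%N isT).
    by move: i i4 => [|[|[|[|//]]]] _ /=; lia.
  move=> j j4; case: eqP => [->|_]; have [F hF] := hs j j4.
    have [G hG] := hs i i4; exists G => P /hG; move: (pos i i4); case: (N i) => // m _.
    by rewrite exprSr mulrA.
  have [_ _ JM] := global_ideal s; have [G hG] := JM vs`_i _ (hs j j4).
  by exists G => P /hG; rewrite -mulrA [vs`_j ^+ _ * (_ * _)]mulrCA.
move=> h.
have [N hN] := @fin_choice nat 4 (fun i N => global (fun P => vs`_i ^+ N * s P)) 0%N
  (fun i i4 => h vs`_i (@mem_nth _ 0 vs i i4)).
exact: (main _ s N (leqnn _)).
Qed.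

(** Two distinct rows span all linear forms in x, and two distinct columns all those in y, so
    [conductor_power] gives a power of every variable that multiplies s into the image. *)
Lemma global_var (rows cols : seq (P1 k)) s :
  uniq rows -> rows != [::] -> uniq cols -> cols != [::] ->
  (forall R, R \in rows -> global (fun P => \prod_(R' <- rows | R' != R) L1 R' * s P)) ->
  (forall Q, Q \in cols -> global (fun P => \prod_(Q' <- cols | Q' != Q) L2 Q' * s P)) ->
  global s.
Proof.
move=> ur r0 uc c0 hr hc; apply: global_conductor => v.
have JI := global_ideal s.
have hx w : xform w -> exists N, global (fun P => w ^+ N * s P).
  move=> hw; apply: (conductor_power JI ur r0 hr) => R R' _ _ RR'.
  have [g [h ->]] := L1_span RR' hw; exists 1%N, g, h.
  by rewrite expr1 mulrC [h * _]mulrC.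
have hy w : yform w -> exists N, global (fun P => w ^+ N * s P).
  move=> hw; apply: (conductor_power JI uc c0 hc) => Q Q' _ _ QQ'.
  have [g [h ->]] := L2_span QQ' hw; exists 1%N, g, h.
  by rewrite expr1 mulrC [h * _]mulrC.
have f1 (i j : 'I_4) : form i j ('X_i : S).
  by exists 1, 0; rewrite oner_neq0 scale1r scale0r addr0.
have f2 (i j : 'I_4) : form i j ('X_j : S).
  by exists 0, 1; rewrite oner_neq0 orbT scale1r scale0r add0r.
rewrite !inE => /or4P[] /eqP->; [apply: hx|apply: hx|apply: hy|apply: hy].
- exact: f1.
- exact: f2.
- exact: f1.
- exact: f2.
Qed.
End Depth.

(** * Interpolation along a row and the grading in y *)

Lemma projy_Vprod Q (t : seq (P1 k)) :
  exists2 a, projy Q (Vprod t) = a *: geny Q ^+ size t & Q \notin t -> a != 0.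
Proof.
elim: t => [|Q' t [a ea na]].
  by exists 1; rewrite ?oner_neq0 // /Vprod big_nil rmorph1 scale1r.
rewrite /Vprod big_cons -/(Vprod t) rmorphM /= ea; have [<-|QQ'] := eqVneq Q' Q.
  by exists 0; rewrite ?mem_head // projy_L2 mul0r scale0r.
have [b b0 ->] := projy_L2_neq QQ'; exists (b * a).
  by rewrite -scalerAl -scalerAr scalerA exprS.
by rewrite inE negb_or mulf_eq0 (negPf b0) => /andP[_ /na].
Qed.

(** Lagrange interpolation by forms in y of degree |T|: the basis element at Q is the product over
    the other points of t, scaled and padded by a power of [geny Q]; the bound on the size of t
    leaves room for the padding. *)
Lemma interpolation (t T : seq (P1 k)) (c : pred (P1 k)) : uniq t ->
  (size t <= size T)%N ->
  exists K, forall Q, Q \in t -> projy Q K = if c Q then projy Q (Vprod T) else 0.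
Proof.
move=> ut tT.
have N Q : Q \in t -> exists N, projy Q N = projy Q (Vprod T) /\
    forall Q', Q' \in t -> Q' != Q -> projy Q' N = 0.
  move=> Qt; have [a ea _] := projy_Vprod Q T; have [b eb b0] := projy_Vprod Q (rem Q t).
  have Qr : Q \notin rem Q t by rewrite mem_rem_uniqF.
  have gQ : projy Q (geny Q) = geny Q by exact: (plane_proj_gen yvar (hcoord_neq0 Q)).
  exists ((a / b) *: (geny Q ^+ (size T - size (rem Q t))) * Vprod (rem Q t)); split.
    have eZ m : projy Q ((a / b) *: geny Q ^+ m) = (a / b) *: geny Q ^+ m.
      by rewrite -mul_mpolyC rmorphM rmorphXn /= gQ [projy Q _%:MP]plane_projC.
    rewrite rmorphM /= eZ eb ea.
    rewrite -scalerAl -scalerAr scalerA mulfVK ?b0 // -exprD subnK //.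
    by rewrite size_rem //; case: (size t) tT => //= m; apply: ltnW.
  move=> Q' Q't Q'Q; have [|g eg] := @prod_mem_dvd _ (rem Q t) (@L2 k) Q'.
    by rewrite mem_rem_uniq // inE Q'Q.
  by rewrite /Vprod eg mulrCA rmorphM /= projy_L2 mul0r.
have main u : uniq u -> {subset u <= t} -> exists K, forall Q, Q \in t ->
    projy Q K = if Q \in u then projy Q (Vprod T) else 0.
  elim: u => [|Q u IH] /=; first by exists 0 => Q _; rewrite rmorph0.
  move=> /andP[Qu uu] sub; have [//||K hK] := IH.
    by move=> Q' Q'u; apply: sub; rewrite inE Q'u orbT.
  have [K' [h1 h2]] := N Q (sub Q (mem_head _ _)); exists (K' + K) => Q' Q't.
  rewrite rmorphD /= hK // inE; have [->|n] := eqVneq Q' Q.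
    by rewrite h1 (negPf Qu) addr0.
  by rewrite h2 // add0r.
have [||K hK] := main (filter c t); first exact: filter_uniq.
  by move=> Q; rewrite mem_filter => /andP[].
by exists K => Q Qt; rewrite hK // mem_filter Qt andbT.
Qed.

Lemma rows_dvd (t : seq (P1 k)) f : uniq t -> (forall R, R \in t -> exists g, f = L1 R * g) ->
  exists g, f = \prod_(R <- t) L1 R * g.
Proof.
elim: t => [|R t IH] /=; first by exists f; rewrite big_nil mul1r.
move=> /andP[Rt ut] h; have [//||g fg] := IH.
  by move=> R' R't; apply: h; rewrite inE R't orbT.
have [g' e] := h R (mem_head _ _).
have [h' gh] : exists h', g = L1 R * h'.
  apply: projx_eq0; have := congr1 (projx R) (etrans (esym fg) e).
  rewrite !rmorphM /= projx_L1 mul0r => /eqP; rewrite mulf_eq0 => /orP[|/eqP//].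
  rewrite rmorph_prod prodf_seq_eq0 => /hasP[R' R't /=].
  have [|a a0 ->] := @projx_L1_neq _ R' R; first by apply: contraNneq Rt => <-.
  have gx : xform (a *: genx R) by apply: form_scale => //; apply: hcoord_neq0.
  by rewrite (negPf (form_neq0 xvar gx)).
by exists h'; rewrite big_cons fg gh; ring.
Qed.

(** The substitution y |-> y T, fixing x; the coefficient of T^b is the component of degree b in
    y. *)
Definition ygrade : S -> {poly S} :=
  mmap (polyC \o @mpolyC 4 k) (fun l => if isx l then ('X_l)%:P else 'X_l *: 'X).
HB.instance Definition _ := GRing.RMorphism.on ygrade.

Definition ypart b f : S := (ygrade f)`_b.

Lemma ygradeX l : ygrade 'X_l = if isx l then ('X_l)%:P else 'X_l *: 'X.
Proof. by rewrite /ygrade mmapX mmap1U. Qed.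

Lemma ygradeZ c f : ygrade (c *: f) = (c%:MP)%:P * ygrade f.
Proof. by rewrite /ygrade mmapZ. Qed.

Lemma ygrade_xprod f : xprod f -> ygrade f = f%:P.
Proof.
case=> s hs ->; rewrite !rmorph_prod big_seq [RHS]big_seq; apply: eq_bigr => l /hs[a [b [_ ->]]].
rewrite /= [ygrade _]rmorphD /= !ygradeZ !ygradeX /isx !inordK //= -!polyCM -polyCD.
by rewrite !mul_mpolyC.
Qed.

Lemma ygrade_L2 Q : ygrade (L2 Q) = (L2 Q)%:P * 'X.
Proof.
rewrite /L2 rmorphB /= !ygradeZ !ygradeX /isx !inordK //= -!mul_polyC !mulrA -!polyCM -mulrBl.
by rewrite -polyCB !mul_mpolyC.
Qed.

Lemma ygrade_Vprod t : ygrade (Vprod t) = (Vprod t)%:P * 'X^(size t).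
Proof.
elim: t => [|Q t IH]; first by rewrite /Vprod big_nil rmorph1 mul1r.
by rewrite /Vprod big_cons -/(Vprod t) rmorphM /= IH ygrade_L2 polyCM exprS; ring.
Qed.

Lemma ypartB b f g : ypart b (f - g) = ypart b f - ypart b g.
Proof. by rewrite /ypart rmorphB coefB. Qed.

Lemma ypart_mulx b f g : xprod f -> ypart b (f * g) = f * ypart b g.
Proof. by move=> hf; rewrite /ypart rmorphM /= ygrade_xprod // coefCM. Qed.

Lemma ypart_big b t g : (b < size t)%N -> ypart b (Vprod t * g) = 0.
Proof.
by move=> bt; rewrite /ypart rmorphM /= ygrade_Vprod -mulrA coefCM coefXnM bt mulr0.
Qed.

Lemma ypart_Vprod t : ypart (size t) (Vprod t) = Vprod t.
Proof. by rewrite /ypart ygrade_Vprod coefCM coefXn eqxx mulr1. Qed.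

(** By [I_row_simple], f = L_R g + V h, and V h starts in degree |t| > b. *)
Lemma ypart_row b R t f : uniq t -> (b < size t)%N ->
  (forall Q, Q \in t -> I_pt (R, Q) f) -> exists g, ypart b f = L1 R * g.
Proof.
move=> ut bt /(I_row_simple ut)[g [h ->]]; exists (ypart b g).
rewrite -[Vprod t * h]opprK -mulrN ypartB ypart_big // subr0 ypart_mulx //.
exact/form_prodform/xform_L1.
Qed.

(** * The obstruction coming from two incomparable rows *)

Section Nested.
Variable X : {fset P1 k * P1 k}.

Definition fiber R : seq (P1 k) := [seq P.2 | P <- X & P.1 == R].

Lemma mem_fiber R Q : (Q \in fiber R) = ((R, Q) \in X).
Proof.
apply/mapP/idP => [[[R' Q']]|h]; last by exists (R, Q); rewrite // mem_filter /= eqxx.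
by rewrite mem_filter /= => /andP[/eqP-> h] ->.
Qed.

Lemma uniq_fiber R : uniq (fiber R).
Proof.
rewrite map_inj_in_uniq ?filter_uniq ?fset_uniq //.
move=> [R1 Q1] [R2 Q2]; rewrite !mem_filter /=.
by move=> /andP[/eqP-> _] /andP[/eqP-> _] ->.
Qed.

Lemma size_fiber R : #|` [fset P in X | P.1 == R]%fset| = size (fiber R).
Proof.
rewrite /fiber size_map; apply: perm_size; apply: uniq_perm.
- exact: fset_uniq.
- exact/filter_uniq/fset_uniq.
- by move=> P; rewrite mem_filter !inE andbC.
Qed.

Section Obstruction.
Variables R1 R2 Q1 Q2 : P1 k.
Hypotheses (h11 : (R1, Q1) \in X) (h21 : (R2, Q1) \notin X).
Hypotheses (h22 : (R2, Q2) \in X) (h12 : (R1, Q2) \notin X).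

(* The family s_P = h G on the columns meeting the row R1, and 0 elsewhere.
   Along each row it is a form of degree b in y: h kills the other rows with
   more than b points, on the shorter ones every function is interpolated in
   degree b, and G vanishes on the common columns of R1 and R2.  But it does
   not come from S/I_X. *)
Let rows := undup [seq P.1 | P <- X].
Let cols := undup [seq P.2 | P <- X].
Let T := [seq Q <- fiber R1 | Q \in fiber R2].
Let b := size T.
Let G : S := Vprod T.
Let big := [seq R <- rows | [&& R != R1, R != R2 & (b < size (fiber R))%N]].
Let h : S := \prod_(R <- big) L1 R.
Let s P : S := if P.2 \in fiber R1 then h * G else 0.

Lemma mem_rows P : P \in X -> P.1 \in rows.
Proof. by move=> PX; rewrite mem_undup map_f. Qed.

Lemma mem_cols P : P \in X -> P.2 \in cols.
Proof. by move=> PX; rewrite mem_undup map_f. Qed.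

Lemma size_T1 : (b < size (fiber R1))%N.
Proof.
rewrite /b /T size_filter -(count_predC (mem (fiber R2)) (fiber R1)) -[X in (X < _)%N]addn0.
rewrite ltn_add2l -has_count; apply/hasP; exists Q1; rewrite ?mem_fiber //=.
by rewrite mem_fiber.
Qed.

Lemma size_T2 : (b < size (fiber R2))%N.
Proof.
have : (size (Q2 :: T) <= size (fiber R2))%N.
  apply: uniq_leq_size.
    rewrite cons_uniq (filter_uniq _ (uniq_fiber R1)) andbT.
    apply/negP; rewrite mem_filter => /andP[_ hQ]; move/negP: h12; apply.
    by rewrite -mem_fiber; exact: hQ.
  move=> Q; rewrite inE => /orP[/eqP->|]; first by rewrite mem_fiber.
  by rewrite mem_filter => /andP[].
by [].
Qed.

Lemma G_vanish P : P.1 = R2 -> P \in X -> exists g, s P = L2 P.2 * g.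
Proof.
case: P => R Q /= -> PX; rewrite /s /=; case: ifP => [Q1X|_]; last by exists 0; rewrite mulr0.
have [|g Gg] := @prod_mem_dvd _ T (@L2 k) Q.
  by rewrite mem_filter; apply/andP; split; [rewrite mem_fiber; exact: PX | exact: Q1X].
by exists (h * g); rewrite /G /Vprod Gg mulrCA.
Qed.

Lemma I_pt_L1 P f : I_pt P (L1 P.1 * f).
Proof. by apply/ideal_gen2; exists f, 0; rewrite mul0r addr0 mulrC. Qed.

Lemma I_pt_L2 P f : I_pt P (L2 P.2 * f).
Proof. by apply/ideal_gen2; exists 0, f; rewrite mul0r add0r mulrC. Qed.

Lemma global_col Q : Q \in cols -> global X (fun P => \prod_(Q' <- cols | Q' != Q) L2 Q' * s P).
Proof.
move=> Qc; exists (\prod_(Q' <- cols | Q' != Q) L2 Q' * (if Q \in fiber R1 then h * G else 0)).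
move=> P PX; rewrite -mulrBr; have [PQ|PQ] := eqVneq P.2 Q.
  by rewrite /s PQ subrr mulr0; apply/I_ptP; rewrite !rmorph0.
have [|g e] := @prod_mem_dvd _ [seq Q' <- cols | Q' != Q] (@L2 k) P.2.
  by rewrite mem_filter PQ mem_cols.
by rewrite -big_filter e -mulrA; apply: I_pt_L2.
Qed.

Lemma global_row R : R \in rows -> global X (fun P => \prod_(R' <- rows | R' != R) L1 R' * s P).
Proof.
move=> Rr; set E := \prod_(_ <- _ | _) _.
(* On the single row R the family is induced by one element h K. The product E of the other rows
   then vanishes at every point off R, so E h K lifts E s. *)
have [K hK] : exists K, forall P, P \in X -> P.1 = R -> I_pt P (h * K - s P).
  have [->|R1R] := eqVneq R R1.
    exists G => -[R' Q'] PX /= R'R; rewrite /s /= mem_fiber -R'R PX subrr.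
    by apply/I_ptP; rewrite !rmorph0.
  have [->|R2R] := eqVneq R R2.
    exists 0 => P PX PR; have [g ->] := G_vanish PR PX.
    by rewrite mulr0 sub0r -mulrN; apply: I_pt_L2.
  have [bR|Rb] := ltnP b (size (fiber R)).
    have [|g eh] := @prod_mem_dvd _ big (@L1 k) R.
      by rewrite mem_filter; apply/andP; split; [apply/and3P | exact: Rr].
    exists 0 => P PX PR; rewrite mulr0 sub0r /s; case: ifP => _; last first.
      by rewrite oppr0; apply/I_ptP; rewrite !rmorph0.
    by rewrite /h eh -PR -mulrA -mulrN; apply: I_pt_L1.
  have [K hK] := interpolation (mem (fiber R1)) (uniq_fiber R) Rb; exists K => P PX PR.
  have [g e] : exists g, K - (if P.2 \in fiber R1 then G else 0) = L2 P.2 * g.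
    apply: projy_eq0; rewrite rmorphB /= hK; last by rewrite mem_fiber -PR -surjective_pairing.
    by rewrite /=; case: ifP => _; rewrite ?rmorph0 subrr.
  have -> : s P = h * (if P.2 \in fiber R1 then G else 0).
    by rewrite /s; case: ifP; rewrite ?mulr0.
  by rewrite -mulrBr e mulrCA; apply: I_pt_L2.
exists (E * (h * K)) => P PX; rewrite -mulrBr; have [PR|PR] := eqVneq P.1 R.
  have [[_ _ JM] _ _] := I_pt_prime P; exact/JM/hK.
have [|g e] := @prod_mem_dvd _ [seq R' <- rows | R' != R] (@L1 k) P.1.
  by rewrite mem_filter PR mem_rows.
by rewrite /E -big_filter e -mulrA; apply: I_pt_L1.
Qed.

Lemma L1_dvd_prod R (t : seq (P1 k)) f g : R \notin t ->
  \prod_(R' <- t) L1 R' * f = L1 R * g -> exists g', f = L1 R * g'.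
Proof.
move=> Rt e; apply: projx_eq0; have := congr1 (projx R) e.
rewrite !rmorphM /= projx_L1 mul0r => /eqP; rewrite mulf_eq0 => /orP[|/eqP//].
rewrite rmorph_prod prodf_seq_eq0 => /hasP[R' R't /=].
have [|a a0 ->] := @projx_L1_neq _ R' R; first by apply: contraNneq Rt => <-.
have gx : xform (a *: genx R) by apply: form_scale => //; apply: hcoord_neq0.
by rewrite (negPf (form_neq0 xvar gx)).
Qed.

(* The part of degree b in y of a lift F would be h g with g - G in (L_R1) and
   g in (L_R2); setting x = 0 gives G = 0. *)
Lemma not_global : ~ global X s.
Proof.
case=> F hF.
have yh : xprod h by apply: prodform_prod => R _; apply: xform_L1.
have eF R : R \in big -> exists g, ypart b F = L1 R * g.
  move=> Rbig; move: (Rbig); rewrite mem_filter => /andP[/and3P[_ _ bR] _].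
  apply: (ypart_row (uniq_fiber R) bR) => Q; rewrite mem_fiber => RQ.
  have [[_ JD JM] _ _] := I_pt_prime (R, Q).
  rewrite -[F](subrK (s (R, Q))); apply: JD; first exact: hF.
  have [|g eh] := @prod_mem_dvd _ big (@L1 k) R; first by [].
  rewrite /s; case: ifP => _; last by apply/I_ptP; rewrite !rmorph0.
  by rewrite /h eh -mulrA; apply: (@I_pt_L1 (R, Q)).
have [|g eg] := rows_dvd _ eF; first by rewrite filter_uniq ?undup_uniq.
have [u1 e1] : exists u, ypart b (F - h * G) = L1 R1 * u.
  apply: (ypart_row (uniq_fiber R1) size_T1) => Q hQ.
  have := hF (R1, Q); rewrite -mem_fiber => /(_ hQ).
  by rewrite /s /= hQ.
have [u2 e2] : exists u, ypart b F = L1 R2 * u.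
  apply: (ypart_row (uniq_fiber R2) size_T2) => Q; rewrite mem_fiber => hQ.
  have [[_ JD JM] _ _] := I_pt_prime (R2, Q).
  rewrite -[F](subrK (s (R2, Q))); apply: JD; first exact: hF.
  have [//|g' ->] := @G_vanish (R2, Q) _ hQ.
  exact: (@I_pt_L2 (R2, Q)).
rewrite ypartB (ypart_mulx _ _ yh) ypart_Vprod eg -/h -mulrBr in e1.
rewrite eg in e2.
have [|v1 {}e1] := L1_dvd_prod _ e1; first by rewrite mem_filter eqxx.
have [|v2 {}e2] := L1_dvd_prod _ e2; first by rewrite mem_filter eqxx andbF.
have kx R : kill isx (L1 R) = 0 by apply: (kill_form _ _ (xform_L1 R)); rewrite /isx inordK.
have kG : kill isx G = G by apply: (kill_prodform _ _ (yprod_L2 T)); rewrite /isx inordK.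
have : kill isx (g - G) = 0 by rewrite e1 rmorphM /= kx mul0r.
rewrite rmorphB /= kG e2 rmorphM /= kx mul0r sub0r => /eqP.
by rewrite oppr_eq0 (negPf (yprod_neq0 (yprod_L2 T))).
Qed.

Lemma no_obstruction : ~ exists f1 f2, [/\ irr_ideal f1, irr_ideal f2,
  forall g, I_pts X (f1 * g) -> I_pts X g &
  forall g h, I_pts X (f2 * g - f1 * h) -> exists h', I_pts X (g - f1 * h')].
Proof.
move=> H; apply: not_global; apply: (@global_var X H rows cols s).
- exact: undup_uniq.
- by apply/eqP => r0; have := mem_rows h11; rewrite r0.
- exact: undup_uniq.
- by apply/eqP => r0; have := mem_cols h11; rewrite r0.
- exact: global_row.
- exact: global_col.
Qed.
End Obstruction.

Lemma ACM_nested R1 R2 : ACM X -> {subset fiber R1 <= fiber R2} \/ {subset fiber R2 <= fiber R1}.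
Proof.
move=> [d [[_ dmax] [[fs [sfs mfs [reg _]]] _]]].
have [/allP h|/allPn[Q1 hQ1 hQ1']] := boolP (all (mem (fiber R2)) (fiber R1)).
  by left; exact: h.
have [/allP h|/allPn[Q2 hQ2 hQ2']] := boolP (all (mem (fiber R1)) (fiber R2)).
  by right; exact: h.
have h11 : (R1, Q1) \in X by rewrite -mem_fiber; exact: hQ1.
have h22 : (R2, Q2) \in X by rewrite -mem_fiber; exact: hQ2.
have h21 : (R2, Q1) \notin X by rewrite -mem_fiber; exact: hQ1'.
have h12 : (R1, Q2) \notin X by rewrite -mem_fiber; exact: hQ2'.
case: (no_obstruction h11 h21 h22 h12).
(* The dimension is at least 2 by the chain of primes above a point; it equals the depth d, so the
   regular sequence [fs] has two elements to offer. *)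
have d2 : (2 <= d)%N.
  have [|p hp] := @prime_chain_I_pt (I_pts X) (R1, Q1); last exact: dmax hp.
  by move=> f; apply.
exists fs`_0, fs`_1; split.
- by apply/mfs/mem_nth; lia.
- by apply/mfs/mem_nth; lia.
- move=> g hg; have s0 : (0 < size fs)%N by lia.
  have [|i [j []]] := reg 0%N s0 g.
    exists (fs`_0 * g), 0; split=> //; last by rewrite addr0.
    by exists (fun=> 0); rewrite big1 // => i; rewrite mul0r.
  by rewrite take0 => hi [c ->] ->; rewrite big_ord0 addr0.
- move=> g h' hg; have sz : (0 < size fs)%N by lia.
  have gen1 f : ideal_gen (take 1 fs) f <-> exists c, f = c * fs`_0.
    rewrite (take_nth 0 sz) take0 /=; split=> [[c ->]|[c ->]].
      by rewrite big_ord1; exists (c ord0).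
    by exists (fun=> c); rewrite big_ord1.
  have s1 : (1 < size fs)%N by lia.
  have [|i [j []]] := reg 1%N s1 g.
    exists (fs`_1 * g - fs`_0 * h'), (fs`_0 * h'); split=> //; last by rewrite subrK.
    by apply/gen1; exists h'; rewrite mulrC.
  move=> hi /gen1[c ->] ->; exists c.
  by rewrite [c * _]mulrC addrK.
Qed.
End Nested.
End ACM.

(** * The shifts produced by the algorithm *)

Section Shapes.
Variable la : seq nat.
Hypothesis la_part : is_partition la.
Hypothesis la_gt0 : 0 < size la.

Local Notation r := (size la).
Local Notation L := (nth 0 la).

Definition breaks : seq nat := 0 :: rcons [seq d.-1 | d <- descents la] r.
Definition ndesc := size (descents la).
Local Notation m := ndesc.
Local Notation n := m.+1.
Definition brk t := nth 0 breaks t.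
(** [L] counts rows from 0, so this is lambda_(p_t + 1). At t = n the index is r, and the default
    value of [nth] gives q_n = 0. *)
Definition hgt t := L (brk t).
Local Notation p := brk.
Local Notation q := hgt.

Lemma L_mono i j : i <= j -> L j <= L i.
Proof.
move=> ij; have [jr|rj] := ltnP j r; last by rewrite nth_default.
case/andP: la_part => srt _.
exact: (sorted_leq_nth (T := nat) (leT := geq) (fun _ _ _ h h' => leq_trans h' h) leqnn 0 srt i j) (leq_ltn_trans ij jr) jr ij.
Qed.

Lemma L_gt0 i : i < r -> 0 < L i.
Proof.
move=> ir; case/andP: la_part => _; rewrite lt0n; apply: contraNneq => <-.
exact: mem_nth.
Qed.

Lemma descP d : (d \in descents la) = [&& 1 < d, d <= r & L d.-1 < L d.-2].
Proof.
by rewrite mem_filter mem_index_iota ltnS andbC /part andbA.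
Qed.

Lemma size_breaks : size breaks = n.+1.
Proof. by rewrite /= size_rcons size_map. Qed.

Lemma brk0 : p 0 = 0. Proof. by []. Qed.

Lemma brkn : p n = r.
Proof. by rewrite /brk /= nth_rcons size_map ltnn eqxx. Qed.

Lemma nth_desc t : t < m -> nth 0 (descents la) t = (p t.+1).+1.
Proof.
move=> tm; rewrite /brk /= nth_rcons size_map tm (nth_map 0) // prednK //.
by have := mem_nth 0 tm; rewrite descP => /and3P[/ltnW].
Qed.

Lemma descE : descents la = [seq (p t).+1 | t <- iota 1 m].
Proof.
apply: (@eq_from_nth _ 0); rewrite ?size_map ?size_iota // => t tm.
by rewrite (nth_map 0) ?size_iota // nth_iota // nth_desc.
Qed.

Lemma brk_desc t : 0 < t <= m -> [/\ 0 < p t, p t < r & L (p t) < L (p t).-1].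
Proof.
case: t => // t /= tm; have := mem_nth 0 tm; rewrite nth_desc // descP /=.
by move=> /and3P[].
Qed.

Lemma sorted_breaks : sorted ltn breaks.
Proof.
rewrite /breaks /= rcons_path.
have pos d : d \in descents la -> 0 < d.-1 < r by rewrite descP => /and3P[]; lia.
have srt : sorted ltn [seq d.-1 | d <- descents la].
  have := sorted_filter ltn_trans (fun i => part la i < part la i.-1) (iota_ltn_sorted 2 (r.+1 - 2)).
  rewrite -/(index_iota 2 r.+1) -/(descents la) sorted_map.
  move: (descents la) pos => s; elim: s => //= x [|y s] IH pos //= /andP[xy ps].
  apply/andP; split; first by have := pos x (mem_head _ _); move: xy; rewrite /relpre /=; lia.
  by apply: IH => // z zs; apply: pos; rewrite inE zs orbT.
apply/andP; split.
  rewrite path_sortedE ?srt ?andbT; last exact: ltn_trans.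
  by apply/allP => x /mapP[d /pos /andP[]]; lia.
have : last 0 [seq d.-1 | d <- descents la] \in 0 :: [seq d.-1 | d <- descents la] by exact: mem_last.
by rewrite inE => /orP[/eqP->//|/mapP[d /pos /andP[_ h] ->]].
Qed.

Lemma brk_lt s t : s < t <= n -> p s < p t.
Proof.
move=> /andP[st tn]; apply: (sorted_ltn_nth ltn_trans 0 sorted_breaks) => //.
all: rewrite inE size_breaks; lia.
Qed.

Lemma brk_le s t : s <= t <= n -> p s <= p t.
Proof.
by move=> /andP[]; rewrite leq_eqVlt => /orP[/eqP->//|st tn]; rewrite ltnW ?brk_lt ?st.
Qed.

(** A drop strictly inside the block would be a descent, hence a break between two consecutive
    ones. *)
Lemma block t i : t < n -> p t <= i < p t.+1 -> L i = q t.
Proof.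
move=> tn; elim: i => [|i IH] /andP[h1 h2].
  by rewrite /hgt; congr (L _); lia.
move: h1; rewrite leq_eqVlt => /orP[/eqP<-//|h1].
rewrite -IH; last by lia.
apply/eqP; rewrite eqn_leq L_mono //= leqNgt; apply/negP => hd.
have h2r : p t.+1 <= r by rewrite -brkn brk_le ?leqnn ?andbT.
have : i.+2 \in descents la by rewrite descP /= hd; lia.
rewrite descE => /mapP[t' ht' [e]]; move: ht'; rewrite mem_iota => ht'.
have [tt'|t't] := leqP t' t.
  by have := @brk_le t' t; lia.
by have := @brk_le t.+1 t'; lia.
Qed.

Lemma hgt_lt s t : s < t <= n -> q t < q s.
Proof.
move=> /andP[st tn]; have ps := @brk_lt t.-1 t; have [tm|] := ltnP t n.
  have [h1 h2 h3] := @brk_desc t ltac:(lia); apply: leq_trans h3 _; apply: L_mono.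
  by have := @brk_le s t.-1; lia.
move=> nt; have -> : t = n by lia.
rewrite {1}/hgt brkn nth_default //; apply: L_gt0; rewrite -brkn brk_lt //; lia.
Qed.

Lemma hgt_le s t : s <= t <= n -> q t <= q s.
Proof.
by move=> /andP[]; rewrite leq_eqVlt => /orP[/eqP->//|st tn]; rewrite ltnW ?hgt_lt ?st.
Qed.

Lemma hgtn : q n = 0. Proof. by rewrite /hgt brkn nth_default. Qed.
Lemma part_brk t : part la (p t).+1 = q t. Proof. by []. Qed.
Lemma part1 : part la 1 = q 0. Proof. by []. Qed.

Lemma part_pred t : 0 < t <= n -> part la (p t) = q t.-1.
Proof.
move=> ht; rewrite /part; apply: block; first by lia.
have -> : t.-1.+1 = t by lia.
by have := @brk_lt t.-1 t; lia.
Qed.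

Lemma L_before t i : t <= n -> i < p t -> q t < L i.
Proof.
move=> tn it; case: t tn it => [//|t] tn it.
have h : i <= (p t.+1).-1 by lia.
apply: leq_trans (L_mono h); rewrite -/(part la (p t.+1)) part_pred; last by lia.
by apply: hgt_lt; lia.
Qed.

Lemma L_after t i : p t <= i -> L i <= q t.
Proof. exact: L_mono. Qed.

(** C_0 is the diagonal s = t; C_1 joins the row of corner s to the column of an earlier corner t <
    s. *)
Lemma CP c : reflect (exists s t, [/\ 0 < t, t <= s <= m & c = ((p s).+1, (q t).+1)])
  (c \in C la).
Proof.
have C0P x : reflect (exists2 s, 0 < s <= m & x = ((p s).+1, (q s).+1)) (x \in C0 la).
  rewrite /C0 descE -map_comp; apply: (iffP mapP) => [[s]|[s hs ->]].
    by rewrite mem_iota => hs ->; exists s; rewrite /= ?part_brk ?addn1 //; lia.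
  by exists s; rewrite /= ?mem_iota ?part_brk ?addn1 //; lia.
rewrite mem_sort mem_undup mem_cat; apply: (iffP orP).
  move=> [/C0P[s hs ->]|/mapP[[x y]]]; first by exists s, s; split=> //; lia.
  rewrite mem_filter /= => /andP[xy /allpairsP[[x' y'] /= [/C0P[s hs ->] /C0P[t ht ->] [ex ey]]]].
  subst x y => /= ->; exists s, t; split=> //; first by lia.
  by move: xy => /=; have := @brk_le s t; lia.
move=> [s [t [t0 /andP[ts sm] ->]]]; move: ts; rewrite leq_eqVlt => /orP[/eqP e|ts].
  by left; apply/C0P; exists s; rewrite ?e //; lia.
right; apply/mapP; exists (((p s).+1, (q s).+1), ((p t).+1, (q t).+1)) => //.
rewrite mem_filter /= ltnS brk_lt; last by lia.
apply/allpairsP; exists (((p s).+1, (q s).+1), ((p t).+1, (q t).+1)); split=> //=.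
  by apply/C0P; exists s => //; lia.
by apply/C0P; exists t => //; lia.
Qed.

Lemma uniq_C : uniq (C la). Proof. by rewrite sort_uniq undup_uniq. Qed.

Lemma lex_ge_total : total lex_ge. Proof. by move=> [a b] [c d]; rewrite /lex_ge /=; lia. Qed.
Lemma lex_ge_trans : transitive lex_ge.
Proof. by move=> [a b] [c d] [e f]; rewrite /lex_ge /=; lia. Qed.
Lemma lex_ge_anti : antisymmetric lex_ge.
Proof. by move=> [a b] [c d]; rewrite /lex_ge /= => h; congr (_, _); lia. Qed.

Lemma sorted_C : sorted lex_ge (C la). Proof. exact/sort_sorted/lex_ge_total. Qed.

(** * The state of the matrix during the loop *)

Definition erased (D : seq (nat * nat)) i j := has (fun c => (c.1 <= i) && (c.2 <= j)) D.

(* The entries erased from the matrix when c is processed are those below and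
   to the right of the lexicographically larger elements of C. *)
Definition later c := [seq d <- C la | lex_ge d c && (d != c)].

Definition cmat c i j := if erased (later c) i j then 0 else M0 la i j.
Definition cu c := \sum_(1 <= i' < c.1) cmat c i' c.2.
Definition cv c := \sum_(1 <= j' < c.2) cmat c c.1 j'.
Definition ca c := \sum_(c.1 <= i' < r.+1) cmat c i' c.2.
Definition cb c := \sum_(c.2 <= j' < (part la 1).+1) cmat c c.1 j'.

(** C is sorted and has no repetition, so the processed prefix D has the same elements as [later c]
    for the next c. The sums read off the current state are therefore the closed expressions [cu],
    [cv], [ca], [cb]. *)
Lemma foldl_step D E st : C la = D ++ E ->
  (forall i j, mat st i j = if erased D i j then 0 else M0 la i j) ->
  [/\ perm_eq (st0 (foldl (step la) st E)) (st0 st ++ [seq (cu c, cv c) | c <- E]),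
      perm_eq (st1 (foldl (step la) st E)) (st1 st ++
        ([seq (cu c + ca c, cv c) | c <- E] ++ [seq (cu c, cv c + cb c) | c <- E])) &
      perm_eq (st2 (foldl (step la) st E)) (st2 st ++ [seq (cu c + ca c, cv c + cb c) | c <- E])].
Proof.
elim: E D st => [|c E IH] D st eC hm; first by rewrite /= !cats0; split.
have eD : later c =i D.
  move=> d; rewrite mem_filter eC.
  have := uniq_C; rewrite eC cat_uniq /= => /and3P[uD /norP[cD _] /andP[cE uE]].
  have := sorted_C; rewrite eC => sC.
  have hD x : x \in D -> lex_ge x c.
    move=> xD; move: sC; rewrite (sorted_pairwise lex_ge_trans) pairwise_cat => /and3P[/allrelP h _ _].
    by apply: h; rewrite // mem_head.
  have hE x : x \in E -> lex_ge c x.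
    move=> xE; move: sC; rewrite (sorted_pairwise lex_ge_trans) pairwise_cat => /and3P[_ _] /=.
    by move=> /andP[/allP h _]; apply: h.
  rewrite mem_cat inE; have [->|dc] := eqVneq d c; first by rewrite andbF (negPf cD).
  rewrite andbT /=; apply/andP/idP => [[dc' /orP[//|dE]]|dD]; last by rewrite hD // dD.
  by case/eqP: dc; apply: lex_ge_anti; rewrite dc' hE.
have hmat i j : mat st i j = cmat c i j by rewrite hm /cmat /erased (eq_has_r eD).
have [||h0 h1 h2] := IH (rcons D c) (step la st c).
- by rewrite cat_rcons.
- move=> i j; case: c eD eC hmat => ci cj eD eC hmat /=; rewrite /erased has_rcons /=.
  by case: ifP => //= _; rewrite hm.
have eu : forall i j, \sum_(1 <= i' < i) mat st i' j = \sum_(1 <= i' < i) cmat c i' j.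
  by move=> i j; apply: eq_bigr => i' _; rewrite hmat.
have ev : forall i j, \sum_(1 <= j' < j) mat st i j' = \sum_(1 <= j' < j) cmat c i j'.
  by move=> i j; apply: eq_bigr => i' _; rewrite hmat.
have ea : forall a b j, \sum_(a <= i' < b) mat st i' j = \sum_(a <= i' < b) cmat c i' j.
  by move=> a b j; apply: eq_bigr => i' _; rewrite hmat.
have eb : forall a b i, \sum_(a <= j' < b) mat st i j' = \sum_(a <= j' < b) cmat c i j'.
  by move=> a b i; apply: eq_bigr => i' _; rewrite hmat.
have [E0 E1 E2] : [/\ st0 (step la st c) = (cu c, cv c) :: st0 st,
    st1 (step la st c) = [:: (cu c + ca c, cv c), (cu c, cv c + cb c) & st1 st] &
    st2 (step la st c) = (cu c + ca c, cv c + cb c) :: st2 st].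
  clear - eu ev ea eb; case: c eu ev ea eb => i j eu ev ea eb /=.
  by rewrite eu ev !ea !eb.
split; [move: h0; rewrite E0|move: h1; rewrite E1|move: h2; rewrite E2] => /perm_trans -> //.
- by rewrite /= perm_sym -cat1s perm_catCA.
- rewrite /= perm_sym -[(cu c + ca c, cv c) :: _ ++ _]cat1s perm_catCA /= perm_cons.
  by rewrite catA -cat1s perm_catCA /= perm_cons -catA.
- by rewrite /= perm_sym -cat1s perm_catCA.
Qed.

Lemma SZ_perm :
  [/\ perm_eq (SZ0 la) (SY0 la ++ [seq (cu c, cv c) | c <- C la]),
      perm_eq (SZ1 la) (SY1 la ++
        ([seq (cu c + ca c, cv c) | c <- C la] ++ [seq (cu c, cv c + cb c) | c <- C la])) &
      perm_eq (SZ2 la) [seq (cu c + ca c, cv c + cb c) | c <- C la]].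
Proof. exact: (@foldl_step [::]). Qed.

Lemma sum_lt_const N K x y : K <= N ->
  \sum_(0 <= i < N) (if i < K then x else y) = K * x + (N - K) * y.
Proof.
move=> KN; rewrite (big_cat_nat (n := K)) //=; congr (_ + _).
  rewrite (eq_big_nat _ _ (F2 := fun=> x)) ?sum_nat_const_nat ?subn0 //.
  by move=> i /andP[_ ->].
rewrite (eq_big_nat _ _ (F2 := fun=> y)) ?sum_nat_const_nat //.
by move=> i /andP[h _]; rewrite ltnNge h.
Qed.

Lemma sum_ge_zero a b c : a <= b <= c ->
  \sum_(a <= i < c) (if b <= i then 0 else 1) = b - a.
Proof.
move=> /andP[ab bc]; rewrite (big_cat_nat (n := b)) //= [X in _ + X](_ : _ = 0) ?addn0.
  rewrite (eq_big_nat _ _ (F2 := fun=> 1)) ?sum_nat_const_nat ?muln1 //.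
  by move=> i /andP[_ h]; rewrite leqNgt h.
by rewrite big_nat big1 // => i /andP[->].
Qed.

Lemma erasedP s t i j : 0 < t <= s -> s <= m ->
  reflect (exists s' t', [/\ 0 < t' <= s', s' <= m, p s' < i, q t' < j &
    (p s < p s') || (s == s') && (q t < q t')]) (erased (later ((p s).+1, (q t).+1)) i j).
Proof.
move=> ts sm; apply: (iffP hasP).
  move=> [d]; rewrite mem_filter => /andP[/andP[ge ne] /CP[s' [t' [t0 ts' e]]]].
  rewrite {}e /lex_ge /= in ge ne * => /andP[h1 h2]; exists s', t'; split=> //; try lia.
  move: ge; rewrite !ltnS => /orP[->//|/andP[/eqP [e] h]].
  have ss : s = s'.
    by have := @brk_lt s s'; have := @brk_lt s' s; lia.
  rewrite -{}ss in ne *; rewrite eqxx [q t < _]ltn_neqAle h andbT; apply/orP; right.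
  by apply: contraNneq ne => ->.
move=> [s' [t' [ts' s'm h1 h2 h]]]; exists ((p s').+1, (q t').+1); last by rewrite /= h1 h2.
rewrite mem_filter; apply/andP; split; last by apply/CP; exists s', t'; split=> //; lia.
case/orP: h => [h|/andP[/eqP <- h]]; rewrite /lex_ge /= ?eqxx /= xpair_eqE; lia.
Qed.

(** In column q_t + 1 the first p_t rows carry 2 and the following ones, up to c, carry 1, whence u;
    row p_s + 1 gives v in the same way. From c downwards there are ones until row p_(s+1),
    everything below being erased by an earlier corner, and to the right there are ones until column
    q_(t-1). For s = m and t = 1 the border of the matrix plays the role of the earlier corner. *)
Lemma step_values s t : 0 < t <= s -> s <= m ->
  let c := ((p s).+1, (q t).+1) in
  [/\ cu c = p s + p t, cv c = q s + q t, cu c + ca c = p s.+1 + p t &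
      cv c + cb c = q s + q t.-1].
Proof.
move=> ts sm c; have pts : p t <= p s by apply: brk_le; lia.
have qts : q s <= q t by apply: hgt_le; lia.
have eu : cu c = p s + p t.
  rewrite /cu /= big_add1 /= (eq_big_nat _ _ (F2 := fun i => if i < p t then 2 else 1)).
    by rewrite sum_lt_const //; lia.
  move=> i /andP[_ hi]; rewrite /cmat; case: erasedP => // [[s' [t' [? ? h1 h2 h3]]]|_].
    by have := @brk_le s s'; case/orP: h3 => [|/andP[/eqP e _]]; subst; lia.
  rewrite /M0 /part /=; have [it|it] := ltnP i (p t).
    by rewrite L_before //; lia.
  by rewrite ltnNge L_after.
have ev : cv c = q s + q t.
  rewrite /cv /= big_add1 /= (eq_big_nat _ _ (F2 := fun i => if i < q s then 2 else 1)).
    by rewrite sum_lt_const //; lia.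
  move=> j /andP[_ hj]; rewrite /cmat; case: erasedP => // -[s' [t' [? ? h1 h2 h3]]].
  by case/orP: h3 => [|/andP[/eqP e h4]]; subst; lia.
have ea : ca c = p s.+1 - p s.
  rewrite /ca /= big_add1 /= (eq_big_nat _ _ (F2 := fun i => if p s.+1 <= i then 0 else 1)).
    by rewrite sum_ge_zero //; have := @brk_le s s.+1; have := @brk_le s.+1 n; rewrite brkn; lia.
  move=> i /andP[h1 h2]; rewrite /cmat; case: erasedP => //.
    move=> [s' [t' [? ? h3 h4]]] /orP[h5|/andP[_ h5]]; last by lia.
    have ss : s < s' by rewrite ltnNge; apply/negP => h; have := @brk_le s' s; lia.
    by rewrite (leq_trans _ (_ : p s' <= i)) // brk_le; lia.
  move=> ne; case: leqP => [h|h].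
    case: ne; exists s.+1, s.+1.
    have sm' : s < m.
      rewrite ltn_neqAle sm andbT; apply/eqP => e; subst s.
      by move: h; rewrite brkn; lia.
    by have := @hgt_le t s.+1; have := @brk_lt s s.+1; split; lia.
  by rewrite /M0 /part /= ltnNge (leq_trans (L_after h1) qts).
have eb : cb c = q t.-1 - q t.
  rewrite /cb /= part1 big_add1 /= (eq_big_nat _ _ (F2 := fun i => if q t.-1 <= i then 0 else 1)).
    by rewrite sum_ge_zero // !hgt_le //; lia.
  move=> j /andP[h1 h2]; rewrite /cmat; case: erasedP => //.
    move=> [s' [t' [? ? h3 h4]]] /orP[h5|/andP[_ h5]]; first by lia.
    have tt : t' < t by rewrite ltnNge; apply/negP => h; have := @hgt_le t t'; lia.
    by rewrite (leq_trans (hgt_le _) (_ : q t' <= j)) //; lia.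
  move=> ne; case: leqP => [h|h].
    case: ne; exists s, t.-1; rewrite eqxx /= hgt_lt; last by lia.
    have t1 : t != 1 by apply/eqP => e; move: h; rewrite e /=; lia.
    by split; lia.
  by rewrite /M0 /part /= ltnNge -/(hgt s) (leq_trans qts).
have h1 := @brk_le s s.+1; have h2 := @hgt_le t.-1 t.
by split=> //; rewrite ?eu ?ev ?ea ?eb; lia.
Qed.

(** These three lists index the bases e_s e_t of Sym^2 G, f_a (x) e_b of F (x) G and f_a /\ f_b of
    /\^2 F. *)
Definition pairs_le := [seq (s, t) | t <- iota 0 n.+1, s <- iota 0 t.+1].
Definition pairs_all := [seq (a, b) | a <- iota 0 n, b <- iota 0 n.+1].
Definition pairs_lt := [seq (a, b) | b <- iota 0 n, a <- iota 0 b].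

(** Bidegrees of these basis elements: e_s has that of G_s, namely (p_s, q_s), and f_a that of l_a,
    namely (p_(a+1), q_a). *)
Definition deg0 (x : nat * nat) := (p x.1 + p x.2, q x.1 + q x.2).
Definition deg1 (x : nat * nat) := (p x.1.+1 + p x.2, q x.1 + q x.2).
Definition deg2 (x : nat * nat) := (p x.1.+1 + p x.2.+1, q x.1 + q x.2).

Definition corner_pairs := [seq (s, t) | s <- iota 1 m, t <- iota 1 s].

Lemma C_perm : perm_eq (C la) [seq ((p x.1).+1, (q x.2).+1) | x <- corner_pairs].
Proof.
have cpP x : x \in corner_pairs -> 0 < x.2 <= x.1 /\ x.1 <= m.
  case: x => s t; move=> /allpairsPdep[s' [t' []]]; rewrite !mem_iota => ? ? [-> ->] /=; lia.
apply: uniq_perm; first exact: uniq_C.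
  rewrite map_inj_in_uniq.
    by apply: allpairs_uniq_dep => [|? _|[? ?] [? ?] _ _ /= [-> ->]] //; apply: iota_uniq.
  move=> [s t] [s' t'] /cpP /= [h1 h2] /cpP /= [h3 h4] [e1 e2]; congr (_, _).
    by have := @brk_lt s s'; have := @brk_lt s' s; lia.
  by have := @hgt_lt t t'; have := @hgt_lt t' t; lia.
move=> c; apply/CP/mapP => [[s [t [t0 ts ->]]]|[x /cpP h ->]].
  exists (s, t) => //; apply/allpairsPdep; exists s, t.
  by rewrite !mem_iota; split=> //; lia.
by exists x.1, x.2; split=> //; lia.
Qed.

Lemma size_tri a b : size [seq (s, t) | s <- iota a b, t <- iota 1 s] = sumn (iota a b).
Proof. by rewrite size_allpairs_dep; congr sumn; rewrite -[RHS]map_id; apply: eq_map => x; rewrite size_iota. Qed.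

Lemma sumn_iota a : 2 * sumn (iota 1 a) = a * a.+1.
Proof.
by elim: a => // a IH; rewrite -{1}[a.+1]addn1 iotaD sumn_cat mulnDr IH /=; lia.
Qed.

(** Replaces the second inclusion by a count, for comparing the index lists with the output of the
    algorithm. *)
Lemma perm_of_sub (T : eqType) (s1 s2 : seq T) :
  uniq s1 -> {subset s1 <= s2} -> size s2 <= size s1 -> perm_eq s1 s2.
Proof.
move=> u sub sz; apply: uniq_perm => //; first exact: leq_size_uniq u sub sz.
by have [_] := uniq_min_size u sub sz.
Qed.

Lemma mem_corner s t : ((s, t) \in corner_pairs) = [&& 0 < t, t <= s & s <= m].
Proof.
apply/allpairsPdep/idP => [[s' [t' []]]|h].
  by rewrite !mem_iota => ? ? [-> ->]; lia.
by exists s, t; rewrite !mem_iota; split=> //; lia.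
Qed.

Lemma map_corner_values (T : Type) (F : nat * nat -> T) (G : nat * nat -> T) :
  (forall s t, 0 < t <= s -> s <= m -> F ((p s).+1, (q t).+1) = G (s, t)) ->
  [seq F ((p x.1).+1, (q x.2).+1) | x <- corner_pairs] = [seq G x | x <- corner_pairs].
Proof.
move=> h; apply/eq_in_map => -[s t]; rewrite mem_corner => hst /=; apply: h; lia.
Qed.

Lemma size_pairs_le : size pairs_le = sumn (iota 1 n.+1).
Proof.
rewrite size_allpairs_dep (iotaDl 1 0); congr sumn.
by apply: eq_map => x; rewrite size_iota.
Qed.

Lemma size_pairs_all : size pairs_all = n * n.+1.
Proof. by rewrite size_allpairs !size_iota. Qed.

Lemma size_pairs_lt : size pairs_lt = sumn (iota 0 n).
Proof.
rewrite size_allpairs_dep -[in RHS](map_id (iota 0 n)); congr sumn.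
by apply: eq_map => x; rewrite size_iota.
Qed.

Lemma SZ0_perm : perm_eq (SZ0 la) (map deg0 pairs_le).
Proof.
have [h _ _] := SZ_perm; apply: (perm_trans h).
apply: (perm_trans (perm_cat (perm_refl _) (perm_map _ C_perm))).
rewrite -map_comp (map_corner_values (G := fun x => deg0 (x.2, x.1))).
  2: by move=> s t h1 h2; have [eu ev _ _] := step_values h1 h2; rewrite eu ev /deg0 /= addnC [q t + _]addnC.
(* The pairs in the order of the output: (2r, 0), (r, lambda_1), (0, 2 lambda_1) are the vertices of
   the triangle s <= t, the two families of SY_0 its edges s = 0 and t = n, and C contributes the
   pairs with 1 <= s <= t <= m. *)
pose J := [:: (n, n); (0, n); (0, 0)] ++ [seq (0, t) | t <- iota 1 m] ++
  [seq (t, n) | t <- iota 1 m] ++ [seq (x.2, x.1) | x <- corner_pairs].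
have -> : SY0 la ++ [seq deg0 (x.2, x.1) | x <- corner_pairs] = map deg0 J.
  rewrite /J !map_cat -!map_comp /SY0 descE -!map_comp -!catA /= /deg0 /= brkn hgtn.
  congr [:: _, _, _ & _]; try (congr (_, _); rewrite ?part1 ?brk0; lia).
  congr (_ ++ (_ ++ _)); apply: eq_map => t /=;
    rewrite part_brk ?part1 ?brk0 ?brkn ?hgtn; congr (_, _); lia.
apply: perm_map; rewrite perm_sym; apply: perm_of_sub.
- by apply: allpairs_uniq_dep => [|? _|[? ?] [? ?] _ _ /= [-> ->]] //; apply: iota_uniq.
- move=> x /allpairsPdep[t [s [ht hs ->]]]; move: ht hs; rewrite !mem_iota => ht hs.
  rewrite /J !mem_cat !inE !xpair_eqE.
  have [tn|tn] := eqVneq t n.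
    have [->|s0] := eqVneq s 0; first by rewrite ?eqxx ?orbT.
    have [sn|sn] := eqVneq s n; first by rewrite ?eqxx ?orbT.
    apply/orP; right; apply/orP; right; apply/orP; left.
    by apply/mapP; exists s; rewrite ?mem_iota ?tn //; lia.
  have [s0|s0] := eqVneq s 0.
    have [t0|t0] := eqVneq t 0; first by rewrite ?eqxx ?orbT.
    apply/orP; right; apply/orP; left; apply/mapP; exists t; rewrite ?s0 ?mem_iota //; lia.
  do 3 (apply/orP; right); apply/mapP; exists (t, s) => //; rewrite mem_corner; lia.
- rewrite size_pairs_le /J !size_cat !size_map size_tri !size_iota [size (_ :: _)]/=.
  have := sumn_iota n.+1; have := sumn_iota m; lia.
Qed.

Lemma SZ1_perm : perm_eq (SZ1 la) (map deg1 pairs_all).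
Proof.
have [_ h _] := SZ_perm; apply: (perm_trans h).
apply: (perm_trans (perm_cat (perm_refl _) (perm_cat (perm_map _ C_perm) (perm_map _ C_perm)))).
rewrite -!map_comp (map_corner_values (G := deg1)).
  2: by move=> s t h1 h2; have [_ ev -> _] := step_values h1 h2; rewrite ev.
rewrite (map_corner_values (F := fun c => (cu c, cv c + cb c)) (G := fun x => deg1 (x.2.-1, x.1))).
  2: by move=> s t h1 h2; have [eu _ _ ->] := step_values h1 h2;
     rewrite eu /deg1 /= prednK; [congr (_, _); lia | lia].
(* SY_1 gives the columns b = 0 and b = n of the rectangle of pairs (a, b), the case a = m being
   listed apart. The two shifts of a corner fill the rest, according to b <= a or a < b. *)
pose J := [:: (m, n); (m, 0)] ++ [seq (t.-1, 0) | t <- iota 1 m] ++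
  [seq (t.-1, n) | t <- iota 1 m] ++ corner_pairs ++ [seq (x.2.-1, x.1) | x <- corner_pairs].
have -> : SY1 la ++ [seq deg1 x | x <- corner_pairs] ++ [seq deg1 (x.2.-1, x.1) | x <- corner_pairs]
   = map deg1 J.
  have pr : part la r = q m.
    by rewrite -brkn part_pred //; lia.
  rewrite /J !map_cat -!map_comp /SY1 descE -!map_comp -!catA /= /deg1 /= brkn hgtn pr.
  congr [:: _, _ & _]; try (congr (_, _); rewrite ?part1 ?brk0; lia).
  congr (_ ++ (_ ++ _)); apply/eq_in_map => t; rewrite mem_iota => ht /=;
    rewrite part_pred ?prednK ?part1 ?brk0 ?brkn ?hgtn; try lia; congr (_, _); lia.
apply: perm_map; rewrite perm_sym; apply: perm_of_sub.
- by apply: allpairs_uniq; rewrite ?iota_uniq // => -[s t] [s' t'].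
- move=> x /allpairsPdep[a [b [ha hb ->]]]; move: ha hb; rewrite !mem_iota => ha hb.
  rewrite /J !mem_cat !inE !xpair_eqE.
  have [am|am] := eqVneq a m.
    have [b0|b0] := eqVneq b 0; first by rewrite ?orbT.
    have [bn|bn] := eqVneq b n; first by [].
    apply/orP; right; do 2 (apply/orP; right); apply/orP; left; rewrite mem_corner; lia.
  have [b0|b0] := eqVneq b 0.
    apply/orP; right; apply/orP; left; apply/mapP; exists a.+1; rewrite ?b0 ?mem_iota //; lia.
  have [bn|bn] := eqVneq b n.
    apply/orP; right; apply/orP; right; apply/orP; left; apply/mapP; exists a.+1;
      rewrite ?bn ?mem_iota //; lia.
  do 3 (apply/orP; right); have [ba|ab] := leqP b a; apply/orP; [left|right].
    rewrite mem_corner; lia.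
  apply/mapP; exists (b, a.+1) => //; rewrite mem_corner; lia.
- rewrite size_pairs_all /J !size_cat !size_map size_tri !size_iota [size (_ :: _)]/=.
  have := sumn_iota m; lia.
Qed.

Lemma SZ2_perm : perm_eq (SZ2 la) (map deg2 pairs_lt).
Proof.
have [_ _ h] := SZ_perm; apply: (perm_trans h); apply: (perm_trans (perm_map _ C_perm)).
rewrite -map_comp (map_corner_values (F := fun c => (cu c + ca c, cv c + cb c))
   (G := fun x => deg2 (x.2.-1, x.1))).
  2: by move=> s t h1 h2; have [_ _ -> ->] := step_values h1 h2;
     rewrite /deg2 /= prednK; [congr (_, _); lia | lia].
rewrite (map_comp deg2); apply: perm_map; rewrite perm_sym; apply: perm_of_sub.
- by apply: allpairs_uniq_dep => [|? _|[? ?] [? ?] _ _ /= [-> ->]] //; apply: iota_uniq.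
- move=> x /allpairsPdep[b [a [hb ha ->]]]; move: ha hb; rewrite !mem_iota => ha hb.
  by apply/mapP; exists (b, a.+1) => //; rewrite mem_corner; lia.
- by rewrite size_pairs_lt size_map size_tri /= add0n.
Qed.
End Shapes.

(** * Resolutions given by families of entries *)

Section FamilyResolution.
Local Open Scope ring_scope.
Variable k : fieldType.
Local Notation S := {mpoly k[4]}.
Local Notation idx := (nat * nat)%type.
Local Notation x00 := (0%N, 0%N).

(** Bihomogeneity of bidegree d' - d, or f = 0, stated additively to avoid truncated subtraction. *)
Definition shift_hom (f : S) (d d' : nat * nat) := forall m, m \in msupp f ->
  (bideg m).1 + d.1 = d'.1 /\ (bideg m).2 + d.2 = d'.2.

(** The shifts come in the order of the algorithm; reordering the basis indices accordingly leaves
    the families of matrix entries unchanged. *)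
Lemma perm_map_eq (T : eqType) (f : idx -> T) (s : seq T) (e : seq idx) :
  perm_eq s (map f e) -> exists2 e', perm_eq e' e & s = map f e'.
Proof.
case: e => [|x e] h; first by exists [::]; rewrite // (perm_nilP h).
have /(perm_iotaP (f x))[Is hI ->] := h; exists (map (nth x (x :: e)) Is).
  by apply/(perm_iotaP x); exists Is => //; rewrite size_map in hI.
rewrite -map_comp; apply/eq_in_map => i iI /=; rewrite -(nth_map x (f x)) //.
by have := perm_mem hI i; rewrite iI mem_iota size_map => /esym/andP[_].
Qed.

Definition fun_of_row (e : seq idx) n (v : 'rV[S]_n) (x : idx) : S :=
  if insub (index x e) is Some i then v 0 i else 0.

Lemma fun_of_rowE (e : seq idx) n (v : 'rV[S]_n) (i : 'I_n) : n = size e -> uniq e ->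
  fun_of_row e v (nth x00 e i) = v 0 i.
Proof.
move=> ne ue; rewrite /fun_of_row index_uniq -?ne ?ltn_ord //.
by rewrite valK.
Qed.

Lemma sum_nth (e : seq idx) n (F : idx -> S) : n = size e ->
  \sum_(i < n) F (nth x00 e i) = \sum_(x <- e) F x.
Proof. by move=> ->; rewrite (big_nth x00) big_mkord. Qed.

Lemma exact_of_families (e e' e'' : seq idx) (n n' n'' : nat)
  (D : idx -> idx -> S) (D' : idx -> idx -> S) :
  n = size e -> n' = size e' -> n'' = size e'' -> uniq e -> uniq e' -> uniq e'' ->
  (forall v : idx -> S, (forall x, x \in e'' -> \sum_(y <- e') v y * D' y x = 0) ->
     exists w, forall y, y \in e' -> v y = \sum_(z <- e) w z * D z y) ->
  (forall (w : idx -> S) x, x \in e'' ->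
     \sum_(y <- e') (\sum_(z <- e) w z * D z y) * D' y x = 0) ->
  let M := \matrix_(i < n, j < n') D (nth x00 e i) (nth x00 e' j) in
  let M' := \matrix_(i < n', j < n'') D' (nth x00 e' i) (nth x00 e'' j) in
  forall v : 'rV_n', v *m M' = 0 <-> exists w : 'rV_n, v = w *m M.
Proof.
move=> ne ne' ne'' ue ue' ue'' ex cx M M' v.
have mulE (w : 'rV_n) (j : 'I_n') :
    (w *m M) 0 j = \sum_(z <- e) fun_of_row e w z * D z (nth x00 e' j).
  rewrite mxE -(sum_nth _ ne); apply: eq_bigr => i _.
  by rewrite fun_of_rowE // mxE.
have mulE' (w : 'rV_n') (j : 'I_n'') :
    (w *m M') 0 j = \sum_(y <- e') fun_of_row e' w y * D' y (nth x00 e'' j).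
  rewrite mxE -(sum_nth _ ne'); apply: eq_bigr => i _.
  by rewrite fun_of_rowE // mxE.
have nthE (f : seq idx) m x : m = size f -> x \in f -> exists i : 'I_m, x = nth x00 f i.
  move=> mf xf; have h : (index x f < m)%N by rewrite mf index_mem.
  by exists (Ordinal h); rewrite /= nth_index.
split=> [h|[w ->]].
  have [x /(nthE _ _ _ ne'')[j ->]|w hw] := ex (fun_of_row e' v).
    by rewrite -mulE' h mxE.
  exists (\row_i w (nth x00 e i)); apply/rowP => j.
  rewrite -(fun_of_rowE v j ne' ue') hw; last by rewrite mem_nth // -ne'.
  rewrite mulE; apply: eq_big_seq => z /(nthE _ _ _ ne)[i ->].
  by rewrite fun_of_rowE // mxE.
apply/rowP => j; rewrite mulE' mxE -[RHS](cx (fun_of_row e w) (nth x00 e'' j)).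
  apply: eq_big_seq => y /(nthE _ _ _ ne')[i ->]; by rewrite fun_of_rowE // mulE.
by rewrite mem_nth // -ne''.
Qed.

Lemma min_resolution_of_families (I : S -> Prop) (s0 s1 s2 : seq (nat * nat))
  (e0 e1 e2 : seq idx) (deg0 deg1 deg2 : idx -> nat * nat)
  (D0 : idx -> S) (D1 D2 : idx -> idx -> S) :
  uniq e0 -> uniq e1 -> uniq e2 ->
  perm_eq s0 (map deg0 e0) -> perm_eq s1 (map deg1 e1) -> perm_eq s2 (map deg2 e2) ->
  (forall x, x \in e0 -> shift_hom (D0 x) x00 (deg0 x)) ->
  (forall x y, x \in e1 -> y \in e0 -> shift_hom (D1 x y) (deg0 y) (deg1 x)) ->
  (forall x y, x \in e2 -> y \in e1 -> shift_hom (D2 x y) (deg1 y) (deg2 x)) ->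
  (forall x y, x \in e1 -> y \in e0 -> irr_ideal (D1 x y)) ->
  (forall x y, x \in e2 -> y \in e1 -> irr_ideal (D2 x y)) ->
  (forall f, I f <-> exists v : idx -> S, f = \sum_(x <- e0) v x * D0 x) ->
  (forall v : idx -> S, \sum_(x <- e0) v x * D0 x = 0 ->
     exists w, forall x, x \in e0 -> v x = \sum_(y <- e1) w y * D1 y x) ->
  (forall w : idx -> S, \sum_(x <- e0) (\sum_(y <- e1) w y * D1 y x) * D0 x = 0) ->
  (forall v : idx -> S, (forall x, x \in e0 -> \sum_(y <- e1) v y * D1 y x = 0) ->
     exists w, forall y, y \in e1 -> v y = \sum_(z <- e2) w z * D2 z y) ->
  (forall (w : idx -> S) x, x \in e0 ->
     \sum_(y <- e1) (\sum_(z <- e2) w z * D2 z y) * D1 y x = 0) ->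
  (forall v : idx -> S, (forall y, y \in e1 -> \sum_(z <- e2) v z * D2 z y = 0) ->
     forall z, z \in e2 -> v z = 0) ->
  has_min_resolution I s0 s1 s2.
Proof.
move=> u0 u1 u2 /perm_map_eq[f0 p0 ->] /perm_map_eq[f1 p1 ->] /perm_map_eq[f2 p2 ->].
move=> h0 h1 h2 i1 i2 gen ex0 cx0 ex1 cx1 inj.
have m0 := perm_mem p0; have m1 := perm_mem p1; have m2 := perm_mem p2.
rewrite -(perm_uniq p0) in u0; rewrite -(perm_uniq p1) in u1; rewrite -(perm_uniq p2) in u2.
have S0 F : \sum_(x <- e0) F x = \sum_(x <- f0) F x :> S by rewrite (perm_big _ p0).
have S1 F : \sum_(x <- e1) F x = \sum_(x <- f1) F x :> S by rewrite (perm_big _ p1).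
have S2 F : \sum_(x <- e2) F x = \sum_(x <- f2) F x :> S by rewrite (perm_big _ p2).
have z0 := size_map deg0 f0; have z1 := size_map deg1 f1; have z2 := size_map deg2 f2.
have nth0 i : (i < size (map deg0 f0))%N -> nth x00 (map deg0 f0) i = deg0 (nth x00 f0 i).
  by rewrite z0 => h; rewrite (nth_map x00).
have nth1 i : (i < size (map deg1 f1))%N -> nth x00 (map deg1 f1) i = deg1 (nth x00 f1 i).
  by rewrite z1 => h; rewrite (nth_map x00).
have nth2 i : (i < size (map deg2 f2))%N -> nth x00 (map deg2 f2) i = deg2 (nth x00 f2 i).
  by rewrite z2 => h; rewrite (nth_map x00).
have in0 (i : 'I_(size (map deg0 f0))) : nth x00 f0 i \in e0.
  by rewrite -m0 mem_nth // -z0.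
have in1 (i : 'I_(size (map deg1 f1))) : nth x00 f1 i \in e1.
  by rewrite -m1 mem_nth // -z1.
have in2 (i : 'I_(size (map deg2 f2))) : nth x00 f2 i \in e2.
  by rewrite -m2 mem_nth // -z2.
exists (\matrix_(i, j) D0 (nth x00 f0 i)),
  (\matrix_(i, j) D1 (nth x00 f1 i) (nth x00 f0 j)),
  (\matrix_(i, j) D2 (nth x00 f2 i) (nth x00 f1 j)).
(* The augmentation is viewed as a family with the single column index (0, 0), so that
   [exact_of_families] covers it too. *)
have E0 : \matrix_(i < size (map deg0 f0), j < size [:: x00]) D0 (nth x00 f0 i) =
    \matrix_(i < size (map deg0 f0), j < size [:: x00])
      (fun x _ => D0 x) (nth x00 f0 i) (nth x00 [:: x00] j) by [].
split.
- split=> i j m; rewrite mxE => hm.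
  + by rewrite nth0 //; have [] := h0 _ (in0 i) m hm; case: j => [[|//]].
  + by rewrite nth0 // nth1 //; apply: h1.
  + by rewrite nth1 // nth2 //; apply: h2.
- by split=> i j; rewrite mxE; [apply: i1 | apply: i2].
split.
- move=> f; rewrite gen; split=> [[v ->]|[v <-]].
    exists (\row_i v (nth x00 f0 i)); rewrite mxE S0 -(sum_nth _ z0).
    by apply: eq_bigr => i _; rewrite !mxE.
  exists (fun_of_row f0 v); rewrite mxE S0 -(sum_nth _ z0).
  by apply: eq_bigr => i _; rewrite fun_of_rowE // mxE.
- rewrite E0; apply: (@exact_of_families f1 f0 [:: x00] _ _ _ D1 (fun x _ => D0 x)) => //.
    move=> v /(_ x00 (mem_head _ _)); rewrite -S0 => /ex0[w hw]; exists w => y.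
    by rewrite m0 => /hw ->; rewrite S1.
  move=> w x _; rewrite -S0 -[RHS](cx0 w); apply: eq_bigr => y _.
  by rewrite -S1.
- apply: (@exact_of_families f2 f1 f0 _ _ _ D2 D1) => //.
    move=> v hv; have [x|w hw] := ex1 v; first by rewrite -m0 S1 => /hv.
    by exists w => y; rewrite m1 => /hw ->; rewrite S2.
  move=> w x; rewrite m0 => hx; rewrite -S1 -[RHS](cx1 w x hx).
  by apply: eq_bigr => y _; rewrite -S2.
- move=> v hv; apply/rowP => i; rewrite mxE -(fun_of_rowE v i z2 u2); apply: inj => //.
  move=> y; rewrite -m1 => hy; have h : (index y f1 < size (map deg1 f1))%N.
    by rewrite z1 index_mem.
  have := congr1 (fun M : 'rV[S]_(size (map deg1 f1)) => M 0 (Ordinal h)) hv.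
  rewrite !mxE S2 -(sum_nth _ z2) => e; rewrite -[RHS]e; apply: eq_bigr => j _.
  by rewrite fun_of_rowE // mxE /= nth_index.
Qed.

Lemma shift_hom0 d d' : shift_hom 0 d d'.
Proof. by move=> m; rewrite msupp0. Qed.

Lemma shift_homN f d d' : shift_hom f d d' -> shift_hom (- f) d d'.
Proof. by move=> h m; rewrite (perm_mem (msuppN f)); apply: h. Qed.

Lemma shift_homD f g d d' : shift_hom f d d' -> shift_hom g d d' -> shift_hom (f + g) d d'.
Proof. by move=> hf hg m /msuppD_le; rewrite mem_cat => /orP[/hf|/hg]. Qed.

Lemma shift_homMb f (b : bool) d d' : (b -> shift_hom f d d') -> shift_hom (f *+ b) d d'.
Proof. by case: b => [|_]; [apply | apply: shift_hom0]. Qed.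

Lemma shift_homM f g a b c : shift_hom f b c -> shift_hom g a b -> shift_hom (f * g) a c.
Proof.
move=> hf hg m /msuppM_le /allpairsP[[m1 m2] /= [/hf[e1 e2] /hg[e3 e4] ->]].
move: e1 e2 e3 e4; rewrite /bideg /= !mnmDE; lia.
Qed.

Lemma shift_homD2 f a b c c' d d' :
  shift_hom f (a, b) (c, d) -> shift_hom f (a + c', b + d')%N (c + c', d + d')%N.
Proof. by move=> h m /h /=; lia. Qed.

Lemma shift_homX i d : shift_hom 'X_i d
  (if (i < 2)%N then (d.1.+1, d.2) else (d.1, d.2.+1)).
Proof.
move=> m; rewrite msuppX inE => /eqP->; rewrite /bideg /= !mnm1E -!val_eqE /= !inordK //.
by case: i => [[|[|[|[|//]]]] hi] /=; lia.
Qed.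

Lemma shift_homZ c f d d' : shift_hom f d d' -> shift_hom (c *: f) d d'.
Proof. by move=> h m /msuppZ_le; apply: h. Qed.

Lemma shift_hom_L1 R a b : shift_hom (L1 R) (a, b) (a.+1, b).
Proof.
by apply: shift_homD; [|apply: shift_homN]; apply: shift_homZ => m /shift_homX h;
  have := h (a, b); rewrite inordK.
Qed.

Lemma shift_hom_L2 Q a b : shift_hom (L2 Q) (a, b) (a, b.+1).
Proof.
by apply: shift_homD; [|apply: shift_homN]; apply: shift_homZ => m /shift_homX h;
  have := h (a, b); rewrite inordK.
Qed.

Lemma shift_hom1 d : shift_hom 1 d d.
Proof.
move=> m; rewrite msupp1 inE => /eqP->; rewrite /bideg !mnm0E /=; lia.
Qed.

Lemma shift_hom_prodL1 (t : seq (P1 k)) a b :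
  shift_hom (\prod_(R <- t) L1 R) (a, b) (size t + a, b)%N.
Proof.
elim: t => [|R t IH]; first by rewrite big_nil; apply: shift_hom1.
by rewrite big_cons; apply: shift_homM IH; apply: shift_hom_L1.
Qed.

Lemma shift_hom_prodL2 (t : seq (P1 k)) a b :
  shift_hom (\prod_(Q <- t) L2 Q) (a, b) (a, size t + b)%N.
Proof.
elim: t => [|R t IH]; first by rewrite big_nil; apply: shift_hom1.
by rewrite big_cons; apply: shift_homM IH; apply: shift_hom_L2.
Qed.

Lemma irr_var v : v \in [:: x0 k; x1 k; y0 k; y1 k] -> irr_ideal v.
Proof.
move=> h; have hi : (index v [:: x0 k; x1 k; y0 k; y1 k] < 4)%N by rewrite index_mem.
exists (fun i => (i == Ordinal hi)%:R); rewrite (bigD1 (Ordinal hi)) //= eqxx mul1r.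
by rewrite nth_index // big1 ?addr0 // => i /negPf ->; rewrite mul0r.
Qed.

Lemma irr_L1 (R : P1 k) : irr_ideal (L1 R).
Proof.
have [_ JD JM] := is_ideal_gen [:: x0 k; x1 k; y0 k; y1 k].
rewrite /L1 -scaleNr -!mul_mpolyC; apply: (JD); apply: JM; apply: irr_var.
  by rewrite !inE eqxx.
by rewrite !inE eqxx orbT.
Qed.

Lemma irr_L2 (Q : P1 k) : irr_ideal (L2 Q).
Proof.
have [_ JD JM] := is_ideal_gen [:: x0 k; x1 k; y0 k; y1 k].
rewrite /L2 -scaleNr -!mul_mpolyC; apply: (JD); apply: JM; apply: irr_var.
  by rewrite !inE eqxx !orbT.
by rewrite !inE eqxx !orbT.
Qed.
End FamilyResolution.

(** * The minimal resolution *)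

Section StaircaseResolution.
Local Open Scope ring_scope.
Variable k : closedFieldType.
Local Notation S := {mpoly k[4]}.
Variable la : seq nat.
Hypothesis la_part : is_partition la.
Hypothesis la_gt0 : (0 < size la)%N.
Variables Rf Qf : nat -> P1 k.
Hypothesis R_inj : forall i j, (i < size la)%N -> (j < size la)%N -> Rf i = Rf j -> i = j.
Hypothesis Q_inj : forall i j, (i < hgt la 0)%N -> (j < hgt la 0)%N -> Qf i = Qf j -> i = j.
Variable X : {fset P1 k * P1 k}.
Local Notation p := (brk la).
Local Notation q := (hgt la).
Local Notation n := (ndesc la).+1.
Hypothesis X_pts : staircase_pts Rf Qf p q n X.
Local Notation A := (row_factor Rf p).
Local Notation B := (col_factor Qf q).

Lemma brk_step a : (a < n)%N -> (p a <= p a.+1)%N.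
Proof. by move=> an; apply: brk_le => //; lia. Qed.

Lemma hgt_step a : (a < n)%N -> (q a.+1 <= q a)%N.
Proof. by move=> an; apply: hgt_le => //; lia. Qed.

Lemma brkn_gt0 : (0 < p n)%N.
Proof. by rewrite brkn. Qed.

Definition quad_gen (x : nat * nat) : S := gen A B n x.1 * gen A B n x.2.

(** The coefficient of e_(x.1) e_(x.2) in l_(y.1) e_(y.2); the last guard prevents doubling when the
    two indices of x agree. *)
Definition quad_rel (y x : nat * nat) : S :=
  lin A B y.1 x.1 *+ (y.2 == x.2) + lin A B y.1 x.2 *+ (y.2 == x.1) *+ (x.1 != x.2).

(** The coefficient of f_(y.1) (x) e_(y.2) in the image of f_(z.1) /\ f_(z.2). *)
Definition koszul_rel (z y : nat * nat) : S :=
  lin A B z.2 y.2 *+ (y.1 == z.1) - lin A B z.1 y.2 *+ (y.1 == z.2).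

Lemma sum_quad_gen v :
  \sum_(x <- pairs_le la) v x * quad_gen x = quad_eval A B n (fun s t => v (s, t)).
Proof.
rewrite /pairs_le big_allpairs_dep /quad_eval /index_iota subn0.
by apply: eq_bigr => t _; rewrite subn0.
Qed.

Lemma sum_nat_eqb m a (F : nat -> S) :
  \sum_(0 <= s < m) F s *+ (s == a) = F a *+ (a < m)%N.
Proof.
case: (leqP a m) => [|ma]; first exact: sum_nat_eqS.
rewrite ltnNge (ltnW ma) big_nat big1 // => s /andP[_ sm].
by rewrite ltn_eqF ?mulr0n // (ltn_trans sm).
Qed.

Lemma sum_quad_rel w s t : (s <= n)%N -> (t <= n)%N ->
  \sum_(y <- pairs_all la) w y * quad_rel y (s, t) =
  sym2 (lin_mul A B n (fun a b => w (a, b))) s t.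
Proof.
move=> sn tn; rewrite /pairs_all big_allpairs_dep /sym2 /lin_mul -sumrMnl -big_split.
rewrite [RHS](_ : _ = \sum_(a <- iota 0 n) (lin A B a s * w (a, t) +
   lin A B a t * w (a, s) *+ (s != t))); last by rewrite /index_iota subn0.
apply: eq_bigr => a _; rewrite /quad_rel /=.
transitivity (\sum_(0 <= b < n.+1) (w (a, b) * lin A B a s) *+ (b == t) +
  \sum_(0 <= b < n.+1) (w (a, b) * lin A B a t *+ (s != t)) *+ (b == s)).
  rewrite -big_split /index_iota subn0; apply: eq_bigr => b _ /=.
  rewrite mulrDr mulrnAr; congr (_ + _).
  by case: (b == s); case: (s != t); rewrite /= ?mulr0n ?mulr1n ?mulr0.
by rewrite !sum_nat_eq ?ltnS // [w _ * _]mulrC [w (a, s) * _]mulrC.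
Qed.

Lemma sum_koszul_rel v c d : (c < n)%N ->
  \sum_(z <- pairs_lt la) v z * koszul_rel z (c, d) =
  koszul A B n (fun a b => v (a, b)) c d.
Proof.
move=> cn; rewrite /pairs_lt big_allpairs_dep /koszul.
transitivity (\sum_(0 <= b < n) ((v (c, b) * lin A B b d) *+ (c < b)%N -
   (\sum_(0 <= a < b) v (a, b) * lin A B a d) *+ (b == c))).
  rewrite [RHS](_ : _ = \sum_(b <- iota 0 n) ((v (c, b) * lin A B b d) *+ (c < b)%N -
     (\sum_(0 <= a < b) v (a, b) * lin A B a d) *+ (b == c))); last by rewrite /index_iota subn0.
  apply: eq_bigr => b _.
  transitivity (\sum_(0 <= a < b) (v (a, b) * lin A B b d) *+ (a == c) -
    \sum_(0 <= a < b) v (a, b) * lin A B a d *+ (b == c)).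
    rewrite -sumrB /index_iota subn0; apply: eq_bigr => a _; rewrite /koszul_rel /=.
    by rewrite mulrBr !mulrnAr [c == a]eq_sym [c == b]eq_sym.
  by rewrite sum_nat_eqb sumrMnl.
rewrite big_split /= sumrN sum_nat_eq //.
under [RHS]eq_bigr => j _ do rewrite /alt mulrBl !mulrnAl.
rewrite [RHS]big_split /= sumrN; congr (_ - _).
rewrite (big_nat_widen 0 c n _ _ (ltnW cn)) big_mkcond /=.
by apply: eq_bigr => j _; case: (j < c)%N.
Qed.

Lemma shift_hom_row_factor a b : (a < n)%N -> shift_hom (A a) (p a, b) (p a.+1, b).
Proof.
move=> an m /shift_hom_prodL1 h; have := h (p a) b; rewrite size_map size_iota subnK //.
by apply: brk_le => //; lia.
Qed.

Lemma shift_hom_col_factor a b : (a < n)%N -> shift_hom (B a) (b, q a.+1) (b, q a).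
Proof.
move=> an m /shift_hom_prodL2 h; have := h b (q a.+1); rewrite size_map size_iota subnK //.
by apply: hgt_le => //; lia.
Qed.

Lemma shift_hom_lin a s : (a < n)%N -> shift_hom (lin A B a s) (p s, q s) (p a.+1, q a).
Proof.
move=> an; apply: shift_homD; [|apply: shift_homN]; apply: shift_homMb => /eqP ->.
  exact: shift_hom_row_factor.
exact: shift_hom_col_factor.
Qed.

Lemma shift_hom_gen s : (s <= n)%N -> shift_hom (gen A B n s) (0, 0)%N (p s, q s).
Proof.
move=> sn; rewrite (gen_factors Rf Qf (brk0 la) brk_step brkn_gt0 (hgtn la) hgt_step) //.
apply: (@shift_homM _ _ _ _ (0, q s)%N).
  rewrite -(big_map Rf xpredT (@L1 k)) => m /shift_hom_prodL1 h; have := h 0%N (q s).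
  by rewrite size_map size_iota subn0 addn0.
rewrite -(big_map Qf xpredT (@L2 k)) => m /shift_hom_prodL2 h; have := h 0%N 0%N.
by rewrite size_map size_iota subn0 addn0.
Qed.

(** Minimality rests on the strict growth of the breaks: each block has at least one row, hence a
    linear factor. *)
Lemma irr_row_factor a : (a < n)%N -> irr_ideal (A a).
Proof.
move=> an; have h : (p a < p a.+1)%N by apply: brk_lt => //; lia.
rewrite /row_factor big_map big_ltn //; apply: idealMr (irr_L1 _).
exact: is_ideal_gen.
Qed.

Lemma irr_col_factor a : (a < n)%N -> irr_ideal (B a).
Proof.
move=> an; have h : (q a.+1 < q a)%N by apply: hgt_lt => //; lia.
rewrite /col_factor big_map big_ltn //; apply: idealMr (irr_L2 _).
exact: is_ideal_gen.
Qed.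

Lemma irr_mulb (f : S) (b : bool) : irr_ideal f -> irr_ideal (f *+ b).
Proof.
have [J0 _ _] := is_ideal_gen [:: x0 k; x1 k; y0 k; y1 k].
by case: b.
Qed.

Lemma irr_lin a s : (a < n)%N -> irr_ideal (lin A B a s).
Proof.
have [J0 JD JM] := is_ideal_gen [:: x0 k; x1 k; y0 k; y1 k].
move=> an; rewrite /lin -mulN1r; apply: JD; last apply: JM; apply: irr_mulb.
  exact: irr_row_factor.
exact: irr_col_factor.
Qed.

Lemma mem_pairs_le x : (x \in pairs_le la) = (x.1 <= x.2 <= n)%N.
Proof.
case: x => s t; apply/allpairsPdep/idP => [[t' [s' []]]|h].
  by rewrite !mem_iota => ? ? [-> ->] /=; lia.
by exists t, s; rewrite !mem_iota; split=> //; move: h => /=; lia.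
Qed.

Lemma mem_pairs_all x : (x \in pairs_all la) = (x.1 < n)%N && (x.2 <= n)%N.
Proof.
case: x => s t; apply/allpairsPdep/idP => [[t' [s' []]]|h].
  by rewrite !mem_iota => ? ? [-> ->] /=; lia.
by exists s, t; rewrite !mem_iota; split=> //; move: h => /=; lia.
Qed.

Lemma mem_pairs_lt x : (x \in pairs_lt la) = (x.1 < x.2 < n)%N.
Proof.
case: x => s t; apply/allpairsPdep/idP => [[t' [s' []]]|h].
  by rewrite !mem_iota => ? ? [-> ->] /=; lia.
by exists t, s; rewrite !mem_iota; split=> //; move: h => /=; lia.
Qed.

Lemma staircase_resolution : has_min_resolution (I_dbl X) (SZ0 la) (SZ1 la) (SZ2 la).
Proof.
have hA a : (a < n)%N -> xprod (A a) by move=> _; apply: xprod_row_factor.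
have hbs := cols_disjoint (brk0 la) brkn_gt0 (hgtn la) hgt_step Q_inj.
have hB := @xy_nzd k (fun a => [seq Qf j | j <- index_iota (q a.+1) (q a)]) n.
have hAB := @xy_nzd_mod k A (fun a => [seq Qf j | j <- index_iota (q a.+1) (q a)]) n hA.
apply: (min_resolution_of_families (D0 := quad_gen) (D1 := quad_rel) (D2 := koszul_rel)
  _ _ _ (SZ0_perm la_part la_gt0) (SZ1_perm la_part la_gt0) (SZ2_perm la_part la_gt0)).
- by apply: allpairs_uniq_dep => [|? _|[? ?] [? ?] _ _ /= [-> ->]] //; apply: iota_uniq.
- by apply: allpairs_uniq; rewrite ?iota_uniq // => -[? ?] [? ?].
- by apply: allpairs_uniq_dep => [|? _|[? ?] [? ?] _ _ /= [-> ->]] //; apply: iota_uniq.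
- case=> s t; rewrite mem_pairs_le /= => /andP[st tn].
  rewrite /quad_gen /deg0 /=; apply: (@shift_homM _ _ _ _ (p t, q t)).
    exact: (@shift_homD2 _ _ 0%N 0%N (p s) (p t) (q s) (q t) (shift_hom_gen (leq_trans st tn))).
  exact: shift_hom_gen.
- case=> a b [s t]; rewrite mem_pairs_all mem_pairs_le /= => /andP[an bn] st.
  rewrite /quad_rel /deg0 /deg1 /=; apply: shift_homD.
    by apply: shift_homMb => /eqP ->; apply/shift_homD2/shift_hom_lin.
  apply: shift_homMb => _; apply: shift_homMb => /eqP ->; rewrite addnC [(q s + _)%N]addnC.
  by apply/shift_homD2/shift_hom_lin.
- case=> a b [c d]; rewrite mem_pairs_lt mem_pairs_all /= => abn /andP[cn dn].
  rewrite /koszul_rel /deg1 /deg2 /=; apply: shift_homD; [|apply: shift_homN];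
    apply: shift_homMb => /eqP ->.
    rewrite addnC [(q a + q d)%N]addnC [(p a.+1 + _)%N]addnC [(q a + _)%N]addnC.
    by apply/shift_homD2/shift_hom_lin; lia.
  rewrite addnC [(q b + q d)%N]addnC.
  by apply/shift_homD2/shift_hom_lin; lia.
- case=> a b [s t]; rewrite mem_pairs_all /= => /andP[an bn] _; rewrite /quad_rel /=.
  have [J0 JD JM] := is_ideal_gen [:: x0 k; x1 k; y0 k; y1 k].
  by apply: JD; [|apply: irr_mulb]; apply: irr_mulb; apply: irr_lin.
- case=> a b [s t]; rewrite mem_pairs_lt /= => abn _; rewrite /koszul_rel -mulN1r.
  have [J0 JD JM] := is_ideal_gen [:: x0 k; x1 k; y0 k; y1 k].
  by apply: JD; last apply: JM; apply: irr_mulb; apply: irr_lin => /=; lia.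
- move=> f; rewrite (I_dbl_square (brk0 la) brk_step brkn_gt0 (hgtn la) hgt_step _ Q_inj X_pts).
    2: by rewrite brkn.
  split=> [[v ->]|[v ->]]; first by exists (fun x => v x.1 x.2); rewrite sum_quad_gen.
  by rewrite sum_quad_gen; eexists.
- move=> v; rewrite sum_quad_gen => /(xy_quad_syz hA hbs)[w hw].
  exists (fun y => w y.1 y.2) => -[s t]; rewrite mem_pairs_le /= => st.
  by rewrite sum_quad_rel ?hw //; lia.
- move=> w; rewrite sum_quad_gen -[RHS](quad_eval_lin_mul A B n (fun a b => w (a, b))).
  by apply: quad_eval_ext => s t st; rewrite sum_quad_rel //; lia.
- move=> v hv; have [|u hu] := @koszul_exact _ A B n n (fun a b => v (a, b)) (leqnn _) hB hAB.
    move=> s t st; rewrite -sum_quad_rel; [|lia|lia].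
    by apply: hv; rewrite mem_pairs_le.
  exists (fun z => u z.1 z.2) => -[a b]; rewrite mem_pairs_all /= => /andP[an bn].
  by rewrite sum_koszul_rel // hu.
- move=> w [s t]; rewrite mem_pairs_le /= => st; rewrite sum_quad_rel; [|lia|lia].
  rewrite -[RHS](lin_mul_koszul A B n (fun a b => w (a, b)) s t) /sym2.
  have E s' t' : lin_mul A B n (fun a b => \sum_(z <- pairs_lt la) w z * koszul_rel z (a, b)) s' t'
     = lin_mul A B n (koszul A B n (fun a b => w (a, b))) s' t'.
    by apply: eq_big_nat => a /andP[_ an]; rewrite sum_koszul_rel.
  by rewrite !E.
- move=> v hv [a b]; rewrite mem_pairs_lt /= => abn.
  apply: (@koszul_inj _ A B n (fun a b => v (a, b)) hB) => // c d cn dn.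
  by rewrite -sum_koszul_rel // hv // mem_pairs_all cn.
Qed.
End StaircaseResolution.

(** * From nested rows to a staircase *)

Section ChainOfFibers.

(** One ordering of the columns serves all rows: starting from the smallest set of the chain, the
    new elements of each larger set are appended at the end, so earlier prefixes survive. *)
Lemma chain_enumeration (T : eqType) (fs : seq (seq T)) : (forall f, f \in fs -> uniq f) ->
  (forall i, i.+1 < size fs -> {subset nth [::] fs i.+1 <= nth [::] fs i}) ->
  exists2 s, uniq s & s =i head [::] fs /\
    forall i, i < size fs -> nth [::] fs i =i take (size (nth [::] fs i)) s.
Proof.
elim: fs => [|f fs IH] hu hs; first by exists [::].
have [||s us [sh st]] := IH.
- by move=> g gfs; apply: hu; rewrite inE gfs orbT.
- by move=> i hi; apply: (hs i.+1).
have uf : uniq f by apply: hu; rewrite mem_head.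
have sf : {subset s <= f}.
  move=> x; rewrite sh; case: {IH st sh hu} fs hs => [|g fs] hs //= xg.
  exact: (hs 0 isT).
have mf : s ++ [seq x <- f | x \notin s] =i f.
  move=> x; rewrite mem_cat mem_filter; case xs: (x \in s) => //=.
  by rewrite (sf x xs).
have ucat : uniq (s ++ [seq x <- f | x \notin s]).
  rewrite cat_uniq us filter_uniq // andbT; apply/hasPn => x.
  by rewrite mem_filter => /andP[].
exists (s ++ [seq x <- f | x \notin s]) => //; split=> // -[|i] hi x.
  rewrite /= -mf; congr (_ \in _); rewrite take_oversize //.
  by rewrite (perm_size (uniq_perm ucat uf mf)).
rewrite /= st // take_cat; case: ltnP => // h.
rewrite [RHS]mem_cat take_oversize //.
set d := size _ - size s; have -> : d = 0; last by rewrite take0 orbF.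
apply/eqP; rewrite subn_eq0; apply: uniq_leq_size.
  by apply: hu; rewrite inE mem_nth ?orbT.
by move=> y; rewrite st // => /mem_take.
Qed.

Variable k : fieldType.
Variable X : {fset P1 k * P1 k}.

Lemma fiber_partition : exists2 rows : seq (P1 k), uniq rows &
  rows =i proj1_pts X /\ [seq size (fiber X R) | R <- rows] = alpha X.
Proof.
exists (sort (relpre (fun R => size (fiber X R)) geq) (enum_fset (proj1_pts X))).
  by rewrite sort_uniq fset_uniq.
split; first by move=> R; rewrite mem_sort.
rewrite -sort_map /alpha; congr sort; apply: eq_map => R.
by rewrite size_fiber.
Qed.
End ChainOfFibers.

Lemma ACM_staircase (k : fieldType) (la : seq nat) (X : {fset P1 k * P1 k}) :
  is_partition la -> 0 < size la -> ACM X -> alpha X = la ->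
  exists Rf Qf : nat -> P1 k,
  [/\ forall i j, i < size la -> j < size la -> Rf i = Rf j -> i = j,
      forall i j, i < hgt la 0 -> j < hgt la 0 -> Qf i = Qf j -> i = j &
      staircase_pts Rf Qf (brk la) (hgt la) (ndesc la).+1 X].
Proof.
move=> la_part la_gt0 acm al; have [rows ur [mr]] := fiber_partition X; rewrite al => szr.
have rr : size rows = size la by rewrite -szr size_map.
have [R0 _] : exists R0 : P1 k, true.
  by case: rows rr {ur mr szr} => [|R0 ?] rr; [move: la_gt0; rewrite -rr | exists R0].
pose Rf := nth R0 rows; pose fs := [seq fiber X R | R <- rows].
have sf i : i < size la -> size (fiber X (Rf i)) = nth 0 la i.
  by move=> ila; rewrite -szr (nth_map R0) ?rr.
have nth_fs i : i < size la -> nth [::] fs i = fiber X (Rf i).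
  by move=> ila; rewrite (nth_map R0) ?rr.
have sfs : size fs = size la by rewrite size_map.
have [f /mapP[R _ ->]|i|cols uc [hc tc]] := @chain_enumeration _ fs.
- exact: uniq_fiber.
- rewrite sfs => ila; rewrite (nth_fs _ ila) (nth_fs _ (ltnW ila)).
  (* If the inclusion goes the other way, the decreasing sizes force equality. *)
  have [sub|sub] := ACM_nested (Rf i.+1) (Rf i) acm; first exact: sub.
  have le : size (fiber X (Rf i.+1)) <= size (fiber X (Rf i)).
    by rewrite (sf _ ila) (sf _ (ltnW ila)); apply: L_mono.
  have [_ e] := uniq_min_size (uniq_fiber X (Rf i)) sub le.
  by move=> Q hQ; exact: (etrans (e Q) hQ).
have scols : size cols = hgt la 0.
  have -> : hgt la 0 = size (fiber X (Rf 0)) by rewrite sf.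
  apply/perm_size/uniq_perm => //; first exact: uniq_fiber.
  by move=> Q; rewrite hc -nth0 nth_fs.
have mem_col i Q : i < size la -> (Q \in fiber X (Rf i)) = (Q \in take (nth 0 la i) cols).
  by move=> ila; rewrite -nth_fs // tc ?sfs // nth_fs // sf.
have le_cols i : nth 0 la i <= size cols by rewrite scols; apply: L_mono.
exists Rf, (nth R0 cols); split.
- by move=> i j ila jla /eqP; rewrite nth_uniq ?rr // => /eqP.
- by move=> i j; rewrite -scols => hi hj /eqP; rewrite nth_uniq // => /eqP.
move=> R Q; split=> [RQ|[a [i [j [an hi hj -> ->]]]]].
  have hR : R \in rows by rewrite mr; apply/imfsetP; exists (R, Q).
  have ila : index R rows < size la by rewrite -rr index_mem.
  have eR : R = Rf (index R rows) by rewrite /Rf nth_index.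
  have [|a an ha] := @block_index (brk la) (ndesc la).+1 (index R rows) (brk0 la).
    by rewrite brkn.
  have := RQ; rewrite -mem_fiber {1}eR mem_col // (block la_part la_gt0 an ha) => hQ.
  exists a, (index R rows), (index Q cols); split=> //.
    exact: index_ltn hQ.
  by rewrite nth_index // (mem_take hQ).
have ila : i < size la.
  have := @brk_le la la_part la_gt0 a.+1 (ndesc la).+1; rewrite brkn; lia.
rewrite -mem_fiber mem_col // (block la_part la_gt0 an hi).
have sq : hgt la a <= size cols by apply: le_cols.
by rewrite -(nth_take R0 hj) mem_nth // size_takel.
Qed.

Theorem mainTheorem2 (k : closedFieldType) (k_char0 : [pchar k]%R =i pred0)
  (la : seq nat) (la_partition : is_partition la) (la_nonempty : 0 < size la)
  (X : {fset P1 k * P1 k}) (X_ACM : ACM X) (X_alpha : alpha X = la) :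
  has_min_resolution (I_dbl X) (SZ0 la) (SZ1 la) (SZ2 la).
Proof.
have [Rf [Qf [hR hQ hX]]] := ACM_staircase la_partition la_nonempty X_ACM X_alpha.
exact: (staircase_resolution la_partition la_nonempty hR hQ hX).
Qed.
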